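(* Let $1\le k<l$. The Frobenius manifolds $\mathcal M=\mathcal M^{(k,k+1)}(A_l)\setminus(\{\tilde y_{l+1}=0\}\cup\{\tilde y_{l+2}=0\})$ and $\mathbb M_{k,l-k+1,1}$ are locally isomorphic.
   Context: **Group and orbit space.** Let $\mathbb R^{l+1}$ have orthonormal basis $\epsilon_1,\dots,\epsilon_{l+1}$, $V=\{\sum v_s\epsilon_s:\sum v_s=0\}$ with the induced inner product $(\,,\,)$, $\alpha_j=\alpha_j^\vee=\epsilon_j-\epsilon_{j+1}$, $\omega_1,\dots,\omega_l\in V$ the fundamental weights ($(\omega_i,\alpha_j^\vee)=\delta_{ij}$), $W$ the Weyl group of type $A_l$ (permutations of $v_1,\dots,v_{l+1}$). Coordinates on $V$: $\mathbf x=\sum x_j\alpha_j^\vee$, i.e. $v_1=x_1$, $v_j=x_j-x_{j-1}$ ($2\le j\le l$), $v_{l+1}=-x_l$; $y_j(\mathbf x)=\sigma_j(e^{2\pi i v_1},\dots,e^{2\pi i v_{l+1}})$ (elementary symmetric functions). The group $\widetilde W=\widetilde W^{(k,k+1)}(A_l)$ acts on $V\oplus\mathbb R^2\ni(\mathbf x,x_{l+1},x_{l+2})$ and is generated by the maps $(w(\mathbf x)+\sum m_j\alpha_j^\vee,x_{l+1},x_{l+2})$ ($w\in W,m_j\in\mathbb Z$), $(\mathbf x+\omega_k,x_{l+1}-1,x_{l+2})$, $(\mathbf x+\omega_{k+1},x_{l+1},x_{l+2}-1)$. With $d_{j,r}=(\omega_j,\omega_r)$ put $\tilde y_j=e^{2\pi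 i(d_{j,k}x_{l+1}+d_{j,k+1}x_{l+2})}y_j(\mathbf x)$ ($1\le j\le l$), $\tilde y_{l+1}=e^{2\pi i x_{l+1}}$, $\tilde y_{l+2}=e^{2\pi i x_{l+2}}$; these are global coordinates on the orbit space $\mathcal M^{(k,k+1)}(A_l)$ of $\widetilde W$ (acting on the complexification of $V\oplus\mathbb R^2$). On $\mathcal M$ use local coordinates $y^j=\tilde y_j$ ($j\le l$), $y^{l+1}=\log\tilde y_{l+1}$, $y^{l+2}=\log\tilde y_{l+2}$. **Frobenius structure on $\mathcal M$.** Let $(dx_a,dx_b)^\sim=\frac1{4\pi^2}(\omega_a,\omega_b)$ for $1\le a,b\le l$; $(dx_{l+1},dx_{l+1})^\sim=-\frac1{4\pi^2}\frac{k+1}{k}$, $(dx_{l+1},dx_{l+2})^\sim=\frac1{4\pi^2}$, $(dx_{l+2},dx_{l+2})^\sim=-\frac1{4\pi^2}\frac{l-k+1}{l-k}$; other pairings $0$. The Frobenius manifold structure on $\mathcal M$ is the unique one of charge $1$ with intersection form $g^{ij}(y)=\sum_{a,b}\frac{\partial y^i}{\partial x_a}\frac{\partial y^j}{\partial x_b}(dx_a,dx_b)^\sim$, unit $e=\frac{\partial}{\partial y^k}+\frac{\partial}{\partial y^{k+1}}$, flat (contravariant) metric $\eta^{ij}(y)=e(g^{ij}(y))$, Euler field $E=\sum_{\alpha=1}^l d_\alpha y^\alpha\frac{\partial}{\partial y^\alpha}+\frac1k\frac{\partial}{\partial y^{l+1}}+\frac1{l-k}\frac{\partial}{\partial y^{l+2}}$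 with $d_j=\frac jk$ ($j\le k$), $d_j=\frac{l-j+1}{l-k}$ ($k+1\le j\le l$). (The intersection form of a Frobenius manifold is the bilinear form $i_E(\omega_1\cdot\omega_2)$ on the cotangent bundle, with cotangent vectors multiplied via the flat metric.) **Frobenius structure on $\mathbb M_{k,l-k+1,1}$.** $\mathbb M_{k,l-k+1,1}$ is the space of functions $$\lambda(\varphi)=(e^{i\varphi}-a_{l+2})^{-1}\left(e^{i(k+1)\varphi}+a_1e^{ik\varphi}+\dots+a_{l+1}e^{i(k-l)\varphi}\right),\quad a_j\in\mathbb C,\ a_{l+1}a_{l+2}\ne0,$$ (the coefficient of $e^{i(k+1-j)\varphi}$ in the numerator is $a_j$ for $1\le j\le l+1$). For tangent vectors at $\lambda$, $$\widetilde\eta(\partial',\partial'')=(-1)^{k+1}\sum_{|\lambda|<\infty}\operatorname*{res}_{d\lambda=0}\frac{\partial'(\lambda\,d\varphi)\,\partial''(\lambda\,d\varphi)}{d\lambda},\qquad \widetilde g(\partial',\partial'')=-\sum_{|\lambda|<\infty}\operatorname*{res}_{d\lambda=0}\frac{\partial'(\log\lambda\,d\varphi)\,\partial''(\log\lambda\,d\varphi)}{d\log\lambda},$$ $$\widetilde\eta(\partial'\cdot\partial'',\partial''')=-\sum_{|\lambda|<\infty}\operatorname*{res}_{d\lambda=0}\frac{\partial'(\lambda\,d\varphi)\,\partial''(\lambda\,d\varphi)\,\partial'''(\lambda\,d\varphi)}{d\lambda\,d\varphi},$$ where derivatives are taken at fixed $\varphi$ and the sums are over the critical points of $\lambda$ (mod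 $2\pi$) with finite $\lambda$. $\widetilde\eta$ is the flat metric, $\widetilde g$ (as a covariant form, inverse to the form on the cotangent bundle) the intersection form, and the Euler field is $E=\sum_{j=1}^{l+1}\frac jk a_j\frac{\partial}{\partial a_j}+\frac1k a_{l+2}\frac{\partial}{\partial a_{l+2}}$. Both structures are considered at the points where they are defined: in $\mathbb M_{k,l-k+1,1}$, where the numerator of $\lambda$ does not vanish at $e^{i\varphi}=a_{l+2}$; in $\mathcal M$, where the potential (which has a term $\frac12(t^{k+1})^2\log t^{k+1}$ in flat coordinates) is regular. ''Locally isomorphic'' means related by a local biholomorphism preserving flat metric, product, unit and Euler field. *)

(* Defs.v *)
From HB Require Import structures.
From mathcomp Require Import all_boot all_order all_fingroup all_algebra.
From mathcomp Require Import complex.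
From mathcomp Require Import all_classical all_reals all_analysis.
From Stdlib Require Import Relation_Operators.

Set Implicit Arguments.
Unset Strict Implicit.
Unset Printing Implicit Defensive.

Import Order.TTheory GRing.Theory Num.Theory numFieldNormedType.Exports.

Local Open Scope classical_set_scope.
Local Open Scope ring_scope.
Local Open Scope complex_scope.

(* R[i] has no topology of its own in the libraries: it is given that of the   *)
(* normed module (R[i])^o, i.e. that of its modulus.                           *)
#[non_forgetful_inheritance]
HB.instance Definition _ (R : realType) :=
  PseudoPointedMetric.copy R[i] (R[i])^o.

(* Indices run from 1 as in the mathematics, those of matrices from 0.         *)
Definition co {R : realType} {n : nat} (p : 'rV[R[i]]_n.+1) (j : nat) : R[i] :=
  p 0 (inord j.-1).

Definition dir {R : realType} {n : nat} (j : nat) : 'rV[R[i]]_n.+1 :=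
  delta_mx 0 (inord j.-1).

Definition cexp {R : realType} (z : R[i]) : R[i] :=
  (expR (complex.Re z))%:C *
  (cos (complex.Im z) +i* sin (complex.Im z)).

Definition inner {R : realType} {n : nat} (u v : 'rV[R[i]]_n) : R[i] :=
  (u *m v^T) 0 0.

(* Tangent vectors, vector fields and covectors are rows of components with    *)
(* respect to the standard coordinates; metric is the covariant Gram matrix.   *)
Record frob_data (R : realType) (n : nat) := FrobData {
  metric : 'rV[R[i]]_n -> 'M[R[i]]_n;
  mult   : 'rV[R[i]]_n -> 'rV[R[i]]_n -> 'rV[R[i]]_n -> 'rV[R[i]]_n;
  unitv  : 'rV[R[i]]_n -> 'rV[R[i]]_n;
  euler  : 'rV[R[i]]_n -> 'rV[R[i]]_n
}.

Section FrobeniusStructure.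
Context {R : realType} {n : nat}.
Implicit Types (F : frob_data R n) (D : set 'rV[R[i]]_n).
Implicit Types (p q u v w z a b : 'rV[R[i]]_n).

Definition eta F p u v : (R[i])^o := (u *m metric F p *m v^T) 0 0.

(* Koszul formula: [gamma F p u v] is the Levi-Civita derivative at p, in the  *)
(* direction u, of the vector field with constant components v.                *)
Definition koszul F p u v w : R[i] :=
  2^-1 * ('D_u (fun q => eta F q v w) p + 'D_v (fun q => eta F q u w) p
          - 'D_w (fun q => eta F q u v) p).

Definition gamma F p u v : 'rV[R[i]]_n :=
  (\row_j koszul F p u v (delta_mx 0 j)) *m invmx (metric F p).

Definition nabla F (u : 'rV[R[i]]_n) (X : 'rV[R[i]]_n -> 'rV[R[i]]_n) p :
    'rV[R[i]]_n :=
  'D_u X p + gamma F p u (X p).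

Definition c3 F p u v w : (R[i])^o := eta F p (mult F p u v) w.

Definition nabla_c3 F p z u v w : R[i] :=
  'D_z (fun q => c3 F q u v w) p
  - c3 F p (gamma F p z u) v w - c3 F p u (gamma F p z v) w
  - c3 F p u v (gamma F p z w).

(* All the identities below are tensorial, so that they are stated for vector  *)
(* fields u, v, w with constant components; the Lie bracket is then            *)
(* [E, u] = - D_u E.                                                           *)
Record frobenius_structure (d : R[i]) D F : Prop := FrobeniusStructure {
  frob_open : open D;
  frob_metric_holo : forall p, D p -> differentiable (metric F) p;
  frob_mult_holo : forall p u v, D p ->
    differentiable (fun q => mult F q u v) p;
  frob_unit_holo : forall p, D p -> differentiable (unitv F) p;
  frob_euler_holo : forall p, D p -> differentiable (euler F) p;
  frob_mult_lin : forall p (s : R[i]) u v w, D p ->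
    mult F p (s *: u + v) w = s *: mult F p u w + mult F p v w;
  frob_mult_comm : forall p u v, D p -> mult F p u v = mult F p v u;
  frob_mult_assoc : forall p u v w, D p ->
    mult F p u (mult F p v w) = mult F p (mult F p u v) w;
  frob_unitE : forall p u, D p -> mult F p (unitv F p) u = u;
  frob_metric_sym : forall p, D p -> (metric F p)^T = metric F p;
  frob_metric_nondeg : forall p, D p -> metric F p \in unitmx;
  frob_invariant : forall p u v w, D p ->
    eta F p (mult F p u v) w = eta F p u (mult F p v w);
  frob_flat : forall p u v w, D p ->
    nabla F u (nabla F v (fun=> w)) p = nabla F v (nabla F u (fun=> w)) p;
  frob_unit_flat : forall p u, D p -> nabla F u (unitv F) p = 0;
  frob_potential : forall p z u v w, D p ->
    nabla_c3 F p z u v w = nabla_c3 F p u z v w;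
  frob_euler_affine : forall p u v, D p ->
    nabla F u (nabla F v (euler F)) p = nabla F (gamma F p u v) (euler F) p;
  frob_euler_mult : forall p u v, D p ->
    'D_(euler F p) (fun q => mult F q u v) p - 'D_(mult F p u v) (euler F) p
    + mult F p ('D_u (euler F) p) v + mult F p u ('D_v (euler F) p)
    = mult F p u v;
  frob_euler_metric : forall p u v, D p ->
    'D_(euler F p) (fun q => eta F q u v) p
    + eta F p ('D_u (euler F) p) v + eta F p u ('D_v (euler F) p)
    = (2 - d) * eta F p u v
}.

Definition sharp F p a : 'rV[R[i]]_n := a *m invmx (metric F p).

(* The intersection form i_E(a . b) of two covectors: a . b is the covector    *)
(* eta(sharp a . sharp b, _).                                                  *)
Definition intersection F p a b : (R[i])^o :=
  eta F p (mult F p (sharp F p a) (sharp F p b)) (euler F p).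

Definition local_biholomorphism D (Phi : 'rV[R[i]]_n -> 'rV[R[i]]_n) : Prop :=
  forall p, D p -> exists (U : set 'rV[R[i]]_n) (Psi : 'rV[R[i]]_n -> 'rV[R[i]]_n),
    [/\ open U, U p, U `<=` D, open (Phi @` U) &
     [/\ forall q, U q -> differentiable Phi q,
         forall q, (Phi @` U) q -> differentiable Psi q &
         forall q, U q -> Psi (Phi q) = q]].

Definition preserves_structure F1 F2 (Phi : 'rV[R[i]]_n -> 'rV[R[i]]_n) p :
    Prop :=
  [/\ forall u v, eta F2 (Phi p) ('d Phi p u) ('d Phi p v) = eta F1 p u v,
      forall u v, 'd Phi p (mult F1 p u v)
                  = mult F2 (Phi p) ('d Phi p u) ('d Phi p v),
      'd Phi p (unitv F1 p) = unitv F2 (Phi p) &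
      'd Phi p (euler F1 p) = euler F2 (Phi p)].

(* The equality Phi(D1) = D2 makes the relation symmetric: every point of D1   *)
(* and every point of D2 has a neighbourhood isomorphic to an open subset of   *)
(* the other manifold.                                                         *)
Definition locally_isomorphic D1 F1 D2 F2 : Prop :=
  exists Phi : 'rV[R[i]]_n -> 'rV[R[i]]_n,
    [/\ local_biholomorphism D1 Phi, Phi @` D1 = D2 &
        forall p, D1 p -> preserves_structure F1 F2 Phi p].

End FrobeniusStructure.

Section OrbitSpace.
Context {R : realType} {l : nat}.

Definition alpha (j : nat) : 'rV[R[i]]_l.+1 := dir j - dir j.+1.

Definition omega (r : nat) : 'rV[R[i]]_l.+1 :=
  \sum_(1 <= s < r.+1) dir s - (r%:R / l.+1%:R) *: const_mx 1.

Lemma omega_sum (r : nat) : (r <= l)%N -> inner (omega r) (const_mx 1) = 0.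
Proof.
move=> rl; rewrite /inner /omega mulmxBl mulmx_suml.
rewrite mxE summxE !mxE (eq_bigr (fun=> 1)); last first.
  move=> s _; rewrite !mxE (bigD1 (inord s.-1)) //= big1 ?addr0; last first.
    by move=> t ht; rewrite !mxE eqxx (negbTE ht) mul0r.
  by rewrite !mxE !eqxx mul1r.
rewrite sumr_const_nat subn1 /= (eq_bigr (fun=> r%:R / l.+1%:R)); last first.
  by move=> s _; rewrite !mxE !mulr1.
by rewrite sumr_const card_ord -[X in _ - X]mulr_natr divfK ?subrr // pnatr_eq0.
Qed.

Lemma omega_alpha (r j : nat) :
  (1 <= r <= l)%N -> (1 <= j <= l)%N -> inner (omega r) (alpha j) = (r == j)%:R.
Proof.
move=> /andP[r1 rl] /andP[j1 jl].
have inE m (u : 'rV[R[i]]_l.+1) : inner u (dir m) = u 0 (inord m.-1).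
  rewrite /inner mxE (bigD1 (inord m.-1)) //= big1 ?addr0.
    by rewrite !mxE !eqxx mulr1.
  by move=> t ht; rewrite !mxE eqxx (negbTE ht) mulr0.
have omE m : (m <= l)%N ->
    omega r 0 (inord m) = (m < r)%N%:R - r%:R / l.+1%:R.
  move=> ml; rewrite !mxE mulr1 summxE; congr (_ - _).
  rewrite big_add1 /= big_mkord; have [mr|rm] := ltnP m r.
    rewrite (bigD1 (Ordinal mr)) //= big1 ?addr0 => [|s /negP hs].
      by rewrite !mxE !eqxx.
    rewrite !mxE /=; case: eqP => // /(congr1 val) /=.
    rewrite !inordK ?ltnS //; last exact: leq_trans (ltnW (ltn_ord s)) rl.
    by move=> E; case: hs; apply/eqP/val_inj.
  rewrite big1 // => s _; rewrite !mxE /=; case: eqP => // /(congr1 val) /=.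
  rewrite !inordK ?ltnS //; last exact: leq_trans (ltnW (ltn_ord s)) rl.
  by move=> E; move: (ltn_ord s); rewrite -E ltnNge rm.
have -> : inner (omega r) (alpha j) =
    inner (omega r) (dir j) - inner (omega r) (dir j.+1).
  by rewrite /inner /alpha linearB /= mulmxBr !mxE.
rewrite !inE !omE //=; last exact: leq_trans (leq_pred _) jl.
case: j j1 jl => // j _ jl /=; rewrite opprB addrA subrK.
by case: (ltngtP r j.+1) => _; rewrite /= ?subrr ?subr0.
Qed.

Definition dcoef (j r : nat) : R[i] := inner (omega j) (omega r).

(* A point of the complexification of V (+) R^2 is the row of its coordinates  *)
(* (x_1, .., x_l, x_{l+1}, x_{l+2}); [vpart] is its component in V.            *)
Definition vpart (x : 'rV[R[i]]_l.+2) : 'rV[R[i]]_l.+1 :=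
  \sum_(1 <= j < l.+1) co x j *: alpha j.

(* x' is the image of x under one of the generating maps of the group.         *)
Inductive Wtilde_gen (k : nat) (x x' : 'rV[R[i]]_l.+2) : Prop :=
| Wtilde_affine (w : 'S_l.+1) (m : nat -> int) of
    vpart x' = col_perm w (vpart x)
               + \sum_(1 <= j < l.+1) (m j)%:~R *: alpha j
    & co x' l.+1 = co x l.+1 & co x' l.+2 = co x l.+2
| Wtilde_shift1 of
    vpart x' = vpart x + omega k
    & co x' l.+1 = co x l.+1 - 1 & co x' l.+2 = co x l.+2
| Wtilde_shift2 of
    vpart x' = vpart x + omega k.+1
    & co x' l.+1 = co x l.+1 & co x' l.+2 = co x l.+2 - 1.

Definition Wtilde_orbit (k : nat) (x : 'rV[R[i]]_l.+2) : set 'rV[R[i]]_l.+2 :=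
  [set x' | clos_refl_sym_trans _ (Wtilde_gen k) x x'].

Definition esym (m j : nat) (f : 'I_m -> R[i]) : R[i] :=
  \sum_(A : {set 'I_m} | #|A| == j) \prod_(s in A) f s.

Definition twopii : R[i] := 2 * pi%:C * 'i.

Definition yfun (j : nat) (x : 'rV[R[i]]_l.+2) : R[i] :=
  esym j (fun s : 'I_l.+1 => cexp (twopii * vpart x 0 s)).

Definition ytilde (k : nat) (x : 'rV[R[i]]_l.+2) : 'rV[R[i]]_l.+2 :=
  \row_i (if (i < l)%N then
            cexp (twopii * (dcoef i.+1 k * co x l.+1
                            + dcoef i.+1 k.+1 * co x l.+2)) * yfun i.+1 x
          else cexp (twopii * x 0 i)).

(* The orbit space without the two divisors, in its global coordinates         *)
(* ytilde: a point is the common value of ytilde on an orbit.                  *)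
Definition orbit_manifold (k : nat) : set 'rV[R[i]]_l.+2 :=
  [set p | (exists x, ytilde k @` Wtilde_orbit k x = [set p])
           /\ co p l.+1 != 0 /\ co p l.+2 != 0].

(* The flat coordinate t^{k+1} up to a nonzero constant factor: the solutions  *)
(* f of nabla df = 0, e(f) = 0, E(f) = f are the multiples of this function.   *)
(* In terms of the Landau-Ginzburg superpotential lambda it is the residue of  *)
(* lambda dz/z, z = e^{i phi}, at its finite pole. The potential of the        *)
(* orbit space is singular exactly where it vanishes.                          *)
Definition tsing (k : nat) (p : 'rV[R[i]]_l.+2) : R[i] :=
  let Y j := if (0 < j <= l)%N then co p j else 1 in
  \sum_(0 <= j < k.+1) (-1) ^+ j * Y j * co p l.+1 ^+ (k - j)
  + \sum_(k.+1 <= j < l.+2) (-1) ^+ j * Y j * co p l.+2 ^+ (j - k.+1).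

Definition orbit_domain (k : nat) : set 'rV[R[i]]_l.+2 :=
  [set p | orbit_manifold k p /\ tsing k p != 0].

Definition dxform (k : nat) (a b : nat) : R[i] :=
  (4 * (pi ^+ 2)%:C)^-1 *
  (if (a <= l)%N && (b <= l)%N then dcoef a b
   else if (a == l.+1) && (b == l.+1) then - (k.+1%:R / k%:R)
   else if (a == l.+2) && (b == l.+2) then - ((l - k).+1%:R / (l - k)%:R)
   else if (a <= l)%N || (b <= l)%N then 0
   else 1).

(* The local coordinates y^1, .., y^{l+2} at the point ytilde(x), as functions *)
(* of x: y^i = log (ytilde_i) = 2 pi i x_i for i = l+1, l+2.                   *)
Definition ylog (k : nat) (i : nat) (x : 'rV[R[i]]_l.+2) : (R[i])^o :=
  if (i <= l)%N then co (ytilde k x) i else twopii * co x i.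

(* The frames d/dy^i and dy^i in the global coordinates ytilde.                *)
Definition dy_vec (p : 'rV[R[i]]_l.+2) (i : nat) : 'rV[R[i]]_l.+2 :=
  if (i <= l)%N then dir i else co p i *: dir i.

Definition dy_cov (p : 'rV[R[i]]_l.+2) (i : nat) : 'rV[R[i]]_l.+2 :=
  if (i <= l)%N then dir i else (co p i)^-1 *: dir i.

Definition gform (k : nat) (i j : nat) (x : 'rV[R[i]]_l.+2) : R[i] :=
  \sum_(1 <= a < l.+3) \sum_(1 <= b < l.+3)
    'D_(dir a) (ylog k i) x * 'D_(dir b) (ylog k j) x * dxform k a b.

Definition orbit_unit (k : nat) (p : 'rV[R[i]]_l.+2) : 'rV[R[i]]_l.+2 :=
  dy_vec p k + dy_vec p k.+1.

Definition ddeg (k j : nat) : R[i] :=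
  if (j <= k)%N then j%:R / k%:R else (l - j).+1%:R / (l - k)%:R.

Definition orbit_euler (k : nat) (p : 'rV[R[i]]_l.+2) : 'rV[R[i]]_l.+2 :=
  \sum_(1 <= j < l.+1) (ddeg k j * co p j) *: dy_vec p j
  + k%:R^-1 *: dy_vec p l.+1 + (l - k)%:R^-1 *: dy_vec p l.+2.

(* The data which determine the Frobenius structure of the orbit space:        *)
(* charge 1, unit, Euler field, intersection form, and the contravariant       *)
(* metric eta^{ij} = e(g^{ij}), in the frame of the coordinates y.             *)
Record orbit_frobenius (k : nat) (F : frob_data R l.+2) : Prop :=
  OrbitFrobenius {
  orbit_frob : frobenius_structure 1 (orbit_domain k) F;
  orbit_intersection : forall x (i j : nat), orbit_domain k (ytilde k x) ->
    (1 <= i <= l.+2)%N -> (1 <= j <= l.+2)%N ->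
    intersection F (ytilde k x) (dy_cov (ytilde k x) i) (dy_cov (ytilde k x) j)
    = gform k i j x;
  orbit_unitE : forall p, orbit_domain k p -> unitv F p = orbit_unit k p;
  orbit_metric : forall p (i j : nat), orbit_domain k p ->
    (1 <= i <= l.+2)%N -> (1 <= j <= l.+2)%N ->
    inner (dy_cov p i *m invmx (metric F p)) (dy_cov p j)
    = 'D_(orbit_unit k p)
        (fun q => intersection F q (dy_cov q i) (dy_cov q j)) p;
  orbit_eulerE : forall p, orbit_domain k p -> euler F p = orbit_euler k p
}.

End OrbitSpace.

Section LandauGinzburg.
Context {R : realType}.

(* c is the coefficient of (z - z0)^-1 in the Laurent expansion of f at a pole *)
(* z0; for f holomorphic on a punctured neighbourhood of z0, the continuous    *)
(* remainder h is holomorphic by Riemann's theorem.                            *)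
Definition is_residue (f : R[i] -> R[i]) (z0 c : R[i]) : Prop :=
  exists (m : nat) (b : nat -> R[i]) (h : (R[i])^o -> (R[i])^o),
    [/\ b 0%N = c, h @ z0 --> h z0 &
        \forall z \near (z0 : (R[i])^o)^',
          f z = \sum_(j < m.+1) b j / (z - z0) ^+ j.+1 + h z].

Definition residue (f : R[i] -> R[i]) (z0 : R[i]) : R[i] :=
  xget 0 [set c | is_residue f z0 c].

Variables (k l : nat).
Implicit Types (a u v w : 'rV[R[i]]_l.+2) (phi : R[i]).

Definition lg_num a phi : R[i] :=
  cexp ('i * k.+1%:R * phi)
  + \sum_(1 <= j < l.+2) co a j * cexp ('i * (k.+1%:R - j%:R) * phi).

Definition lam a (phi : (R[i])^o) : (R[i])^o :=
  (cexp ('i * phi) - co a l.+2)^-1 * lg_num a phi.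

Definition lg_domain : set 'rV[R[i]]_l.+2 :=
  [set a | [/\ co a l.+1 != 0, co a l.+2 != 0 &
            forall phi, cexp ('i * phi) = co a l.+2 -> lg_num a phi != 0]].

Definition dlam u a phi : R[i] := 'D_u (fun b => lam b phi) a.

(* The strip 0 <= Re phi < 2 pi is a fundamental domain for phi modulo 2 pi.   *)
Definition lg_crit a : set R[i] :=
  [set phi | [/\ 0 <= complex.Re phi, complex.Re phi < 2 * pi,
                 cexp ('i * phi) != co a l.+2 & derive1 (lam a) phi = 0]].

(* With d lambda = lambda'(phi) d phi, the quotients of differentials are the  *)
(* 1-forms (product of the derivatives of lambda) / lambda'(phi) d phi.        *)
Definition lg_eta a u v : R[i] :=
  (-1) ^+ k.+1 *
  \sum_(phi0 \in lg_crit a)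
    residue (fun phi => dlam u a phi * dlam v a phi / derive1 (lam a) phi) phi0.

Definition lg_c a u v w : R[i] :=
  - \sum_(phi0 \in lg_crit a)
      residue (fun phi => dlam u a phi * dlam v a phi * dlam w a phi
                          / derive1 (lam a) phi) phi0.

Definition lg_metric a : 'M[R[i]]_l.+2 :=
  \matrix_(i, j) lg_eta a (delta_mx 0 i) (delta_mx 0 j).

(* The vector u . v such that eta(u . v, w) = c(u, v, w) for all w.            *)
Definition lg_mult a u v : 'rV[R[i]]_l.+2 :=
  (\row_j lg_c a u v (delta_mx 0 j)) *m invmx (lg_metric a).

Definition lg_unit a : 'rV[R[i]]_l.+2 :=
  xget 0 [set e | forall u, lg_mult a e u = u].

Definition lg_euler a : 'rV[R[i]]_l.+2 :=
  \sum_(1 <= j < l.+2) (j%:R / k%:R * co a j) *: dir j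
  + (k%:R^-1 * co a l.+2) *: dir l.+2.

Definition lg_frobenius : frob_data R l.+2 :=
  FrobData lg_metric lg_mult lg_unit lg_euler.

End LandauGinzburg.

Arguments orbit_domain {R} l k.
Arguments lg_domain {R} k l.
Arguments lg_frobenius R k l : clear implicits.

(* Main.v *)
Require Import Defs.
From mathcomp Require Import all_boot all_order all_algebra.
From mathcomp Require Import complex all_classical all_reals all_analysis.
From HB Require Import structures.
From mathcomp Require Import fingroup perm.
From mathcomp Require separable.
From mathcomp Require Import ring lra zify.

(* Write m = l + 1, n = l - k. In the variable z = e^{i phi} the                *)
(* superpotential is lambda = P / (z^n (z - w)) with P monic of degree m and w = *)
(* a_{l+2}; its critical points are the roots of the polynomial Q of degree     *)
(* l + 2, numerator of z d lambda / dz. A tangent vector u is encoded by the    *)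
(* polynomial R_u = z^n (z - w)^2 d_u lambda of degree < l + 2. The residues    *)
(* become values of the functional rho Q on K[z]/(Q), the coefficient of degree *)
(* l + 1 of the remainder modulo Q divided by the leading coefficient, and u.v  *)
(* is the x with z^n (z - w)^2 R_x = (-1)^k R_u R_v modulo Q.                    *)
(* The isomorphism Phi sends the orbit of x to the lambda with zeros            *)
(* e^{2 pi i X_s}, where X_s is v_s up to a linear combination of x_{l+1} and   *)
(* x_{l+2}, and with pole w = e^{2 pi i x_{l+1}}. In the coordinates            *)
(* X_1, .., X_m, x_{l+1} the intersection form is                               *)
(* diag(1, .., 1, -1) - (1/k) (1)_{ij} up to a factor, and a Bezout-type        *)
(* identity (casimir) turns it into multiplication by lambda modulo Q. Moving   *)
(* along the unit only adds a constant to lambda; hence the metrics agree and   *)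
(* multiplication by the Euler field is multiplication by lambda. Where its     *)
(* eigenvalues are distinct this determines the product; such points exist, and *)
(* being given by a polynomial condition they are dense on every line through   *)
(* one of them, so that the products agree everywhere by continuity.            *)

Set Implicit Arguments.
Unset Strict Implicit.
Unset Printing Implicit Defensive.

Import Order.TTheory GRing.Theory Num.Theory numFieldNormedType.Exports.

Local Open Scope classical_set_scope.
Local Open Scope ring_scope.
Local Open Scope complex_scope.

(** * Residues modulo a polynomial *)

(** In the variable z = exp(i phi) both structures become statements about the algebra K[z]/(Q),
    where Q ([lgQ]) is the numerator of z dlambda/dz. On the Landau-Ginzburg side a tangent vector u
    is the class of R_u ([lgR]). Summing residues over the critical points ([sum_residues])
    expresses the metric and the triple tensor through the single functional [rho] ([lg_etaE],
    [lg_cE]), and the product becomes, with e the unit, R_e R_{u.v} = R_u R_v modulo Q ([lg_multE]).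

    The isomorphism is the explicit polynomial map [Phi]. Composed with [ytilde] it factors the
    numerator of lambda into the z - exp(2 pi i X_s) ([lgP_ytilde]). In the coordinates X_s and
    x_{l+1} the constant intersection form is diagonal up to a rank-one term -1/k ([sum_dxform]).
    The identity [casimir] shows that contracting with this form is multiplication of classes:
    lowering v by the pulled-back Landau-Ginzburg metric [Mhat] and raising it by the intersection
    form gives the vector whose class is (-1)^k lambda R_v ([Rp_gsharp], [gsharp_euler_rel]).

    Moving along the unit e adds a constant to lambda and leaves Q, the classes R_u and [Mhat]
    unchanged. Hence a covector raised by the intersection form varies affinely along e, and its
    slope is the covector raised by [Mhat]. The flat metric of the orbit space being the derivative
    of the intersection form along e, the two metrics agree ([metric_Mhat]), and multiplication by
    the Euler field is multiplication by (-1)^k lambda ([mult_euler_rel]).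

    Where the powers of lambda span K[z]/(Q), that is where [Vdet] is nonzero, the powers of the
    Euler field form a basis, so associativity determines the whole product ([mult_cyclic]). A point
    with distinct critical values is found in the family P = z^m + b, w = 1 ([good_point]). As
    [Vdet] is polynomial along lines, it is nonzero at points arbitrarily close to any given one,
    and the identity of products extends by continuity ([mult_Rp]).

    Finally, the numerator at the pole is a power of w times [tsing] ([lgP_Phi_q1]), so the two
    domains correspond under [Phi]. Inverting [Phi] only requires the choice of an (l - k)-th root,
    for which there are local holomorphic branches ([local_biholomorphism_Phi]). *)

Section Residue.
Variable K : fieldType.
Implicit Types (Q f g h : {poly K}).

(** The global residue: the sum of the residues of f dz / Q over all roots of Q, in a form valid for
    repeated roots and over any field. *)
Definition rho Q f : K := (f %% Q)`_(size Q).-2 / lead_coef Q.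

Lemma rho_is_scalar Q : scalar (rho Q).
Proof.
by move=> a f g; rewrite /rho modpD modpZl coefD coefZ mulrDl mulrA.
Qed.

HB.instance Definition _ Q :=
  GRing.isLinear.Build K {poly K} K _ (rho Q) (rho_is_scalar Q).

Lemma rhoZ Q c f : rho Q (c *: f) = c * rho Q f.
Proof. exact: linearZ. Qed.

Lemma rhoCM Q c f : rho Q (c%:P * f) = c * rho Q f.
Proof. by rewrite mul_polyC rhoZ. Qed.

Lemma rhoD Q f g : rho Q (f + g) = rho Q f + rho Q g.
Proof. exact: raddfD. Qed.

Lemma rhoB Q f g : rho Q (f - g) = rho Q f - rho Q g.
Proof. exact: raddfB. Qed.

Lemma rho_sum Q (I : Type) (r : seq I) (F : I -> {poly K}) :
  rho Q (\sum_(i <- r) F i) = \sum_(i <- r) rho Q (F i).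
Proof. exact: raddf_sum. Qed.

Lemma rho_mod Q f g : Q %| f - g -> rho Q f = rho Q g.
Proof.
move=> /modp_eq0P Qfg; apply/eqP.
by rewrite -subr_eq0 -raddfB /= /rho Qfg coef0 mul0r.
Qed.

Lemma rho_small Q f : (size f < size Q)%N ->
  rho Q f = f`_(size Q).-2 / lead_coef Q.
Proof. by move=> sf; rewrite /rho modp_small. Qed.

(** If the remainder r of f were nonzero, the power of X that brings its degree to deg Q - 1 would
    give a product whose residue is a quotient of leading coefficients. *)
Lemma rho_nondeg Q f : (1 < size Q)%N ->
  (forall j, (j < (size Q).-1)%N -> rho Q (f * 'X^j) = 0) -> Q %| f.
Proof.
move=> sQ f0; apply/modp_eq0P; pose r : {poly K} := f %% Q.
have Q0 : Q != 0 by rewrite -size_poly_gt0 ltnW.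
have sr : (size r < size Q)%N by rewrite ltn_modp.
apply/eqP/negP => /negP r0; have sr0 : (0 < size r)%N by rewrite size_poly_gt0.
have rX j : (j < (size Q).-1)%N -> rho Q (r * 'X^j) = 0.
  move=> /f0 <-; apply: rho_mod; rewrite -mulrBl dvdp_mulr //.
  rewrite -dvdpNr opprB; apply/dvdpP; exists (f %/ Q).
  by rewrite [X in X - _](divp_eq f Q) addrK.
have /rX : ((size Q).-1 - size r < (size Q).-1)%N by lia.
rewrite rho_small; last by rewrite size_mulXn //; lia.
rewrite coefMXn; have -> : ((size Q).-2 < (size Q).-1 - size r)%N = false by lia.
have -> : ((size Q).-2 - ((size Q).-1 - size r) = (size r).-1)%N by lia.
have -> : r`_(size r).-1 = lead_coef r by [].
by move/eqP; rewrite mulf_eq0 invr_eq0 !lead_coef_eq0 (negbTE Q0) (negbTE r0).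
Qed.

End Residue.


Lemma deriv_prod (R : comNzRingType) (I : eqType) (r : seq I)
    (F : I -> {poly R}) : uniq r ->
  (\prod_(i <- r) F i)^`() =
  \sum_(i <- r) (F i)^`() * \prod_(j <- r | j != i) F j.
Proof.
elim: r => [|i0 r IH] /=; first by rewrite !big_nil -polyC1 derivC.
move=> /andP[i0r ur]; rewrite !big_cons derivM IH // eqxx /=; congr (_ * _ + _).
  rewrite big_seq [RHS]big_seq_cond; apply: eq_bigl => j.
  by case jr: (j \in r) => //=; apply/esym; apply: contraNneq i0r => <-.
rewrite mulr_sumr !big_seq; apply: eq_bigr => i ir.
rewrite big_cons; have -> : i0 != i by apply: contraNneq i0r => ->.
by rewrite mulrCA.
Qed.

(** * Degree, leading coefficient and values at the poles of the critical polynomial *)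

Section CriticalPolynomial.
Variables (K : fieldType) (m n k : nat) (P : {poly K}) (w : K).
Hypotheses (mE : m = (n + k).+1) (sP : size P = m.+1) (monP : P \is monic).

(* z d/dz (P / (z^n (z - w))) = critp / (z^n (z - w)^2).                        *)
Definition critp : {poly K} :=
  'X * P^`() * ('X - w%:P) - n%:R%:P * (P * ('X - w%:P)) - 'X * P.

Let Pm : P`_m = 1.
Proof. by have /monicP := monP; rewrite lead_coefE sP. Qed.

Lemma size_mulXsubC : size (P * ('X - w%:P)) = m.+2.
Proof.
rewrite size_Mmonic ?monicXsubC ?size_XsubC ?sP ?addn2 //.
by rewrite -size_poly_eq0 sP.
Qed.

Lemma coef_mulXsubC : (P * ('X - w%:P))`_m.+1 = 1.
Proof.
by rewrite mulrBr coefB coefMX coefMC /= Pm [X in _ - X * _]nth_default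
  ?sP // mul0r subr0.
Qed.

Lemma coef_critp : critp`_m.+1 = k%:R.
Proof.
rewrite /critp mulrBr -mulrA -mulrA !(coefB, coefXM, coefMC, coefCM).
rewrite coef_mulXsubC /= [P^`() * _]mulrC coefXM !coef_deriv Pm.
rewrite [P`_m.+1]nth_default ?sP //.
move: Pm mE; case: (m) => [//|m'] /= pm mE'.
rewrite pm; have -> : m'.+1 = (n + k + 1)%N by lia.
rewrite !natrD; ring.
Qed.

Hypothesis k0 : k%:R != 0 :> K.

Lemma size_critp : size critp = m.+2.
Proof.
apply/eqP; rewrite eqn_leq; apply/andP; split; last first.
  rewrite ltnNge; apply/negP => sQ'; move: k0; rewrite -coef_critp.
  by rewrite nth_default ?eqxx.
apply/leq_sizeP => j jm; rewrite /critp.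
rewrite mulrBr -mulrA -mulrA !(coefB, coefXM, coefMC, coefCM) /=.
rewrite [P^`() * _]mulrC coefXM !coef_deriv.
rewrite [(P * _)`_j]nth_default ?size_mulXsubC //.
case: j jm => [//|[//|j]] jm /=.
by rewrite ![P`__]nth_default ?sP ?mul0rn ?mulr0 ?mul0r ?subr0 //; lia.
Qed.

Lemma lead_coef_critp : lead_coef critp = k%:R.
Proof. by rewrite lead_coefE size_critp coef_critp. Qed.

(** Together with [horner_critpw]: the poles 0 and w are not critical as soon as P does not vanish
    there, so that z and z - w are invertible modulo Q. *)
Lemma horner_critp0 : critp.[0] = n%:R * w * P.[0].
Proof. by rewrite /critp !(hornerD, hornerN, hornerM, hornerX, hornerC); ring. Qed.

Lemma horner_critpw : critp.[w] = - w * P.[w].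
Proof. by rewrite /critp !(hornerD, hornerN, hornerM, hornerX, hornerC); ring. Qed.

End CriticalPolynomial.

(** * Contraction over the zeros and the pole is multiplication in K[z]/(Q) *)

Section Casimir.
Variables (K : fieldType) (m n k : nat) (z : 'I_m -> K) (w : K).
Hypotheses (mE : m = (n + k).+1) (k0 : k%:R != 0 :> K).

Let P : {poly K} := \prod_s ('X - (z s)%:P).
Let Ps s : {poly K} := \prod_(t | t != s) ('X - (z t)%:P).
Let G := P * ('X - w%:P).
Let Q := critp n P w.
(** The encoding of the vector d/d(log z_s), which moves the single zero z_s of P; the polynomial w
    P is that of d/d(log w). *)
Let R s := - (z s)%:P * (Ps s * ('X - w%:P)).
Let sig := \sum_s z s.

Let size_ie : size (index_enum 'I_m) = m.
Proof. by rewrite -sum1_size; exact: etrans (sum1_card 'I_m) (card_ord m).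
Qed.

Let PsE s : P = ('X - (z s)%:P) * Ps s.
Proof. by rewrite /P (bigD1 s). Qed.

Let dP : P^`() = \sum_s Ps s.
Proof.
rewrite /P deriv_prod ?index_enum_uniq //.
by apply: eq_bigr => s _; rewrite derivXsubC mul1r.
Qed.

Let sP : size P = m.+1.
Proof. by rewrite /P size_prod_XsubC size_ie. Qed.

Let monP : P \is monic. Proof. exact: monic_prod_XsubC. Qed.

Let Pm : P`_m = 1.
Proof. by have /monicP := monP; rewrite lead_coefE sP. Qed.

Let Pm1 : P`_m.-1 = - sig.
Proof.
have := @coefPn_prod_XsubC K [seq z s | s <- index_enum 'I_m].
rewrite size_map size_ie big_map big_map; apply.
by rewrite mE.
Qed.

Let sG : size G = m.+2.
Proof. exact: size_mulXsubC. Qed.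

Let Gm1 : G`_m.+1 = 1.
Proof. exact: coef_mulXsubC. Qed.

Let Gm : G`_m = - sig - w.
Proof.
by rewrite /G mulrBr coefB coefMX coefMC Pm Pm1 mul1r; move: mE; case: (m).
Qed.

Let Qm : Q`_m = (1 - k%:R) * sig - (k%:R + 1) * w.
Proof.
rewrite /Q /critp -/G.
rewrite mulrBr -mulrA -mulrA !(coefB, coefXM, coefMC, coefCM) /=.
rewrite [P^`() * _]mulrC coefXM !coef_deriv Gm.
move: Pm Pm1 mE; case: (m) => [//|m'] /=; case: m' => [|m'] /= pm pm1 mE'.
  have [n0 k'0] : n = 0%N /\ k = 0%N by lia.
  by move: k0; rewrite k'0 eqxx.
rewrite pm pm1; have -> : m'.+1 = (n + k)%N by lia.
have -> : (n + k).+1 = (n + k + 1)%N by lia.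
rewrite natrD -[_ *+ (n + k)]mulr_natr !natrD; ring.
Qed.

Let Qm1 : Q`_m.+1 = k%:R.
Proof. exact: coef_critp. Qed.

Let sQ : size Q = m.+2.
Proof. exact: (size_critp w mE sP monP k0). Qed.

Let leadQ : lead_coef Q = k%:R.
Proof. exact: (lead_coef_critp w mE sP monP k0). Qed.

Let rhoG : rho Q G = (w - sig) / k%:R ^+ 2.
Proof.
(* G and Q have the same degree; subtracting Q/k cancels the leading term and leaves a
   representative on which [rho_small] applies. *)
have -> : rho Q G = rho Q (G - k%:R^-1 *: Q).
  by apply: rho_mod; rewrite opprB addrC subrK dvdpZr ?dvdpp // invr_neq0.
rewrite rho_small.
  rewrite sQ leadQ /= coefB coefZ Gm Qm; field.
  exact: k0.
rewrite sQ ltnS; apply/leq_sizeP => j; rewrite leq_eqVlt => /orP[/eqP <-|jm].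
  by rewrite coefB coefZ Gm1 Qm1 mulVf ?subrr.
by rewrite coefB coefZ ![_`_j]nth_default ?sG ?sQ // mulr0 subr0.
Qed.

Let sPs s : size (Ps s) = m.
Proof.
have := sP; rewrite (PsE s) size_Mmonic ?polyXsubC_eq0 //.
  by rewrite size_XsubC add2n /= => -[].
  exact: monic_prod_XsubC.
Qed.

Let rhoR s : rho Q (R s) = - z s / k%:R.
Proof.
have mon : Ps s * ('X - w%:P) \is monic.
  by rewrite rpredM ?monicXsubC // monic_prod_XsubC.
have sz : size (Ps s * ('X - w%:P)) = m.+1.
  rewrite size_Mmonic ?monicXsubC ?size_XsubC ?sPs ?addn2 //.
  by rewrite -size_poly_eq0 sPs mE.
rewrite /R -polyCN mul_polyC linearZ /= rho_small ?sz ?sQ //= leadQ.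
by move/monicP: mon; rewrite lead_coefE sz /= => ->; rewrite mulrA mulr1.
Qed.

Let rhoP : rho Q P = k%:R^-1.
Proof. by rewrite rho_small ?sP ?sQ //= leadQ Pm mul1r. Qed.

Let S := \sum_s (z s)%:P * R s.

Let SE : S = - 'X * Q + (k%:R%:P * 'X + (sig - w)%:P) * G - (w ^+ 2)%:P * P.
Proof.
have -> : S = - ('X^2 * P^`() - (m%:R%:P * 'X + sig%:P) * P) * ('X - w%:P).
  have -> : m%:R%:P * 'X + sig%:P = \sum_s ('X + (z s)%:P) :> {poly K}.
    rewrite big_split /= sumr_const card_ord -['X *+ m]mulr_natl (rmorph_nat polyC).
    by rewrite (rmorph_sum polyC).
  rewrite dP mulr_sumr mulr_suml -sumrB -sumrN mulr_suml; apply: eq_bigr => s _.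
  by rewrite (PsE s) /R; ring.
have -> : m%:R = n%:R + k%:R + 1 :> K by rewrite mE -natrD natr1.
by rewrite /Q /critp /G !polyCD !polyCN polyC_exp; ring.
Qed.

(** The defect of the identity [casimir]. It is additive in h, commutes with multiplication by X
    modulo Q ([TX]) and vanishes modulo Q at 1 ([T1]), so it vanishes modulo Q for every h by
    induction on the degree. *)
Let T h : {poly K} :=
  - (\sum_s (rho Q (R s * h))%:P * R s)
  + (rho Q (w%:P * P * h))%:P * (w%:P * P)
  + (k%:R * rho Q (G * h))%:P * G - 'X * G * h.

Let TD f g : T (f + g) = T f + T g.
Proof.
rewrite /T !mulrDr; rewrite !raddfD /= mulrDr !polyCD.
have -> : \sum_s (rho Q (R s * (f + g)))%:P * R s =
    \sum_s (rho Q (R s * f))%:P * R s + \sum_s (rho Q (R s * g))%:P * R s.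
  rewrite -big_split /=; apply: eq_bigr => s _.
  by rewrite mulrDr raddfD /= polyCD mulrDl.
ring.
Qed.

Let TC c : T c%:P = c%:P * T 1.
Proof.
rewrite /T !mulr1 ![_ * c%:P]mulrC !rhoCM.
have -> : \sum_s (rho Q (R s * c%:P))%:P * R s =
    c%:P * \sum_s (rho Q (R s * 1))%:P * R s.
  rewrite mulr_sumr; apply: eq_bigr => s _.
  by rewrite mulr1 [R s * c%:P]mulrC rhoCM polyCM -!mulrA.
by rewrite !polyCM; ring.
Qed.

Let TX h : 'X * T h - T ('X * h) = (rho Q (G * h))%:P * 'X * Q.
Proof.
have sumE : 'X * (\sum_s (rho Q (R s * h))%:P * R s)
      - \sum_s (rho Q (R s * ('X * h)))%:P * R s
    = (rho Q (G * h))%:P * S - (rho Q (S * h))%:P * G.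
  rewrite /S mulr_suml (raddf_sum (rho Q)) (rmorph_sum polyC) /= [X in _ = _ - X]mulr_suml.
  rewrite !mulr_sumr -!sumrB; apply: eq_bigr => s _.
  (* As (X - z_s) [Ps s] is P, multiplication by X acts on [R s] as the scalar z_s up to a multiple
     of G; the errors of the two sums cancel up to the terms in [S] and G. *)
  have XR : 'X * R s = (z s)%:P * R s - (z s)%:P * G.
    by rewrite /R /G (PsE s); ring.
  have -> : rho Q (R s * ('X * h)) = z s * rho Q (R s * h) - z s * rho Q (G * h).
    by rewrite mulrA [R s * 'X]mulrC XR mulrBl raddfB /= -!mulrA !rhoCM.
  rewrite mulrCA XR -[(z s)%:P * R s * h]mulrA rhoCM !(polyCD, polyCN, polyCM); ring.
rewrite /T.
have -> : rho Q (w%:P * P * ('X * h)) = w * (rho Q (G * h) + w * rho Q (P * h)).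
  rewrite -mulrA rhoCM; congr (_ * _); rewrite -rhoCM -rhoD; congr (rho Q _).
  by rewrite /G; ring.
have SE' : rho Q (S * h) = k%:R * rho Q (G * ('X * h))
    + (sig - w) * rho Q (G * h) - w ^+ 2 * rho Q (P * h).
  rewrite -!rhoCM -rhoD -rhoB SE.
  rewrite [RHS](_ : _ = rho Q (((k%:R%:P * 'X + (sig - w)%:P) * G
    - (w ^+ 2)%:P * P) * h)); last by congr (rho _ _); ring.
  apply: rho_mod; rewrite -mulrBl dvdp_mulr //.
  by apply/dvdpP; exists (- 'X); ring.
rewrite -[w%:P * P * h]mulrA rhoCM.
set S1 := \sum_s _ in sumE *; set S2 := \sum_s _ in sumE *.
transitivity (- ('X * S1 - S2)
  + 'X * ((w * rho Q (P * h))%:P * (w%:P * P) + (k%:R * rho Q (G * h))%:P * G)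
  - (w * (rho Q (G * h) + w * rho Q (P * h)))%:P * (w%:P * P)
  - (k%:R * rho Q (G * ('X * h)))%:P * G).
  by ring.
rewrite sumE SE' SE !(polyCM, polyCD, polyCN, polyC_exp) /G; ring.
Qed.

Let T1 : T 1 = - k%:R^-1%:P * 'X * Q.
Proof.
rewrite /T !mulr1 rhoCM rhoP rhoG.
have -> : \sum_s (rho Q (R s * 1))%:P * R s = - k%:R^-1%:P * S.
  rewrite /S mulr_sumr; apply: eq_bigr => s _.
  by rewrite mulr1 rhoR polyCM polyCN; ring.
have -> : k%:R * ((w - sig) / k%:R ^+ 2) = k%:R^-1 * (w - sig).
  by field.
rewrite SE !(polyCM, polyCD, polyCN).
have kk : k%:R^-1%:P * k%:R%:P = 1 :> {poly K} by rewrite -polyCM mulVf.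
transitivity (- k%:R^-1%:P * 'X * Q + (k%:R^-1%:P * k%:R%:P - 1) * ('X * G)).
  by ring.
by rewrite kk subrr mul0r addr0.
Qed.

(* The left-hand side is the inverse intersection form, a sum over the roots   *)
(* of the numerator and the pole, applied to the functional [rho (_ * h)].     *)
Lemma casimir h :
  Q %| - (\sum_s (rho Q (R s * h))%:P * R s)
  + (rho Q (w%:P * P * h))%:P * (w%:P * P)
  + (k%:R * rho Q (G * h))%:P * G - 'X * G * h.
Proof.
rewrite -/(T h); elim/poly_ind: h => [|h c IH].
  by rewrite -polyC0 TC mul0r dvdp0.
rewrite TD TC dvdp_add //; last by rewrite T1 !mulrA dvdp_mull.
rewrite mulrC -(dvdp_subr _ (dvdp_mull 'X IH)) TX.
exact: dvdp_mull.
Qed.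

End Casimir.

(** * The complex exponential *)

Section ComplexExponential.
Context {R : realType}.
Implicit Types (z : R[i]).

Let N : R[i] -> R := @Normc.normc R.

Let absE z : `|z| = (N z)%:C. Proof. by []. Qed.

Let N_ge0 z : 0 <= N z. Proof. by case: z => a b; exact: sqrtr_ge0. Qed.

Let ReleN z : complex.Re z <= N z.
Proof.
have := normc_ge_Re z; rewrite absE lecR => /(le_trans _); apply.
exact: ler_norm.
Qed.

Lemma cexpD (a b : R[i]) : cexp (a + b) = cexp a * cexp b.
Proof.
case: a b => [a1 a2] [b1 b2]; rewrite /cexp /= expRD cosD sinD.
by simpc; congr (_ +i* _); ring.
Qed.

Lemma cexp0 : cexp 0 = 1 :> R[i].
Proof. by rewrite /cexp /= expR0 cos0 sin0; simpc. Qed.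

Lemma cexpNK (a : R[i]) : cexp (- a) * cexp a = 1.
Proof. by rewrite -cexpD addNr cexp0. Qed.

Lemma cexp_neq0 (a : R[i]) : cexp a != 0.
Proof.
apply: contra_eq_neq (cexpNK a) => ->.
by rewrite mulr0 eq_sym oner_neq0.
Qed.

Lemma cexpN (a : R[i]) : cexp (- a) = (cexp a)^-1.
Proof.
by apply: (mulIf (cexp_neq0 a)); rewrite cexpNK mulVf ?cexp_neq0.
Qed.

Lemma cexpMn (a : R[i]) j : cexp (a *+ j) = cexp a ^+ j.
Proof.
by elim: j => [|j IH]; rewrite ?mulr0n ?cexp0 // mulrSr cexpD IH exprSr.
Qed.

Lemma cexp_sum (I : Type) (r : seq I) (f : I -> R[i]) :
  cexp (\sum_(i <- r) f i) = \prod_(i <- r) cexp (f i).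
Proof.
by elim: r => [|i r IH]; rewrite ?big_nil ?cexp0 // !big_cons cexpD IH.
Qed.

Let NM a b : N (a * b) = N a * N b. Proof. exact: Normc.normcM. Qed.

Let NC (t : R) : N t%:C = `|t|.
Proof. by rewrite /N /= expr0n addr0 sqrtr_sqr. Qed.

Let Ncexp z : N (cexp z) = expR (complex.Re z).
Proof.
rewrite /cexp NM NC gtr0_norm ?expR_gt0 // /N /=.
by rewrite cos2Dsin2 sqrtr1 mulr1.
Qed.

Definition exp_trunc M z : R[i] := \sum_(j < M) z ^+ j / j`!%:R.

Let is_derive_Re_cexp (c z : R[i]) (t : R) :
  is_derive t (1 : R) (fun s : R => complex.Re (c * cexp (s%:C * z)))
    (complex.Re (c * z * cexp (t%:C * z))).
Proof.
case: c z => [a b] [x y].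
have E : (fun s : R => complex.Re ((a +i* b) * cexp (s%:C * (x +i* y)))) =
  (fun s => a * (expR (s * x) * cos (s * y)) - b * (expR (s * x) * sin (s * y))).
  apply/funext => s; rewrite /cexp; simpc => /=; simpc.
  rewrite /=; ring.
rewrite E.
have l (u : R) : is_derive t (1 : R) (fun s : R => s * u) u.
  by apply: is_derive_eq; rewrite /GRing.scale /=; ring.
have e : is_derive t (1 : R) (fun s => expR (s * x)) (expR (t * x) * x).
  exact: (@is_derive1_comp _ expR (fun s => s * x)).
have co : is_derive t (1 : R) (fun s => cos (s * y)) (- sin (t * y) * y).
  exact: (@is_derive1_comp _ cos (fun s => s * y)).
have si : is_derive t (1 : R) (fun s => sin (s * y)) (cos (t * y) * y).
  exact: (@is_derive1_comp _ sin (fun s => s * y)).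
have ec := is_deriveM e co; have es := is_deriveM e si.
have := is_deriveB (is_deriveZ a ec) (is_deriveZ b es).
move=> H; apply: (is_derive_eq H).
rewrite /cexp; simpc => /=; simpc; rewrite /= /GRing.scale /=; ring.
Qed.

Let trunc_poly M (c z : R[i]) : {poly R} :=
  \poly_(j < M) complex.Re (c * (z ^+ j / j`!%:R)).

Let trunc_polyE M (c z : R[i]) (t : R) :
  (trunc_poly M c z).[t] = complex.Re (c * exp_trunc M (t%:C * z)).
Proof.
rewrite horner_poly /exp_trunc mulr_sumr (raddf_sum (@complex.Re R)).
apply: eq_bigr => j _; rewrite exprMn -rmorphXn /= -mulrA [in RHS]mulrCA.
by case: (c * _) => u v /=; rewrite mul0r subr0 mulrC.
Qed.

Let deriv_trunc_poly M (c z : R[i]) :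
  (trunc_poly M.+1 c z)^`() = trunc_poly M (c * z) z.
Proof.
apply/polyP => j; rewrite coef_deriv !coef_poly ltnS.
case: ltnP => _; last by rewrite mul0rn.
rewrite -raddfMn /=; congr complex.Re.
rewrite -mulrnAr -mulrA; congr (_ * _).
rewrite -[_ *+ j.+1]mulr_natr factS natrM exprS.
have f0 : j`!%:R != 0 :> R[i] by rewrite pnatr_eq0 -lt0n fact_gt0.
have j0 : j.+1%:R != 0 :> R[i] by rewrite pnatr_eq0.
have divK (x a b : R[i]) : a != 0 -> b != 0 -> x / (a * b) * a = x / b.
  by move=> a0 b0; field; rewrite a0 b0.
by rewrite divK // mulrA.
Qed.

(** Induction on the order. With c the conjugate of the error g, the real function t -> Re(c (exp(t
    z) - Taylor polynomial at t z)) goes from 0 to |g|^2, and its derivative is controlled by the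
    error of the previous order; the mean value theorem bounds |g|^2 by |g| times the wanted
    quantity. *)
Lemma cexp_taylor M z : Normc.normc z <= 1 ->
  Normc.normc (cexp z - exp_trunc M z) <= expR 1 * Normc.normc z ^+ M.
Proof.
rewrite -/N; elim: M z => [|M IH] z z1.
  rewrite /exp_trunc big_ord0 subr0 expr0 mulr1 Ncexp ler_expR.
  exact: le_trans (ReleN z) z1.
set g := cexp z - _; have [->|g0] := eqVneq g 0.
  by rewrite /N Normc.normc0 mulr_ge0 ?expR_ge0 ?exprn_ge0.
pose c := g^*%C.
have cg : c * g = (N g ^+ 2)%:C.
  by rewrite mulrC -sqr_normc absE rmorphXn.
pose phi (t : R) := complex.Re (c * cexp (t%:C * z)) - (trunc_poly M.+1 c z).[t].
pose dphi (t : R) := complex.Re (c * z * cexp (t%:C * z))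
                     - (trunc_poly M (c * z) z).[t].
have dp t : is_derive t (1 : R) phi (dphi t).
  rewrite /dphi -deriv_trunc_poly.
  exact: is_deriveB (is_derive_Re_cexp c z t) (is_derive_poly _ t).
have cp : {within `[0, 1], continuous phi}.
  apply: derivable_within_continuous => t _.
  by have [] := dp t.
have [t /andP[t0 t1]] := MVT_segment (@ler01 R) (fun t _ => dp t) cp.
rewrite subr0 mulr1 /phi /dphi !trunc_polyE !rmorph1 !mul1r !mul0r.
have T0 : exp_trunc M.+1 0 = cexp 0 :> R[i].
  rewrite cexp0 /exp_trunc big_ord_recl expr0 fact0 divr1 big1 ?addr0 //.
  by move=> j _; rewrite expr0n mul0r.
have ReB u v : complex.Re u - complex.Re v = complex.Re (u - v) :> R.
  by case: u v => [? ?] [? ?].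
rewrite T0 subrr subr0 !ReB -!mulrBr -/g cg /= => gE.
have tz : N (t%:C * z) <= N z.
  rewrite NM NC ger0_norm; last by move: t0; rewrite bnd_simp.
  by rewrite ler_piMl.
have : N g ^+ 2 <= N g * N z * (expR 1 * N z ^+ M).
  have Nc : N c = N g by rewrite /c /N; case: (g) => u v /=; rewrite sqrrN.
  rewrite gE; apply: le_trans (ReleN _) _; rewrite [X in X <= _]NM [N (c * z)]NM Nc.
  apply: ler_wpM2l; first by rewrite mulr_ge0.
  apply: le_trans (IH _ (le_trans tz z1)) _.
  rewrite ler_wpM2l ?expR_ge0 // lerXn2r // nnegrE; exact: N_ge0.
rewrite expr2 -mulrA ler_pM2l; first by rewrite mulrCA exprS.
rewrite lt_neqAle N_ge0 andbT eq_sym; apply: contra_neq g0.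
exact: Normc.eq0_normc.
Qed.

Lemma near_dist (z0 : R[i]^o) (e : R[i]) :
  0 < e -> \forall z \near z0, `|z - z0| <= e.
Proof.
move=> e0; have H : (id : R[i]^o -> R[i]^o) @ z0 --> z0 by exact: cvg_id.
exact: (cvgr_distC_le _ _ H _ e0).
Qed.

Lemma cvg_dnbhs_lin (f : R[i]^o -> R[i]^o) (z0 : R[i]^o) (l : R[i]) (K d : R) :
  0 <= K -> 0 < d ->
  (forall z, z != z0 -> Normc.normc (z - z0) <= d ->
     Normc.normc (f z - l) <= K * Normc.normc (z - z0)) ->
  f @ z0^' --> (l : R[i]^o).
Proof.
move=> K0 d0 fl; apply/cvgrPdist_le => e e0.
have K1 : 0 < K + 1 by rewrite ltr_wpDl.
have e'0 : 0 < e / (K + 1)%:C by rewrite divr_gt0 // ltcR.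
have d'0 : 0 < d%:C by rewrite ltcR.
near=> z.
have zz0 : z != z0 by near: z; exact: nbhs_dnbhs_neq.
have zd : `|z - z0| <= d%:C.
  by near: z; apply: nbhs_dnbhs; exact: near_dist.
have ze : `|z - z0| <= e / (K + 1)%:C.
  by near: z; apply: nbhs_dnbhs; exact: near_dist.
rewrite distrC absE.
apply: (@le_trans _ _ ((K + 1)%:C * `|z - z0|)); last first.
  by rewrite -ler_pdivlMl ?ltcR // mulrC.
rewrite absE -rmorphM lecR; apply: le_trans (fl _ zz0 _) _.
  by rewrite -lecR -absE.
by rewrite ler_wpM2r // lerDl.
Unshelve. all: by end_near. Qed.

Lemma is_derive_cexp (z : R[i]^o) :
  is_derive z (1 : R[i]^o) (cexp : R[i]^o -> R[i]^o) (cexp z).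
Proof.
have H : (fun h : R[i]^o => h^-1 *: ((cexp (h *: 1 + z) : R[i]^o) - cexp z))
    @ (0 : R[i]^o)^' --> (cexp z : R[i]^o).
  apply: (@cvg_dnbhs_lin _ 0 _ (N (cexp z) * expR 1) 1) => //.
    by rewrite mulr_ge0 // expR_ge0.
  move=> h h0; rewrite subr0 => h1; rewrite -/N.
  have -> : h^-1 *: ((cexp (h *: 1 + z) : R[i]^o) - cexp z) - cexp z =
    cexp z * ((cexp h - exp_trunc 2 h) / h).
    rewrite /exp_trunc !big_ord_recr big_ord0 /= expr0 expr1 fact0 !divr1 add0r.
    rewrite cexpD; rewrite /GRing.scale /= mulr1; field.
    exact: h0.
  rewrite NM -mulrA ler_wpM2l // NM -/(N h).
  have Nh : N h != 0 by apply: contra_neq h0 => /Normc.eq0_normc.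
  have Nh0 : 0 < N h by rewrite lt_neqAle N_ge0 andbT eq_sym.
  rewrite {2}/N Normc.normcV -/N ler_pdivrMr // -mulrA -expr2.
  exact: cexp_taylor.
apply: DeriveDef; first by apply/cvg_ex; exists (cexp z).
exact/cvg_lim.
Qed.

End ComplexExponential.

(** * Logarithms in the strip 0 <= Re phi < 2 pi *)

Section ComplexLogarithm.
Context {R : realType}.
Implicit Types (z : R[i]).

Lemma unit_circle_angle (a b : R) : a ^+ 2 + b ^+ 2 = 1 ->
  exists2 t : R, 0 <= t < 2 * pi & (cos t = a /\ sin t = b).
Proof.
move=> ab; have a1 : -1 <= a <= 1.
  by have := sqr_ge0 b; have := sqr_ge0 (a - 1); have := sqr_ge0 (a + 1); nra.
have sb : Num.sqrt (1 - a ^+ 2) = `|b| by rewrite -ab addrC addKr sqrtr_sqr.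
have p0 : 0 < pi :> R := pi_gt0 R.
have ap : acos a <= pi by rewrite acos_lepi.
have a0 : 0 <= acos a by rewrite acos_ge0.
have [b0|b0] := leP 0 b.
  exists (acos a); first by rewrite a0; lra.
  by rewrite acosK ?in_itv // sin_acos // sb ger0_norm.
exists (2 * pi - acos a).
  have : acos a != 0.
    apply/eqP => e; have := sin_acos a1; rewrite e sin0 sb => /esym/eqP.
    by rewrite normr_eq0 => /eqP b00; rewrite b00 ltxx in b0.
  rewrite neq_lt ltNge a0 /= => a00; lra.
have -> : 2 * pi - acos a = - acos a + pi *+ 2 by ring.
rewrite cosD2pi sinD2pi cosN sinN acosK ?in_itv // sin_acos // sb.
by rewrite ltr0_norm ?opprK.
Qed.

Lemma unit_circle_angle_inj (s t : R) :
  0 <= s < 2 * pi -> 0 <= t < 2 * pi -> cos s = cos t -> sin s = sin t -> s = t.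
Proof.
wlog st : s t / s <= t.
  move=> H hs ht c n; have [/H|/ltW/H] := leP s t; first exact.
  by move=> H'; apply/esym/H'.
move=> hs ht c n; apply/eqP; rewrite eq_le st leNgt; apply/negP => lts.
have d0 : 0 < sin ((t - s) / 2) by apply: sin_gt0_pi; lra.
have : cos (t - s) = 1.
  by rewrite cosB c n -!expr2 cos2Dsin2.
have -> : t - s = (t - s) / 2 + (t - s) / 2 by field.
rewrite cosD -!expr2 => e; have := cos2Dsin2 ((t - s) / 2); nra.
Qed.

(** With [cexpi_inj], the strip contains exactly one logarithm of each nonzero z; sums over critical
    points phi thus become sums over the roots of Q. *)
Lemma cexpi_surj z : z != 0 ->
  exists phi, [/\ 0 <= complex.Re phi, complex.Re phi < 2 * pi & cexp ('i * phi) = z].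
Proof.
move=> z0; pose r := Normc.normc z.
have r0 : 0 < r.
  rewrite lt_neqAle; apply/andP; split; last by case: (z) @r => a b; exact: sqrtr_ge0.
  by rewrite eq_sym; apply: contra_neq z0; exact: Normc.eq0_normc.
have zE : z = r%:C * ((complex.Re z / r) +i* (complex.Im z / r)).
  have := lt0r_neq0 r0; move: (r) => q q0; case: (z) => a b /=; simpc.
  by congr (_ +i* _); field.
have : (complex.Re z / r) ^+ 2 + (complex.Im z / r) ^+ 2 = 1.
  rewrite !expr_div_n -mulrDl.
  have -> : complex.Re z ^+ 2 + complex.Im z ^+ 2 = r ^+ 2.
    by rewrite /r; case: (z) => a b /=; rewrite sqr_sqrtr // addr_ge0 ?sqr_ge0.
  by rewrite divff // expf_neq0 // lt0r_neq0.
move=> /unit_circle_angle[t /andP[t0 t2] [ct st]].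
exists (t +i* - ln r); split => //=.
rewrite zE -ct -st /cexp; simpc => /=; simpc.
by rewrite lnK.
Qed.

Lemma cexpi_inj (phi psi : R[i]) :
  0 <= complex.Re phi < 2 * pi -> 0 <= complex.Re psi < 2 * pi ->
  cexp ('i * phi) = cexp ('i * psi) -> phi = psi.
Proof.
case: phi psi => [s a] [t b] /= hs ht; rewrite /cexp; simpc => /= -[].
move=> c n; have e0 (x : R) : 0 < expR x by exact: expR_gt0.
have ab : expR (- a) = expR (- b).
  apply/eqP; rewrite -(@eqrXn2 _ 2) ?ltW //; apply/eqP.
  have : (expR (- a) * cos s) ^+ 2 + (expR (- a) * sin s) ^+ 2 =
    (expR (- b) * cos t) ^+ 2 + (expR (- b) * sin t) ^+ 2 by rewrite c n.
  by rewrite !exprMn -!mulrDr !cos2Dsin2 !mulr1.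
have aN : a = b by apply: oppr_inj; apply: expR_inj.
move: c n; rewrite aN => /(mulfI (lt0r_neq0 (e0 _))) c.
move=> /(mulfI (lt0r_neq0 (e0 _))) n.
by congr (_ +i* _); exact: unit_circle_angle_inj.
Qed.

End ComplexLogarithm.

(** * Residues in the variable exp(i phi) *)

(** With f = X p and q the inverse of p modulo X^M, the coefficient is the residue at 0 of df /
    f^(j+1). For j > 0 this form is the derivative of -f^(-j)/j and has no residue; division by j is
    where its invertibility enters. *)
Lemma coef_dlog (K : fieldType) (p q s : {poly K}) (M j : nat) :
  j%:R != 0 :> K \/ j = 0%N -> (j < M)%N -> p * q = 1 + 'X^M * s ->
  (('X * p)^`() * q ^+ j.+1)`_j = (j == 0%N)%:R.
Proof.
move=> j0 jM pq; case: j j0 jM => [_|j] M0.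
  rewrite expr1 derivM derivX mul1r mulrDl pq.
  rewrite !coefD coef1 -mulrA -['X * _]mulrC coefMX eqxx /= addr0.
  by rewrite coefXnM M0 addr0.
case: M0 => // j0 jM.
have dpq : p^`() * q + p * q^`() = 'X^(M.-1) * (M%:R%:P * s + 'X * s^`()).
  rewrite -derivM pq derivD derivC add0r derivM derivXn.
  case: (M) jM => // M' _ /=; rewrite exprS -mulr_natl polyC_natr; ring.
have E : ('X * p)^`() * q ^+ j.+2 = q ^+ j.+1 - 'X * (q ^+ j * q^`()) + 'X^M *
   (s * q ^+ j.+1 - 'X * (q ^+ j * q^`()) * s + (M%:R%:P * s + 'X * s^`()) * q ^+ j.+1).
  rewrite derivM derivX mul1r.
  transitivity (p * q * q ^+ j.+1
    + 'X * ((p^`() * q + p * q^`()) * q ^+ j.+1 - (p * q) * (q ^+ j * q^`()))).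
    by rewrite !exprS; ring.
  rewrite dpq pq; case: (M) jM => // M' _ /=; rewrite !exprS; ring.
rewrite E coefD coefXnM jM addr0 coefB coefXM /=.
have := congr1 (fun f : {poly K} => f`_j) (deriv_exp q j.+1).
rewrite coef_deriv /= coefMn => dq.
apply: (mulIf j0); rewrite !mulr_natr mul0rn mulrnBl dq.
by rewrite [q^`() * _]mulrC subrr.
Qed.

Section LaurentExpansion.
Context {R : realType}.
Implicit Types (f g : R[i] -> R[i]) (p q s : {poly R[i]}).

Let N : R[i] -> R := @Normc.normc R.
Let N_ge0 z : 0 <= N z. Proof. by case: z => a b; exact: sqrtr_ge0. Qed.
Let NM a b : N (a * b) = N a * N b. Proof. exact: Normc.normcM. Qed.
Let ND a b : N (a + b) <= N a + N b. Proof. exact: le_normcD. Qed.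
Let NN a : N (- a) = N a. Proof. exact: normcN. Qed.
Let NX a j : N (a ^+ j) = N a ^+ j.
Proof. by elim: j => [|j IH]; [rewrite /N !expr0 Normc.normc1 | rewrite !exprS NM IH]. Qed.
Let N_gt0 a : a != 0 -> 0 < N a.
Proof.
move=> a0; rewrite lt_neqAle N_ge0 andbT eq_sym; apply: contra_neq a0.
exact: Normc.eq0_normc.
Qed.

(* f = g modulo O(x^M) as x -> 0, x <> 0. *)
Definition eqO M f g := exists K d : R, [/\ 0 <= K, 0 < d <= 1 &
  forall x, x != 0 -> N x <= d -> N (f x - g x) <= K * N x ^+ M].

Lemma horner_bound p : exists2 K : R, 0 <= K & forall x, N x <= 1 -> N p.[x] <= K.
Proof.
elim/poly_ind: p => [|p c [K K0 HK]].
  by exists 0 => // x _; rewrite horner0 /N Normc.normc0.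
exists (K + N c); first by rewrite addr_ge0.
move=> x x1; rewrite hornerMXaddC; apply: le_trans (ND _ _) _.
by rewrite lerD2r NM; apply: le_trans (HK _ x1); rewrite ler_piMr.
Qed.

Lemma eqO_bound M f p : eqO M f (horner p) -> exists K d : R,
  [/\ 0 <= K, 0 < d <= 1 & forall x, x != 0 -> N x <= d -> N (f x) <= K].
Proof.
move=> [K [d [K0 /andP[d0 d1] H]]]; have [K' K'0 HK'] := horner_bound p.
exists (K + K'), d; split; first by rewrite addr_ge0.
  by rewrite d0.
move=> x x0 xd; rewrite -[f x](subrK p.[x]); apply: le_trans (ND _ _) _.
have x1 := le_trans xd d1.
rewrite lerD ?HK' //; apply: le_trans (H _ x0 xd) _.
by rewrite ler_piMr // exprn_ile1.
Qed.

Lemma eqOM M f g p q : eqO M f (horner p) -> eqO M g (horner q) ->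
  eqO M (fun x => f x * g x) (horner (p * q)).
Proof.
move=> Hf [K' [d' [K'0 /andP[d'0 d'1] H']]].
have [B [e [B0 /andP[e0 e1] HB]]] := eqO_bound Hf.
have [K [d [K0 /andP[d0 d1] H]]] := Hf.
have [B' B'0 HB'] := horner_bound q.
exists (B * K' + K * B'), (Num.min e (Num.min d d')); split.
- by rewrite addr_ge0 ?mulr_ge0.
- by rewrite !lt_min e0 d0 d'0 ge_min e1.
move=> x x0; rewrite !le_min => /and3P[xe xd xd'].
have -> : f x * g x - (p * q).[x] =
    f x * (g x - q.[x]) + (f x - p.[x]) * q.[x] by rewrite hornerM; ring.
apply: le_trans (ND _ _) _; rewrite !NM mulrDl lerD //.
  rewrite -mulrA; apply: ler_pM => //; [exact: HB | exact: H'].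
rewrite mulrAC; apply: ler_pM => //; [exact: H | exact/HB'/(le_trans xd d1)].
Qed.

Lemma eqOV M f p q s : (0 < M)%N -> p * q = 1 + 'X^M * s ->
  eqO M f (horner p) -> eqO M (fun x => (f x)^-1) (horner q).
Proof.
move=> M0 pq [K [d [K0 /andP[d0 d1] H]]].
have p0 : p.[0] != 0.
  apply/negP => /eqP p0; have := congr1 (horner^~ 0) pq.
  rewrite hornerM p0 mul0r hornerD hornerM hornerXn expr0n hornerC.
  by rewrite (gtn_eqF M0) mul0r addr0 => /eqP; rewrite eq_sym oner_eq0.
have [p' pE] : exists p', p = p.[0]%:P + 'X * p'.
  have : root (p - p.[0]%:P) 0 by rewrite /root !hornerE subrr.
  move/factor_theorem => [p' e]; exists p'.
  by rewrite mulrC -[X in p' * X]subr0 -polyC0 -e addrC subrK.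
have [B B0 HB] := horner_bound p'; have [B1 B10 HB1] := horner_bound q.
have [B2 B20 HB2] := horner_bound s.
(* On the punctured ball of radius [e] the modulus of f stays above half of |p(0)|, so that dividing
   by f costs only a constant. *)
pose a := N p.[0] / 2; have a0 : 0 < a by rewrite divr_gt0 ?N_gt0.
pose e := Num.min d (a / (K + B + 1)).
have KB : 0 < K + B + 1 by rewrite ltr_wpDl // addr_ge0.
have lowf x : x != 0 -> N x <= e -> a <= N (f x).
  move=> x0; rewrite le_min => /andP[xd xa]; have x1 := le_trans xd d1.
  have : N p.[0] <= N (f x) + (K + B) * N x.
    have -> : p.[0] = f x - (f x - p.[x]) - x * p'.[x].
      have -> : p.[x] = p.[0] + x * p'.[x].
        by rewrite {1}pE hornerD hornerC hornerM hornerX.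
      by ring.
    apply: le_trans (ND _ _) _; rewrite NN mulrDl addrA lerD //; last first.
      by rewrite NM mulrC ler_wpM2r ?HB.
    apply: le_trans (ND _ _) _; rewrite NN lerD2l.
    apply: le_trans (H _ x0 xd) _; rewrite ler_wpM2l //.
    case: (M) M0 => // M' _; rewrite exprS ler_piMr // exprn_ile1 //.
  have : (K + B) * N x <= a.
    apply: (@le_trans _ _ ((K + B + 1) * N x)).
      by rewrite ler_wpM2r // lerDl.
    by rewrite mulrC -ler_pdivlMr.
  rewrite /a; lra.
exists ((K * B1 + B2) / a), e; split.
- by rewrite divr_ge0 ?(ltW a0) // addr_ge0 // mulr_ge0.
- by rewrite lt_min d0 divr_gt0 //= ge_min d1.
move=> x x0 xe; have fx := lowf _ x0 xe.
have f0 : f x != 0.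
  by apply/negP => /eqP e0; move: fx; rewrite e0 /N Normc.normc0 leNgt a0.
move: xe; rewrite le_min => /andP[xd _]; have x1 := le_trans xd d1.
have -> : (f x)^-1 - q.[x] =
    - ((f x - p.[x]) * q.[x] + x ^+ M * s.[x]) / f x.
  have := congr1 (horner^~ x) pq; rewrite !hornerE => e1.
  have -> : x ^+ M * s.[x] = p.[x] * q.[x] - 1 by rewrite e1; ring.
  by field.
rewrite NM NN /N Normc.normcV -/N ler_pdivrMr ?(lt_le_trans a0) //.
apply: (@le_trans _ _ ((K * B1 + B2) * N x ^+ M)).
  apply: le_trans (ND _ _) _; rewrite !NM NX mulrDl lerD //.
    by rewrite mulrAC ler_pM ?H ?HB1.
  by rewrite mulrC ler_wpM2r ?HB2 // exprn_ge0.
rewrite [X in _ <= X](_ : _ = (K * B1 + B2) * N x ^+ M * (N (f x) / a)).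
  rewrite ler_peMr // ?ler_pdivlMr ?mul1r //.
  by rewrite mulr_ge0 ?exprn_ge0 // addr_ge0 // mulr_ge0.
by ring.
Qed.

(** The terms of p of degree at most j give the principal part. After division by x^(j+1), the
    remaining terms tend to their value at 0 and an error O(x^(j+2)) is still O(x), so the remainder
    is continuous. *)
Lemma eqO_residue (f : R[i] -> R[i]) (z0 : R[i]) (j : nat) p :
  eqO j.+2 (fun x => f (z0 + x) * x ^+ j.+1) (horner p) ->
  is_residue f z0 p`_j.
Proof.
move=> [K [d [K0 /andP[d0 d1] H]]].
pose D := drop_poly j.+1 p.
have pE : p = take_poly j.+1 p + 'X^(j.+1) * D.
  by rewrite -{1}(poly_take_drop j.+1 p) mulrC.
have [D' DE] : exists D', D = D.[0]%:P + 'X * D'.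
  have : root (D - D.[0]%:P) 0 by rewrite /root !hornerE subrr.
  move/factor_theorem => [D' e]; exists D'.
  by rewrite mulrC -[X in D' * X]subr0 -polyC0 -e addrC subrK.
have [B B0 HB] := horner_bound D'.
pose S z := \sum_(i < j.+1) p`_(j - i) / (z - z0) ^+ i.+1.
pose h z := if z == z0 then D.[0] else f z - S z.
exists j, (fun i => p`_(j - i)), h; split; first by rewrite subn0.
- apply/continuous_withinNx.
  rewrite {2}/h eqxx; apply: (@cvg_dnbhs_lin _ _ _ _ (K + B) d) => //.
    by rewrite addr_ge0.
  move=> z zz0 zd; rewrite -/N /h (negbTE zz0).
  set x := z - z0; have x0 : x != 0 by rewrite subr_eq0.
  have SE : S z * x ^+ j.+1 = (take_poly j.+1 p).[x].
    rewrite horner_poly mulr_suml (reindex_inj rev_ord_inj) /=.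
    apply: eq_bigr => i _; rewrite subSS -/x subKn -1?ltnS //.
    rewrite -mulrA; congr (_ * _).
    have -> : x ^+ j.+1 = x ^+ (j - i).+1 * x ^+ i.
      by rewrite -exprD addSn subnK // -ltnS.
    by rewrite mulKf // expf_neq0.
  have xj : x ^+ j.+1 != 0 by rewrite expf_neq0.
  have -> : f z - S z - D.[0] =
      (f (z0 + x) * x ^+ j.+1 - p.[x]) / x ^+ j.+1 + x * D'.[x].
    have -> : p.[x] = S z * x ^+ j.+1 + x ^+ j.+1 * (D.[0] + x * D'.[x]).
      rewrite SE {1}pE hornerD hornerM hornerXn {1}DE.
      by rewrite [(_ + _).[x]]hornerD hornerC hornerM hornerX.
    have -> : z0 + x = z by rewrite /x addrC subrK.
    by move: (x ^+ j.+1) xj => y y0; field.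
  have x1 : N x <= 1 by apply: le_trans d1.
  apply: le_trans (ND _ _) _; rewrite [X in _ <= X]mulrDl.
  apply: lerD; last by rewrite NM mulrC ler_wpM2r ?HB.
  rewrite NM /N Normc.normcV -/N NX ler_pdivrMr ?exprn_gt0 ?N_gt0 //.
  by rewrite -mulrA -exprS; exact: H.
- near=> z; have zz0 : z != z0 by near: z; exact: nbhs_dnbhs_neq.
  by rewrite /h (negbTE zz0) addrC subrK.
Unshelve. all: by end_near. Qed.

Lemma eqOX M f p n : eqO M f (horner p) ->
  eqO M (fun x => f x ^+ n) (horner (p ^+ n)).
Proof.
move=> Hf; elim: n => [|n IH].
  exists 0, 1; split => // [|x _ _]; first by rewrite ltr01 lexx.
  by rewrite !expr0 hornerC subrr /N Normc.normc0 mul0r.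
have -> : (fun x => f x ^+ n.+1) = (fun x => f x * f x ^+ n).
  by apply/funext => x; rewrite exprS.
by rewrite exprS; exact: eqOM.
Qed.

Lemma inverse_modXn p M : p.[0] != 0 -> exists q s, p * q = 1 + 'X^M * s.
Proof.
move=> p0; have /Bezout_eq1_coprimepP[[u v] /= e] : coprimep p 'X^M.
  by apply: coprimep_expr; rewrite coprimepX.
by exists u, (- v); rewrite -e; ring.
Qed.

Let expi_poly M : {poly R[i]} := \poly_(a < M) ('i ^+ a.+1 / a.+1`!%:R).

Let expi_polyE M x : exp_trunc M.+1 ('i * x) = 1 + x * (expi_poly M).[x].
Proof.
rewrite /exp_trunc big_ord_recl expr0 fact0 divr1; congr (_ + _).
rewrite horner_poly mulr_sumr; apply: eq_bigr => a _.
by rewrite lift0 exprMn !exprS; ring.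
Qed.

Let deriv_expi_poly M x :
  ('X * expi_poly M)^`().[x] = 'i * exp_trunc M ('i * x).
Proof.
have -> : ('X * expi_poly M)^`() = \poly_(a < M) ('i ^+ a.+1 / a`!%:R).
  apply/polyP => a; rewrite coef_deriv coefXM /= !coef_poly.
  case: ltnP => _; last by rewrite mul0rn.
  rewrite -[_ *+ a.+1]mulr_natr factS natrM.
  have f0 : a`!%:R != 0 :> R[i] by rewrite pnatr_eq0 -lt0n fact_gt0.
  have a0 : a.+1%:R != 0 :> R[i] by rewrite pnatr_eq0.
  have divK (x' b d : R[i]) : b != 0 -> d != 0 -> x' / (b * d) * b = x' / d.
    by move=> b0 d0; field; rewrite b0 d0.
  by rewrite divK.
rewrite horner_poly mulr_sumr; apply: eq_bigr => a _.
by rewrite exprMn exprS; ring.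
Qed.

Let Ni x : N ('i * x) = N x.
Proof. by rewrite NM {1}/N /= expr0n expr1n add0r sqrtr1 mul1r. Qed.

(* Along z = exp(i phi), the form dz / (z - zeta)^(j+1) is exact but for j = 0. *)
Lemma residue_expi_pole (phi0 c : R[i]) (j : nat) :
  is_residue (fun phi => 'i * cexp ('i * phi) *
    (c / (cexp ('i * phi) - cexp ('i * phi0)) ^+ j.+1)) phi0 (c *+ (j == 0%N)).
Proof.
(* With x = phi - phi0, p is the Taylor polynomial of (exp(i x) - 1)/x and X p has derivative
   approximating i exp(i x); q inverts p up to x^(j+2), which puts the form in the shape of
   [coef_dlog]. *)
pose p := expi_poly j.+2; pose zeta := cexp ('i * phi0) : R[i].
have z0 : zeta != 0 := cexp_neq0 _.
have p0 : p.[0] != 0.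
  by rewrite /p horner_coef0 coef_poly /= expr1 divr1 neq0Ci.
have [q [s pq]] := inverse_modXn j.+2 p0.
pose u (x : R[i]) : R[i] := (cexp ('i * x) - 1) / x.
have Hu : eqO j.+2 u (horner p).
  exists (expR 1), 1; split; rewrite ?expR_ge0 ?ltr01 ?lexx // => x x0 x1.
  have -> : u x - p.[x] = (cexp ('i * x) - exp_trunc j.+3 ('i * x)) / x.
    by rewrite expi_polyE -/p /u; field.
  rewrite NM /N Normc.normcV -/N ler_pdivrMr ?N_gt0 // -mulrA -exprSr -(Ni x).
  by apply: cexp_taylor; rewrite -/N Ni.
have He : eqO j.+2 (fun x => 'i * cexp ('i * x)) (horner ('X * p)^`()).
  exists (expR 1), 1; split; rewrite ?expR_ge0 ?ltr01 ?lexx // => x x0 x1.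
  rewrite deriv_expi_poly -mulrBr Ni -(Ni x).
  by apply: cexp_taylor; rewrite -/N Ni.
have := eqOM He (eqOX j.+1 (eqOV (ltn0Sn _) pq Hu)).
have Hc : eqO j.+2 (fun=> c / zeta ^+ j) (horner (c / zeta ^+ j)%:P).
  exists 0, 1; split => // [|x _ _]; first by rewrite ltr01 lexx.
  by rewrite hornerC subrr /N Normc.normc0 mul0r.
move=> /(eqOM Hc) H.
have -> : c *+ (j == 0%N) =
    ((c / zeta ^+ j)%:P * (('X * p)^`() * q ^+ j.+1))`_j.
  rewrite coefCM (coef_dlog _ _ pq) //.
    by case: (j) => [|j'] /=; rewrite ?expr0 ?divr1 ?mulr1 ?mulr0.
  by case: (j) => [|j']; [right|left; rewrite pnatr_eq0].
apply: eqO_residue; case: H => K [d [K0 d01 H]]; exists K, d; split => //.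
move=> x x0 xd; rewrite [X in X - _](_ : _ = c / zeta ^+ j *
  ('i * cexp ('i * x) * (u x)^-1 ^+ j.+1)); first exact: H.
rewrite mulrDr cexpD -/zeta /u invfM invrK.
have -> : zeta * cexp ('i * x) - zeta = zeta * (cexp ('i * x) - 1) by ring.
have gen (Z E X : R[i]) : Z != 0 -> 'i * (Z * E) *
    (c / (Z * (E - 1)) ^+ j.+1) * X ^+ j.+1 =
    c / Z ^+ j * ('i * E * ((E - 1)^-1 * X) ^+ j.+1).
  move=> Z0; set y := E - 1; rewrite !exprMn [Z ^+ j.+1]exprS !invfM exprVn.
  transitivity (Z * Z^-1 * (c / Z ^+ j *
    ('i * E * ((y ^+ j.+1)^-1 * X ^+ j.+1)))); first by ring.
  by rewrite mulfV // mul1r.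
exact: gen.
Qed.

End LaurentExpansion.

Lemma horner_continuous (K : numFieldType) (p : {poly K}) :
  continuous (horner p : K^o -> K^o).
Proof.
elim/poly_ind: p => [|p c IH] x.
  have -> : horner (0 : {poly K}) = cst 0 by apply/funext => y; rewrite horner0.
  exact: cst_continuous.
have -> : horner (p * 'X + c%:P) = (fun y : K^o => (p.[y] * y + c : K^o)).
  by apply/funext => y; rewrite hornerMXaddC.
have H1 : (fun y : K^o => (p.[y] * y : K^o)) @ (x : K^o) --> (p.[x] * x : K^o).
  have Hx : (id : K^o -> K^o) @ (x : K^o) --> (x : K^o) by exact: cvg_id.
  exact: (cvgM (IH x) Hx).
exact: (cvgD H1 (cvg_cst (c : K^o))).
Qed.

(** * Uniqueness and additivity of residues *)

Section Residues.
Context {R : realType}.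
Implicit Types (f g h : R[i]^o -> R[i]^o) (z c : R[i]).

Lemma cvg_cstC (a z0 : R[i]) : (fun=> a : R[i]^o) @ (z0 : R[i]^o) --> (a : R[i]^o).
Proof. exact: (@cvg_cst (R[i]^o) (a : R[i]^o) _ (nbhs (z0 : R[i]^o)) _). Qed.

Lemma cvg_subC (a z0 : R[i]) :
  (fun z : R[i]^o => (z - a : R[i]^o)) @ (z0 : R[i]^o) --> (z0 - a : R[i]^o).
Proof.
have H1 : (id : R[i]^o -> R[i]^o) @ (z0 : R[i]^o) --> (z0 : R[i]^o) by exact: cvg_id.
exact: (cvgB H1 (@cvg_cstC a z0)).
Qed.

Lemma is_residueD f g z0 c c' : is_residue f z0 c -> is_residue g z0 c' ->
  is_residue (fun z => f z + g z) z0 (c + c').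
Proof.
move=> [m [b [h [<- hc fE]]]] [m' [b' [h' [<- hc' gE]]]].
(* The two principal parts are padded with zeros to a common length. *)
pose cut (k : nat) (b : nat -> R[i]) j := if (j <= k)%N then b j else 0.
have cutE k k' (bb : nat -> R[i]) (z : R[i]) : (k <= k')%N ->
    \sum_(j < k.+1) bb j / (z - z0) ^+ j.+1 =
    \sum_(j < k'.+1) cut k bb j / (z - z0) ^+ j.+1.
  move=> kk; rewrite (big_ord_widen k'.+1 (fun j => bb j / (z - z0) ^+ j.+1)) //.
  rewrite big_mkcond; apply: eq_bigr => j _; rewrite /cut ltnS.
  by case: leqP => // _; rewrite mul0r.
exists (maxn m m'), (fun j => cut m b j + cut m' b' j), (fun z => h z + h' z).
split; [by rewrite /cut | exact: (cvgD hc hc') |].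
near=> z; have -> : f z = \sum_(j < m.+1) b j / (z - z0) ^+ j.+1 + h z by near: z.
have -> : g z = \sum_(j < m'.+1) b' j / (z - z0) ^+ j.+1 + h' z by near: z.
rewrite (cutE m (maxn m m')) ?leq_maxl // (cutE m' (maxn m m')) ?leq_maxr //.
rewrite addrACA -big_split /=; congr (_ + _).
by apply: eq_bigr => j _; rewrite mulrDl.
Unshelve. all: by end_near. Qed.

Lemma is_residueN f z0 c : is_residue f z0 c -> is_residue (fun z => - f z) z0 (- c).
Proof.
move=> [m [b [h [<- hc fE]]]]; exists m, (fun j => - b j), (fun z => - h z).
split; [by [] | exact: (cvgN hc) |].
near=> z; have -> : f z = \sum_(j < m.+1) b j / (z - z0) ^+ j.+1 + h z by near: z.
by rewrite opprD -sumrN; congr (_ + _); apply: eq_bigr => j _; rewrite mulNr.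
Unshelve. all: by end_near. Qed.

Lemma is_residue_near f g z0 c : (\forall z \near (z0 : R[i]^o)^', f z = g z) ->
  is_residue f z0 c -> is_residue g z0 c.
Proof.
move=> fg [m [b [h [b0 hc fE]]]]; exists m, b, h; split => //.
near=> z; have <- : f z = g z by near: z.
by near: z.
Unshelve. all: by end_near. Qed.

Lemma is_residue_continuous h z0 : h @ (z0 : R[i]^o) --> h z0 -> is_residue h z0 0.
Proof.
move=> hc; exists 0%N, (fun=> 0), h; split => //; apply: nearW => z.
by rewrite big1 ?add0r // => j _; rewrite mul0r.
Qed.

Lemma is_residue_sum (I : Type) (r : seq I) (f : I -> R[i]^o -> R[i]^o)
    (c : I -> R[i]) z0 : (forall i, is_residue (f i) z0 (c i)) ->
  is_residue (fun z => \sum_(i <- r) f i z) z0 (\sum_(i <- r) c i).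
Proof.
move=> H; elim: r => [|i r IH].
  rewrite big_nil; apply: (@is_residue_near (fun=> 0)).
    by apply: nearW => z; rewrite big_nil.
  exact: (is_residue_continuous (@cvg_cstC 0 z0)).
rewrite big_cons; apply: (is_residue_near _ (is_residueD (H i) IH)).
by apply: nearW => z; rewrite big_cons.
Qed.

(** Multiplied by (z - z0)^m, the expression becomes continuous at z0 with the coefficient of the
    highest pole as value; being zero nearby, that coefficient vanishes, and the order of the pole
    drops. *)
Lemma principal_part_eq0 m (b : nat -> R[i]) h (z0 : R[i]) :
  h @ (z0 : R[i]^o) --> h z0 ->
  (\forall z \near (z0 : R[i]^o)^',
     \sum_(j < m) b j / (z - z0) ^+ j.+1 + h z = 0) ->
  forall j, (j < m)%N -> b j = 0.
Proof.
move=> hc; elim: m => [//|m IH] H.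
suff bm : b m = 0.
  move=> j; rewrite ltnS leq_eqVlt => /predU1P[-> //|].
  apply: IH; near=> z.
  have : \sum_(j < m.+1) b j / (z - z0) ^+ j.+1 + h z = 0 by near: z.
  by rewrite big_ord_recr /= bm mul0r addr0.
pose p : {poly R[i]} := \poly_(j < m.+1) b (m - j)%N.
pose G (z : R[i]^o) : R[i]^o := p.[z - z0] + (z - z0) ^+ m.+1 * h z.
have xc := @cvg_subC z0 z0.
have Gc0 : G @ (z0 : R[i]^o) --> (b m : R[i]^o).
  have <- : p.[z0 - z0] + 'X^(m.+1).[z0 - z0] * h z0 = b m.
    rewrite subrr hornerXn expr0n mul0r addr0 horner_coef0 coef_poly /=.
    by rewrite subn0.
  have -> : G = (fun z : R[i]^o => (p.[z - z0] : R[i]^o) + 'X^(m.+1).[z - z0] * h z).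
    by apply/funext => z; rewrite /G hornerXn.
  have c1 := cvg_comp _ _ xc (@horner_continuous _ p (z0 - z0)).
  have c2 := cvg_comp _ _ xc (@horner_continuous _ 'X^(m.+1) (z0 - z0)).
  exact: (cvgD c1 (cvgM c2 hc)).
have Gc : G @ (z0 : R[i]^o)^' --> (b m : R[i]^o).
  by apply: cvg_within_filter; exact: Gc0.
have G0 : G @ (z0 : R[i]^o)^' --> (0 : R[i]^o).
  have c0 : (fun=> 0 : R[i]^o) @ (z0 : R[i]^o)^' --> (0 : R[i]^o).
    by apply: cvg_within_filter; exact: cvg_cstC.
  apply: cvg_trans c0; apply: near_eq_cvg; near=> z.
  have zz0 : z != z0 by near: z; exact: nbhs_dnbhs_neq.
  have : \sum_(j < m.+1) b j / (z - z0) ^+ j.+1 + h z = 0 by near: z.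
  rewrite /G addrC => /(congr1 (fun u => u * (z - z0) ^+ m.+1)).
  rewrite mul0r mulrDl => <-; rewrite addrC; congr (_ + _); last exact: mulrC.
  rewrite horner_poly mulr_suml (reindex_inj rev_ord_inj) /=.
  apply: eq_bigr => i _; rewrite subSS -mulrA; congr (_ * _).
  have -> : (z - z0) ^+ m.+1 = (z - z0) ^+ (m - i).+1 * (z - z0) ^+ i.
    by rewrite -exprD addSn subnK // -ltnS.
  by rewrite mulKf // expf_neq0 // subr_eq0.
exact: (cvg_unique _ Gc G0).
Unshelve. all: by end_near. Qed.

Lemma is_residue_unique f z0 c c' :
  is_residue f z0 c -> is_residue f z0 c' -> c = c'.
Proof.
move=> H H'; have [m [b [h [b0 hc E]]]] := is_residueD H (is_residueN H').
apply/eqP; rewrite -subr_eq0 -b0; apply/eqP.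
apply: (@principal_part_eq0 m.+1 b h z0) => //.
near=> z.
have <- : f z - f z = \sum_(j < m.+1) b j / (z - z0) ^+ j.+1 + h z by near: z.
by rewrite subrr.
Unshelve. all: by end_near. Qed.

Lemma residueE f z0 c : is_residue f z0 c -> residue f z0 = c.
Proof.
move=> fc; rewrite /residue; case: xgetP => [c' _ fc' |/(_ c)//].
exact: is_residue_unique fc' fc.
Qed.

End Residues.

(** * Partial fractions with repeated roots *)

Section PartialFractions.
Variable K : fieldType.

(** A triple ((r, c), j) stands for the term c / (z - r)^(j+1), so the second clause is the sum of
    the residues. Roots are peeled off one at a time: if r still occurs mu times in the rest, a term
    of order mu + 1 is subtracted whose coefficient makes the new numerator divisible by z - r. *)
Lemma partial_fractions (rs : seq K) (f : {poly K}) : (size f <= size rs)%N ->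
  exists ts : seq (K * K * nat),
  [/\ forall t, t \in ts -> t.1.1 \in rs,
      f`_(size rs).-1 = \sum_(t <- ts) t.1.2 *+ (t.2 == 0%N) &
      forall z, z \notin rs -> f.[z] / (\prod_(r <- rs) ('X - r%:P)).[z] =
        \sum_(t <- ts) t.1.2 / (z - t.1.1) ^+ t.2.+1].
Proof.
elim: rs f => [|r rs IH] f sf.
  exists [::]; split => //; rewrite ?big_nil.
    by move: sf; rewrite size_poly_leq0 => /eqP ->; rewrite coef0.
  by move: sf; rewrite size_poly_leq0 => /eqP -> z _; rewrite big_nil horner0 mul0r.
pose mu := count_mem r rs.
pose H : {poly K} := \prod_(s <- [seq s <- rs | s != r]) ('X - s%:P).
have PE : \prod_(s <- rs) ('X - s%:P) = ('X - r%:P) ^+ mu * H.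
  rewrite (bigID (pred1 r)) /= /H big_filter; congr (_ * _).
  rewrite /mu; elim: (rs) => [|s ss IHs]; first by rewrite big_nil.
  by rewrite big_cons /=; case: eqP => [->|_]; rewrite IHs ?exprS.
have Hr : H.[r] != 0.
  by rewrite /H -/(root _ r) root_prod_XsubC mem_filter eqxx.
pose c := f.[r] / H.[r].
have sH : (size H + mu = (size rs).+1)%N.
  rewrite /H size_prod_XsubC size_filter addSn addnC; congr _.+1.
  by rewrite /mu -(count_predC (pred1 r) rs).
have : root (f - c *: H) r.
  by rewrite /root hornerD hornerN hornerZ /c divfK // subrr.
move=> /factor_theorem[f1 fE].
have sf1 : (size f1 <= size rs)%N.
  have [->|f10] := eqVneq f1 0; first by rewrite size_poly0.
  have : (size (f1 * ('X - r%:P))%R <= (size rs).+1)%N.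
    rewrite -fE; apply: leq_trans (size_polyD _ _) _.
    rewrite geq_max sf size_polyN; apply: leq_trans (size_scale_leq _ _) _.
    by rewrite -sH leq_addr.
  by rewrite size_Mmonic ?monicXsubC // size_XsubC addn2.
have [ts [ts_rs ts0 tsE]] := IH _ sf1.
exists ((r, c, mu) :: ts); split.
- by move=> t; rewrite !inE => /predU1P[-> /=|/ts_rs ->]; rewrite ?eqxx ?orbT.
- rewrite big_cons -ts0 /= -[f](subrK (c *: H)) fE coefD coefZ addrC.
  congr (_ + _).
    have [mu0|mu0] := eqVneq mu 0%N.
      have mH : H \is monic by exact: monic_prod_XsubC.
      move/monicP: mH; rewrite lead_coefE; have -> : (size H).-1 = size rs.
        by move: sH; rewrite mu0 addn0 => ->.
      by move=> ->; rewrite mulr1.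
    rewrite nth_default ?mulr0 //.
    by rewrite -ltnS -sH -[X in (X < _)%N]addn0 ltn_add2l lt0n.
  rewrite mulrBr coefB coefMX coefMC.
  case: (size rs) sf1 => [|n] sf1 /=.
    by move: sf1; rewrite size_poly_leq0 => /eqP ->; rewrite coef0 mul0r subrr.
  by rewrite [X in _ - X * _]nth_default // mul0r subr0.
- move=> z; rewrite inE negb_or => /andP[zr zrs].
  rewrite !big_cons /= -tsE // !hornerM.
  have e : f.[z] = c * H.[z] + f1.[z] * (z - r).
    rewrite -[f in LHS](subrK (c *: H)) fE hornerD hornerZ hornerM addrC.
    by rewrite !hornerE.
  rewrite e PE hornerM horner_exp !hornerE.
  have Hz : H.[z] != 0.
    by rewrite /H -/(root _ z) root_prod_XsubC mem_filter (negbTE zrs) andbF.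
  have zr0 : z - r != 0 by rewrite subr_eq0.
  have : (z - r) ^+ mu != 0 by rewrite expf_neq0.
  rewrite exprS; move: ((z - r) ^+ mu) => y y0.
  by rewrite /=; field; rewrite Hz zr0 y0.
Qed.

End PartialFractions.

(** * Sums of residues over the critical points as values of the global residue *)

Section SumOfResidues.
Context {R : realType}.
Implicit Types (f D Q I : {poly R[i]}).

Lemma cexpi_continuous (phi0 : R[i]) :
  (fun phi : R[i]^o => cexp ('i * phi) : R[i]^o) @ (phi0 : R[i]^o) -->
  (cexp ('i * phi0) : R[i]^o).
Proof.
have [dc _] := @is_derive_cexp R ('i * phi0).
have cc : {for ('i * phi0 : R[i]^o), continuous (cexp : R[i]^o -> R[i]^o)}.
  by apply: differentiable_continuous; apply/derivable1_diffP.
have ic : (fun phi : R[i]^o => 'i * phi : R[i]^o) @ (phi0 : R[i]^o) -->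
    ('i * phi0 : R[i]^o).
  have -> : (fun phi : R[i]^o => 'i * phi : R[i]^o) = horner ('i *: 'X).
    by apply/funext => z; rewrite hornerZ hornerX.
  have -> : 'i * phi0 = ('i *: 'X).[phi0] by rewrite hornerZ hornerX.
  exact: horner_continuous.
exact: (cvg_comp _ _ ic cc).
Qed.

Lemma is_residue_rat_cexpi (p q : {poly R[i]}) (phi0 : R[i]) :
  q.[cexp ('i * phi0)] != 0 ->
  is_residue (fun phi => p.[cexp ('i * phi)] / q.[cexp ('i * phi)]) phi0 0.
Proof.
move=> q0; apply: is_residue_continuous.
have c1 := cvg_comp _ _ (@cexpi_continuous phi0)
  (@horner_continuous _ p (cexp ('i * phi0))).
have c2 := cvg_comp _ _ (@cexpi_continuous phi0)
  (@horner_continuous _ q (cexp ('i * phi0))).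
exact: (cvgM c1 (cvgV q0 c2)).
Qed.

(** If exp(i x) = 1, the Taylor bound of order 2 gives |x| <= e |x|^2, which is impossible for 0 <
    |x| <= 1/(2e). *)
Lemma cexpi_near_neq (phi0 : R[i]) :
  \forall phi \near (phi0 : R[i]^o)^', cexp ('i * phi) != cexp ('i * phi0).
Proof.
have e1 : 1 < expR 1 :> R by rewrite expR_gt1.
have e0 : 0 < ((2 * expR 1)^-1)%:C :> R[i].
  by rewrite ltcR invr_gt0 mulr_gt0 ?expR_gt0.
near=> phi; have phi_neq : phi != phi0 by near: phi; exact: nbhs_dnbhs_neq.
have : `|phi - phi0| <= ((2 * expR 1)^-1)%:C.
  by near: phi; apply: nbhs_dnbhs; exact: near_dist.
pose N : R[i] -> R := @Normc.normc R.
have -> : `|phi - phi0| = (N (phi - phi0))%:C by [].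
rewrite lecR; set x := phi - phi0 => xd.
apply/negP => /eqP E.
have Ei : cexp ('i * x) = 1.
  by rewrite /x mulrBr cexpD cexpN -E mulfV ?cexp_neq0.
have Nx0 : 0 < N x.
  rewrite lt_neqAle; apply/andP; split; last by case: (x) => a b; exact: sqrtr_ge0.
  rewrite eq_sym; apply: contra_neq phi_neq => /Normc.eq0_normc /eqP.
  by rewrite subr_eq0 => /eqP.
have Ni : N ('i * x) = N x.
  by rewrite /N Normc.normcM {1}/Normc.normc /= expr0n expr1n add0r sqrtr1 mul1r.
have e2 : 0 < expR 1 :> R by rewrite expR_gt0.
have xe : N x * (2 * expR 1) <= 1 by rewrite -ler_pdivlMr ?mulr_gt0 // mul1r.
have x1 : N ('i * x) <= 1 by rewrite Ni; nra.
have := @cexp_taylor R 2 ('i * x) x1.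
rewrite Ei /exp_trunc !big_ord_recr big_ord0 /= expr0 expr1 fact0 !divr1 add0r.
rewrite -/N; have -> : 1 - (1 + 'i * x) = - ('i * x) by ring.
rewrite /N normcN -/N Ni; nra.
Unshelve. all: by end_near. Qed.

Lemma near_horner_cexpi_neq0 (q : {poly R[i]}) (phi0 : R[i]) :
  q.[cexp ('i * phi0)] != 0 ->
  \forall phi \near (phi0 : R[i]^o), q.[cexp ('i * phi)] != 0.
Proof.
have c := cvg_comp _ _ (@cexpi_continuous phi0)
  (@horner_continuous _ q (cexp ('i * phi0))).
exact: (cvgr_neq0 _ c).
Qed.

Lemma cexpi_near_notin (phi0 : R[i]) (rs : seq R[i]) :
  \forall phi \near (phi0 : R[i]^o)^', cexp ('i * phi) \notin rs.
Proof.
elim: rs => [|r rs IH]; first by apply: nearW.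
have H : \forall phi \near (phi0 : R[i]^o)^', cexp ('i * phi) != r.
  have [<-|rz] := eqVneq (cexp ('i * phi0)) r; first exact: cexpi_near_neq.
  have /near_horner_cexpi_neq0 H : ('X - r%:P).[cexp ('i * phi0)] != 0.
    by rewrite hornerXsubC subr_eq0.
  apply: nbhs_dnbhs; near=> phi; rewrite -subr_eq0 -hornerXsubC; near: phi.
  exact: H.
near=> phi; rewrite inE negb_or; apply/andP; split; near: phi => //.
Unshelve. all: by end_near. Qed.

(** Since I inverts D modulo Q, f/(D Q) differs from g/Q, with g the remainder of f I, by a function
    regular at the roots of Q. The partial fractions of g/Q are integrated by [residue_expi_pole];
    only the simple poles contribute, and the sum of their coefficients is the top coefficient of
    g. *)
Lemma sum_residues (Q D I f : {poly R[i]}) (F : R[i] -> R[i]) (A : set R[i]) :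
  Q.[0] != 0 -> Q %| D * I - 1 ->
  A = [set phi | [/\ 0 <= complex.Re phi, complex.Re phi < 2 * pi &
                     Q.[cexp ('i * phi)] = 0]] ->
  (forall phi0, A phi0 -> \forall phi \near (phi0 : R[i]^o)^',
    F phi = 'i * cexp ('i * phi) *
      (f.[cexp ('i * phi)] / (D.[cexp ('i * phi)] * Q.[cexp ('i * phi)]))) ->
  \sum_(phi0 \in A) residue F phi0 = rho Q (f * I).
Proof.
move=> Q0 DI AE FE.
have Qn0 : Q != 0 by apply: contraNneq Q0 => ->; rewrite horner0.
have [rs QE] := closed_field_poly_normal Q.
have lQ : lead_coef Q != 0 by rewrite lead_coef_eq0.
have rootQ z : (Q.[z] == 0) = (z \in rs).
  by rewrite QE hornerZ mulf_eq0 (negbTE lQ) -/(root _ z) root_prod_XsubC.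
have sQ : size Q = (size rs).+1 by rewrite QE size_scale // size_prod_XsubC.
have [S SE] : exists S, D * I = 1 + S * Q.
  by have /dvdpP[S SE] := DI; exists S; rewrite -SE addrC subrK.
pose g := (f * I) %% Q.
have sg : (size g <= size rs)%N by rewrite -ltnS -sQ ltn_modp.
have [ts [ts_rs ts0 tsE]] := partial_fractions sg.
pose arg (z : R[i]) := xget 0 [set phi | [/\ 0 <= complex.Re phi,
  complex.Re phi < 2 * pi & cexp ('i * phi) = z]].
have argE z : z != 0 -> [/\ 0 <= complex.Re (arg z),
    complex.Re (arg z) < 2 * pi & cexp ('i * arg z) = z].
  by move=> z0; have [phi H] := cexpi_surj z0; rewrite /arg; case: xgetP => // /(_ phi).
have rs0 z : z \in rs -> z != 0.
  by rewrite -rootQ => zr; apply: contraNneq Q0 => z0; move: zr; rewrite z0.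
have AS : A = [set` [seq arg z | z <- undup rs]].
  rewrite AE; apply/seteqP; split => phi /=.
    move=> [p0 p1 /eqP]; rewrite rootQ => zr.
    apply/mapP; exists (cexp ('i * phi)); rewrite ?mem_undup //.
    have [a0 a1 aE] := argE _ (cexp_neq0 ('i * phi)).
    by apply: cexpi_inj; rewrite ?aE ?p0 ?a0.
  move/mapP => [z]; rewrite mem_undup => zr ->.
  by have [a0 a1 aE] := argE _ (rs0 _ zr); split => //; apply/eqP; rewrite aE rootQ.
have resE z0 : z0 \in rs -> residue F (arg z0) =
    \sum_(t <- ts) (if t.1.1 == z0 then (t.1.2 / lead_coef Q) *+ (t.2 == 0%N) else 0).
  move=> zr; have [a0 a1 aE] := argE _ (rs0 _ zr).
  apply: residueE; set phi0 := arg z0.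
  have Dz : D.[z0] != 0.
    apply/negP => /eqP Dz; have := congr1 (horner^~ z0) SE.
    have /eqP Qz : Q.[z0] == 0 by rewrite rootQ.
    rewrite hornerM Dz mul0r hornerD hornerM Qz mulr0 addr0 hornerC.
    by move/eqP; rewrite eq_sym oner_eq0.
  have H1 : is_residue (fun phi => \sum_(t <- ts) 'i * cexp ('i * phi) *
      ((t.1.2 / lead_coef Q) / (cexp ('i * phi) - t.1.1) ^+ t.2.+1)) phi0
      (\sum_(t <- ts) (if t.1.1 == z0 then (t.1.2 / lead_coef Q) *+ (t.2 == 0%N) else 0)).
    apply: is_residue_sum => t; case: eqP => [->|/eqP tz].
      by rewrite -aE; exact: residue_expi_pole.
    pose p : {poly R[i]} := ('i * (t.1.2 / lead_coef Q)) *: 'X.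
    apply: (@is_residue_near _ (fun phi => p.[cexp ('i * phi)]
        / (('X - t.1.1%:P) ^+ t.2.+1).[cexp ('i * phi)])).
      apply: nearW => phi.
      rewrite /p hornerZ hornerX horner_exp hornerXsubC.
      have gen (a c y x : R[i]) : a * c * y * x = a * y * (c * x) by ring.
      exact: gen.
    apply: is_residue_rat_cexpi; rewrite aE horner_exp !hornerE expf_neq0 //.
    by rewrite subr_eq0 eq_sym.
  (* The regular part f/(D Q) - g/Q, computed from D I = 1 + S Q. *)
  have H2 : is_residue (fun phi => ('i *: 'X * ((f * I) %/ Q * D - f * S)).[cexp ('i * phi)]
      / D.[cexp ('i * phi)]) phi0 0 by apply: is_residue_rat_cexpi; rewrite aE.
  have := is_residueD H1 H2; rewrite addr0; apply: is_residue_near.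
  near=> phi; have -> : F phi = 'i * cexp ('i * phi) *
      (f.[cexp ('i * phi)] / (D.[cexp ('i * phi)] * Q.[cexp ('i * phi)])).
    near: phi; apply: FE; rewrite AE /=; split => //; apply/eqP.
    by rewrite aE rootQ.
  have znr : cexp ('i * phi) \notin rs.
    by near: phi; exact: cexpi_near_notin.
  have Dn : D.[cexp ('i * phi)] != 0.
    by near: phi; apply: nbhs_dnbhs; apply: near_horner_cexpi_neq0; rewrite aE.
  move: (cexp ('i * phi)) znr Dn => z znr Dn.
  have Qz : Q.[z] != 0 by rewrite rootQ.
  have := tsE _ znr; set Z := (\prod_(r <- rs) _).[z] => gz.
  have QZ : Q.[z] = lead_coef Q * Z by rewrite {1}QE hornerZ.
  have ZE : Z = Q.[z] / lead_coef Q by rewrite QZ mulrC mulKf.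
  have fz : f.[z] * (D.[z] * I.[z]) = f.[z] + f.[z] * S.[z] * Q.[z].
    by rewrite -[D.[z] * _]hornerM SE hornerD hornerM hornerC; ring.
  have fIz : f.[z] * I.[z] = ((f * I) %/ Q).[z] * Q.[z] + g.[z].
    by rewrite -hornerM {1}(divp_eq (f * I) Q) hornerD hornerM.
  have -> : \sum_(t <- ts) 'i * z * (t.1.2 / lead_coef Q / (z - t.1.1) ^+ t.2.+1)
     = 'i * z * (g.[z] / Q.[z]).
    rewrite -mulr_sumr; congr (_ * _).
    transitivity ((lead_coef Q)^-1 * (g.[z] / Z)); last first.
      by rewrite ZE; field; rewrite lQ Qz.
    by rewrite gz mulr_sumr; apply: eq_bigr => t _; ring.
  rewrite hornerM hornerD hornerN hornerZ hornerX ![(_ * _).[z]]hornerM.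
  have gen (x a b c d e q g' : R[i]) : b != 0 -> e != 0 ->
      a * (b * c) = a + a * d * e -> a * c = q * e + g' ->
      'i * x * (g' / e) + 'i * x * (q * b - a * d) / b = 'i * x * (a / (b * e)).
    move=> b0 e0 e1 e2.
    have -> : g' = a * c - q * e by rewrite e2; ring.
    have -> : a / (b * e) = (a * (b * c) - a * d * e) / (b * e).
      by congr (_ / _); rewrite e1; ring.
    by field; rewrite b0 e0.
  exact: (gen _ _ _ _ _ _ _ _ Dn Qz fz fIz).
have uA : uniq [seq arg z | z <- undup rs].
  rewrite map_inj_in_uniq ?undup_uniq // => y z.
  rewrite !mem_undup => /rs0/argE[_ _ yE] /rs0/argE[_ _ zE] e.
  by rewrite -yE -zE e.
rewrite AS -(fsbig_seq _ _ uA) big_map; transitivity (\sum_(z <- undup rs) \sum_(t <- ts)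
    (if t.1.1 == z then (t.1.2 / lead_coef Q) *+ (t.2 == 0%N) else 0)).
  by apply: eq_big_seq => z; rewrite mem_undup; exact: resE.
have -> : rho Q (f * I) = (\sum_(t <- ts) t.1.2 *+ (t.2 == 0%N)) / lead_coef Q.
  by rewrite /rho sQ /= -/g ts0.
rewrite exchange_big /= mulr_suml big_seq [RHS]big_seq.
apply: eq_bigr => t tts; rewrite mulrnAl (bigD1_seq t.1.1) ?undup_uniq //=; last first.
  by rewrite mem_undup; exact: ts_rs.
rewrite eqxx big1 ?addr0 // => z zt; case: eqP => // e.
by rewrite e eqxx in zt.
Unshelve. all: by end_near. Qed.

End SumOfResidues.

(** * The Landau-Ginzburg structure *)

Section ComplexDerivatives.
Variable K : numFieldType.

Lemma is_derive1_compK (f g : K^o -> K^o) (x : K^o) (a b : K) :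
  is_derive (g x) (1 : K^o) f a -> is_derive x (1 : K^o) g b ->
  is_derive x (1 : K^o) (fun y => f (g y)) (a * b).
Proof.
move=> [fd fa] [gd gb].
have df : differentiable f (g x) by apply/derivable1_diffP.
have dg : differentiable g x by apply/derivable1_diffP.
have dfg : differentiable (fun y => f (g y)) x by exact: differentiable_comp.
apply: DeriveDef; first exact/derivable1_diffP.
rewrite deriveE // (diff_comp dg df) /=.
rewrite -(deriveE _ dg) gb.
have -> : 'd f (g x) b = b *: 'd f (g x) (1 : K^o).
  by rewrite -linearZ /=; congr ('d f (g x) _); rewrite /GRing.scale /= mulr1.
by rewrite -(deriveE _ df) fa mulrC.
Qed.

Lemma is_derive_hornerK (p : {poly K}) (x : K^o) :
  is_derive x (1 : K^o) (horner p : K^o -> K^o) p^`().[x].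
Proof.
elim/poly_ind: p => [|p c IH].
  have -> : horner (0 : {poly K}) = cst 0 by apply/funext => y; rewrite horner0.
  by rewrite deriv0 horner0; exact: is_derive_cst.
have -> : horner (p * 'X + c%:P) =
    ((horner p : K^o -> K^o) * (id : K^o -> K^o)) + cst c.
  by apply/funext => y; rewrite hornerMXaddC.
have H := is_deriveD (is_deriveM IH (is_derive_id x (1 : K^o)))
  (is_derive_cst (c : K^o) x (1 : K^o)).
apply: (is_derive_eq H).
rewrite derivD derivM derivX derivC !hornerE /GRing.scale /=; ring.
Qed.

Lemma is_derive_affine (V : normedModType K) (f : V -> K^o) (x v : V) (d : K) :
  (forall h : K, f (h *: v + x) = f x + h * d) -> is_derive x v f d.
Proof.
move=> fE.
have H : (fun h : K => h^-1 *: (f (h *: v + x) - f x)) @ (0 : K)^' --> (d : K^o).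
  have c0 : (fun=> d : K^o) @ (0 : K)^' --> (d : K^o) by exact: cvg_cst.
  apply: cvg_trans c0; apply: near_eq_cvg; near=> h.
  have h0 : h != 0 by near: h; exact: nbhs_dnbhs_neq.
  by rewrite fE addrC addKr /GRing.scale /= mulKf.
apply: DeriveDef; first by apply/cvg_ex; exists (d : K^o).
exact/cvg_lim.
Unshelve. all: by end_near. Qed.

End ComplexDerivatives.

(** * Points and tangent vectors as polynomials in z *)

Section LGPolynomials.
Context {R : realType} {l : nat}.
Implicit Types (a u v : 'rV[R[i]]_l.+2) (f : {poly R[i]}).

(** Clearing the factor z^-(l-k) of the numerator places a_j in degree l + 1 - j. Being linear,
    [lgV] serves both for the lower part of the numerator at a point and for its derivative along a
    tangent vector. *)
Definition lgV u : {poly R[i]} := \poly_(j < l.+1) co u (l.+1 - j).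
Definition lgP a : {poly R[i]} := 'X^(l.+1) + lgV a.
Definition lgR a u : {poly R[i]} :=
  lgV u * ('X - (co a l.+2)%:P) + (co u l.+2)%:P * lgP a.

Lemma co_eq u v : (forall j, (0 < j <= l.+2)%N -> co u j = co v j) -> u = v.
Proof.
move=> H; apply/rowP => i; have := H i.+1; rewrite /co /= inord_val; apply.
by rewrite ltn_ord.
Qed.

Lemma co_linear j c u v : co (c *: u + v) j = c * co u j + co v j.
Proof. by rewrite /co !mxE. Qed.

Lemma lgV_linear c u v : lgV (c *: u + v) = c%:P * lgV u + lgV v.
Proof.
apply/polyP => i; rewrite coefD coefCM !coef_poly; case: ltnP => _.
  by rewrite co_linear.
by rewrite mulr0 addr0.
Qed.

Lemma lgR_linear a c u v : lgR a (c *: u + v) = c%:P * lgR a u + lgR a v.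
Proof. by rewrite /lgR lgV_linear co_linear polyCD polyCM; ring. Qed.

Lemma lgR0 a : lgR a 0 = 0.
Proof.
have := lgR_linear a 1 0 0; rewrite scaler0 addr0 polyC1 mul1r => /eqP.
by rewrite -[X in X == _]addr0 (inj_eq (addrI _)) eq_sym => /eqP.
Qed.

Lemma lgR_sum a u : lgR a u = \sum_i (u 0 i)%:P * lgR a (delta_mx 0 i).
Proof.
rewrite [in LHS](row_sum_delta u).
elim: (index_enum _) => [|i s IH]; first by rewrite !big_nil lgR0.
by rewrite !big_cons lgR_linear IH.
Qed.

Lemma size_lgV u : (size (lgV u) <= l.+1)%N. Proof. exact: size_poly. Qed.

Lemma size_lgP a : size (lgP a) = l.+2.
Proof. by rewrite /lgP size_polyDl size_polyXn // ltnS size_lgV. Qed.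

Lemma monic_lgP a : lgP a \is monic.
Proof.
apply/monicP; rewrite /lgP lead_coefDl ?lead_coefXn //.
by rewrite size_polyXn ltnS size_lgV.
Qed.

Lemma lgP0 a : (lgP a).[0] = co a l.+1.
Proof. by rewrite /lgP hornerD hornerXn expr0n add0r horner_coef0 coef_poly. Qed.

Lemma size_lgR a u : (size (lgR a u) <= l.+2)%N.
Proof.
apply: leq_trans (size_polyD _ _) _; rewrite geq_max; apply/andP; split.
  apply: leq_trans (size_polyMleq _ _) _; rewrite size_XsubC addn2 /=.
  by rewrite ltnS size_lgV.
rewrite mul_polyC; apply: leq_trans (size_scale_leq _ _) _.
by rewrite size_lgP.
Qed.

(** Evaluation at the pole w isolates the component of u along a_{l+2}, as the numerator is nonzero
    there; the rest is read off after division by z - w. The same division proves [lgR_surj], so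
    tangent vectors are exactly the polynomials of degree < l + 2. *)
Lemma lgR_inj a u : (lgP a).[co a l.+2] != 0 -> lgR a u = 0 -> u = 0.
Proof.
move=> Pw R0; have uw : co u l.+2 = 0.
  have := congr1 (horner^~ (co a l.+2)) R0.
  rewrite /lgR hornerD 2!hornerM hornerXsubC subrr mulr0 add0r !hornerC.
  by move/eqP; rewrite mulf_eq0 (negbTE Pw) orbF => /eqP.
have V0 : lgV u = 0.
  move/eqP: R0; rewrite /lgR uw polyC0 mul0r addr0 mulf_eq0 polyXsubC_eq0 orbF.
  by move/eqP.
apply: co_eq => j /andP[j0]; rewrite leq_eqVlt => /predU1P[->|jl].
  by rewrite uw /co mxE.
have := congr1 (fun p : {poly R[i]} => p`_(l.+1 - j)) V0.
rewrite coef_poly coef0 ltn_subrL j0 /= subKn // => ->.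
by rewrite /co mxE.
Qed.

Lemma lgR_surj a f : (lgP a).[co a l.+2] != 0 -> (size f <= l.+2)%N ->
  exists u, lgR a u = f.
Proof.
move=> Pw sf; set w := co a l.+2 in Pw *; pose c := f.[w] / (lgP a).[w].
have : root (f - c *: lgP a) w.
  by rewrite /root hornerD hornerN hornerZ /c divfK // subrr.
move=> /factor_theorem[V VE].
have sV : (size V <= l.+1)%N.
  have [->|V0] := eqVneq V 0; first by rewrite size_poly0.
  have : (size (V * ('X - w%:P))%R <= l.+2)%N.
    rewrite -VE; apply: leq_trans (size_polyD _ _) _.
    rewrite geq_max sf size_polyN; apply: leq_trans (size_scale_leq _ _) _.
    by rewrite size_lgP.
  by rewrite size_Mmonic ?monicXsubC // size_XsubC addn2.
pose u : 'rV[R[i]]_l.+2 := \row_i (if (i < l.+1)%N then V`_(l - i) else c).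
exists u; rewrite /lgR.
have -> : co u l.+2 = c by rewrite /co mxE inordK //= ltnn.
have -> : lgV u = V.
  apply/polyP => i; rewrite coef_poly; case: ltnP => il.
    rewrite /co mxE inordK; last by rewrite ltnS; lia.
    have -> : ((l.+1 - i).-1 < l.+1)%N by lia.
    by congr (V`_ _); lia.
  by rewrite nth_default // (leq_trans sV).
by rewrite -VE mul_polyC subrK.
Qed.

End LGPolynomials.

(** * Derivatives of the superpotential *)

Section LGDerivatives.
Context {R : realType}.
Variables (k l : nat).
Hypotheses (hk : (0 < k)%N) (hkl : (k < l)%N).
Let n := (l - k)%N.
Implicit Types (a u v x : 'rV[R[i]]_l.+2) (phi : R[i]).
Let E phi : R[i] := cexp ('i * phi).

Definition lgQ a : {poly R[i]} := critp n (lgP a) (co a l.+2).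

Let lE : l.+1 = (n + k).+1. Proof. by rewrite /n; lia. Qed.
Let k0 : k%:R != 0 :> R[i]. Proof. by rewrite pnatr_eq0 -lt0n. Qed.

Lemma size_lgQ a : size (lgQ a) = l.+3.
Proof. exact: (size_critp _ lE (size_lgP a) (monic_lgP a) k0). Qed.

Lemma lead_coef_lgQ a : lead_coef (lgQ a) = k%:R.
Proof. exact: (lead_coef_critp _ lE (size_lgP a) (monic_lgP a) k0). Qed.

Lemma lg_numE a phi : lg_num k a phi = (lgP a).[E phi] / E phi ^+ n.
Proof.
have E0 : E phi != 0 := cexp_neq0 _.
have pw (j : nat) : (j <= l.+1)%N ->
    cexp ('i * (k.+1%:R - j%:R) * phi) = E phi ^+ (l.+1 - j) / E phi ^+ n.
  move=> jl; apply: (mulIf (expf_neq0 n E0)).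
  rewrite divfK ?expf_neq0 // /E -!cexpMn -cexpD; congr cexp.
  rewrite -[_ *+ n]mulr_natr -[_ *+ (_ - _)]mulr_natr (natrB _ jl).
  have -> : l.+1%:R = k.+1%:R + n%:R :> R[i] by rewrite -natrD; congr _%:R; rewrite /n; lia.
  by ring.
rewrite /lg_num /lgP hornerD hornerXn mulrDl; congr (_ + _).
  by have := pw 0%N; rewrite subr0 subn0; apply.
rewrite horner_poly mulr_suml big_add1 /= big_mkord (reindex_inj rev_ord_inj) /=.
apply: eq_bigr => i _; rewrite subSS pw ?mulrA; last by lia.
have il := ltn_ord i.
by congr (co a _ * E phi ^+ _ / _); lia.
Qed.

Lemma lamE a phi : lam k a phi =
  (lgP a).[E phi] / ('X^n * ('X - (co a l.+2)%:P)).[E phi].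
Proof.
rewrite /lam lg_numE hornerM hornerXn hornerXsubC invfM -/(E phi).
by rewrite mulrC -mulrA.
Qed.

Lemma derive1_lam a phi : E phi != co a l.+2 ->
  derive1 (lam k a) phi =
  'i * (lgQ a).[E phi] / (E phi ^+ n * (E phi - co a l.+2) ^+ 2).
Proof.
move=> Ew; have E0 : E phi != 0 := cexp_neq0 _.
set w := co a l.+2 in Ew *.
pose D : {poly R[i]} := 'X^n * ('X - w%:P).
have D0 : D.[E phi] != 0.
  by rewrite hornerM hornerXn hornerXsubC mulf_neq0 ?expf_neq0 // subr_eq0.
have lin : is_derive (phi : R[i]^o) (1 : R[i]^o) (fun y : R[i]^o => 'i * y : R[i]^o) 'i.
  apply: is_derive_affine => h; rewrite mulrDr addrC /GRing.scale /= mulr1.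
  by rewrite [h * _]mulrC.
have dE : is_derive (phi : R[i]^o) (1 : R[i]^o) (E : R[i]^o -> R[i]^o) (E phi * 'i).
  exact: (is_derive1_compK (is_derive_cexp ('i * phi)) lin).
have dP := is_derive1_compK (is_derive_hornerK (lgP a) (E phi)) dE.
have dD := is_derive1_compK (is_derive_hornerK D (E phi)) dE.
have derD : derivable (fun y : R[i]^o => D.[E y] : R[i]^o) (phi : R[i]^o) (1 : R[i]^o).
  by case: dD.
have derP : derivable (fun y : R[i]^o => (lgP a).[E y] : R[i]^o) (phi : R[i]^o) (1 : R[i]^o).
  by case: dP.
have derV := @derivableV _ _ _ (phi : R[i]^o) (1 : R[i]^o) D0 derD.
have -> : lam k a = (fun y : R[i]^o => (lgP a).[E y] * (D.[E y])^-1 : R[i]^o).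
  by apply/funext => y; rewrite lamE.
rewrite derive1E; apply: etrans (deriveM derP derV) _.
rewrite (@deriveV _ _ _ _ _ D0 derD).
rewrite (@derive_val _ _ _ _ _ _ _ dP) (@derive_val _ _ _ _ _ _ _ dD).
rewrite /GRing.scale /=.
have -> : D^`().[E phi] = n%:R * E phi ^+ n.-1 * (E phi - w) + E phi ^+ n.
  rewrite derivM derivXsubC mulr1 hornerD hornerM hornerXsubC derivXn.
  by rewrite hornerMn !hornerXn -[_ *+ n]mulr_natl.
have -> : (lgQ a).[E phi] = E phi * (lgP a)^`().[E phi] * (E phi - w)
    - n%:R * ((lgP a).[E phi] * (E phi - w)) - E phi * (lgP a).[E phi].
  rewrite /lgQ /critp; move: (lgP a) => p.
  by rewrite !(hornerD, hornerN, hornerM, hornerX, hornerC).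
have -> : D.[E phi] = E phi ^+ n * (E phi - w).
  by rewrite hornerM hornerXn hornerXsubC.
have n0 : (0 < n)%N by rewrite /n subn_gt0.
have gen (z p p' y : R[i]) : z != 0 -> y != 0 ->
  p * (- (z ^+ n * y) ^- 2 * ((n%:R * z ^+ n.-1 * y + z ^+ n) * (z * 'i)))
  + (z ^+ n * y)^-1 * (p' * (z * 'i)) =
  'i * (z * p' * y - n%:R * (p * y) - z * p) / (z ^+ n * y ^+ 2).
  move=> z0 y0; rewrite -[in RHS](prednK n0) -[in LHS](prednK n0) /= !exprS.
  have := expf_neq0 n.-1 z0; move: (z ^+ n.-1) => t t0.
  by field; rewrite z0 y0 t0.
by apply: gen => //; rewrite subr_eq0.
Qed.

Lemma dlamE u a phi : E phi != co a l.+2 ->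
  dlam k u a phi = (lgR a u).[E phi] / (E phi ^+ n * (E phi - co a l.+2) ^+ 2).
Proof.
move=> Ew; have E0 : E phi != 0 := cexp_neq0 _.
set z := E phi in Ew E0 *; set w := co a l.+2 in Ew *.
have dP : is_derive a u (fun b => ((lgP b).[z] / z ^+ n : R[i]^o)) ((lgV u).[z] / z ^+ n).
  apply: is_derive_affine => h.
  rewrite /lgP lgV_linear !hornerD hornerM hornerC; ring.
have dw : is_derive a u (fun b => (z - co b l.+2 : R[i]^o)) (- co u l.+2).
  by apply: is_derive_affine => h; rewrite co_linear; ring.
have w0 : z - w != 0 by rewrite subr_eq0.
have derP : derivable (fun b => ((lgP b).[z] / z ^+ n : R[i]^o)) a u by case: dP.
have derw : derivable (fun b => (z - co b l.+2 : R[i]^o)) a u by case: dw.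
pose fw (b : 'rV[R[i]]_l.+2) : R[i]^o := z - co b l.+2.
have derV := @derivableV _ _ fw a u w0 derw.
rewrite /dlam.
have -> : (fun b : 'rV[R[i]]_l.+2 => lam k b phi) =
    (fun b : 'rV[R[i]]_l.+2 => (z - co b l.+2)^-1 * ((lgP b).[z] / z ^+ n) : R[i]^o).
  by apply/funext => b; rewrite /lam lg_numE.
apply: etrans (deriveM derV derP) _.
rewrite (@deriveV _ _ fw _ _ w0 derw).
rewrite (@derive_val _ _ _ _ _ _ _ dP) (@derive_val _ _ _ _ _ _ _ dw).
rewrite /GRing.scale /=.
have -> : (lgR a u).[z] = (lgV u).[z] * (z - w) + co u l.+2 * (lgP a).[z].
  rewrite /lgR -/w; move: (lgP a) (lgV u) => p q.
  by rewrite hornerD 2!hornerM hornerXsubC hornerC.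
rewrite -[fw a]/(z - w).
have := expf_neq0 n E0; move: (z ^+ n) (z - w) w0 => t y y0 t0.
by field; rewrite y0 t0.
Qed.

End LGDerivatives.

Lemma row_free_unitmx (K : fieldType) (n : nat) (A : 'M[K]_n) :
  (forall v : 'rV_n, v *m A = 0 -> v = 0) -> A \in unitmx.
Proof. by move=> H; rewrite -row_free_unit; apply: inj_row_free. Qed.

(** * The metric and the triple tensor as residues modulo Q *)

Section LGStructure.
Context {R : realType}.
Variables (k l : nat).
Hypotheses (hk : (0 < k)%N) (hkl : (k < l)%N).
Let n := (l - k)%N.
Implicit Types (a u v x : 'rV[R[i]]_l.+2) (f I J : {poly R[i]}).
Let lE : l.+1 = (n + k).+1. Proof. by rewrite /n; lia. Qed.

Lemma lg_domain_polyE a : lg_domain k l a <->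
  [/\ (lgP a).[0] != 0, co a l.+2 != 0 & (lgP a).[co a l.+2] != 0].
Proof.
rewrite lgP0; split=> -[a1 a2 H]; split => //.
  have [phi [_ _ e]] := cexpi_surj a2.
  by have := H _ e; rewrite lg_numE // e mulf_eq0 negb_or => /andP[].
move=> phi e; rewrite lg_numE // e mulf_neq0 // invr_eq0 expf_neq0 //.
Qed.

Section AtPoint.
Variable a : 'rV[R[i]]_l.+2.
Hypothesis aD : lg_domain k l a.
Let Q := lgQ k a.
Let w := co a l.+2.
Let w0 : w != 0. Proof. by case/lg_domain_polyE: aD. Qed.
Let Pw : (lgP a).[w] != 0. Proof. by case/lg_domain_polyE: aD. Qed.
Let P0 : (lgP a).[0] != 0. Proof. by case/lg_domain_polyE: aD. Qed.

Lemma lgQ_at0 : Q.[0] != 0.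
Proof.
rewrite /Q /lgQ horner_critp0 !mulf_neq0 // pnatr_eq0 -lt0n subn_gt0 //.
Qed.

Lemma lgQ_atw : Q.[w] != 0.
Proof. by rewrite /Q /lgQ horner_critpw mulf_neq0 // oppr_eq0. Qed.

Lemma lgQ_coprime i j : coprimep ('X^i * ('X - w%:P) ^+ j) Q.
Proof.
rewrite coprimepMl; apply/andP; split; apply: coprimep_expl.
  by rewrite coprimep_sym coprimepX /root lgQ_at0.
by rewrite coprimep_sym coprimep_XsubC /root lgQ_atw.
Qed.

Lemma lgQ_inverse i j : exists I, Q %| 'X^i * ('X - w%:P) ^+ j * I - 1.
Proof.
have /Bezout_eq1_coprimepP[[u v] /= e] := lgQ_coprime i j.
by exists u; apply/dvdpP; exists (- v); rewrite -e; ring.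
Qed.

Lemma lg_critE : lg_crit k a =
  [set phi | [/\ 0 <= complex.Re phi, complex.Re phi < 2 * pi &
                 Q.[cexp ('i * phi)] = 0]].
Proof.
apply/seteqP; split => phi /= [].
  move=> p0 p1 ne; rewrite derive1_lam // => /eqP.
  have D0 : cexp ('i * phi) ^+ (l - k) * (cexp ('i * phi) - co a l.+2) ^+ 2 != 0.
    by rewrite mulf_neq0 // expf_neq0 ?subr_eq0 // cexp_neq0.
  rewrite mulf_eq0 invr_eq0 (negbTE D0) orbF mulf_eq0 (negbTE (neq0Ci _)) /=.
  by move/eqP.
move=> p0 p1 Q0; have ne : cexp ('i * phi) != w.
  by apply: contraNneq lgQ_atw => <-; rewrite Q0.
by split => //; rewrite derive1_lam // -/Q Q0 mulr0 mul0r.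
Qed.

Lemma near_crit_neq phi0 : lg_crit k a phi0 ->
  \forall phi \near (phi0 : R[i]^o)^', cexp ('i * phi) != w.
Proof.
case=> _ _ ne _; have : ('X - w%:P).[cexp ('i * phi0)] != 0.
  by rewrite hornerXsubC subr_eq0.
move=> /near_horner_cexpi_neq0 H; apply: nbhs_dnbhs; near=> phi.
by rewrite -subr_eq0 -hornerXsubC; near: phi; exact: H.
Unshelve. all: by end_near. Qed.

(** From d_u lambda = R_u / (z^n (z-w)^2) and dlambda/dphi = i Q / (z^n (z-w)^2), the integrand is i
    z times -R_u R_v / (z^(n+1) (z-w)^2 Q), the shape required by [sum_residues]; the minus sign
    turns (-1)^(k+1) into (-1)^k. *)
Lemma lg_etaE I : Q %| 'X^(n.+1) * ('X - w%:P) ^+ 2 * I - 1 ->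
  forall u v, lg_eta k a u v = (-1) ^+ k * rho Q (lgR a u * lgR a v * I).
Proof.
move=> HI u v; rewrite /lg_eta.
rewrite (sum_residues (f := - (lgR a u * lgR a v)) lgQ_at0 HI lg_critE).
  by rewrite mulNr raddfN /= exprS; ring.
move=> phi0 c0; near=> phi.
have ne : cexp ('i * phi) != w by near: phi; exact: near_crit_neq.
rewrite !dlamE // derive1_lam // -/w -/n -/Q.
have E0 : cexp ('i * phi) != 0 := cexp_neq0 _.
rewrite hornerN [(lgR a u * _).[_]]hornerM [('X^_ * _).[_]]hornerM hornerXn.
rewrite horner_exp hornerXsubC.
have gen (z y r s q : R[i]) : z != 0 -> y != 0 ->
  r / (z ^+ n * y ^+ 2) * (s / (z ^+ n * y ^+ 2)) / ('i * q / (z ^+ n * y ^+ 2)) =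
  'i * z * (- (r * s) / (z ^+ n.+1 * y ^+ 2 * q)).
  move=> z0 y0; rewrite (exprS z n); have := expf_neq0 n z0.
  move: (z ^+ n) => t t0.
  have ii : 'i * 'i = -1 :> R[i] by rewrite -expr2 sqrCi.
  have [->|q0] := eqVneq q 0; first by rewrite !(mulr0, mul0r, invr0).
  have i0 : 'i != 0 :> R[i] by rewrite neq0Ci.
  set L := LHS; have -> : L = - ('i * 'i) * L by rewrite ii opprK mul1r.
  by rewrite /L; field; rewrite i0 q0 y0 t0 z0.
by apply: gen => //; rewrite subr_eq0.
Unshelve. all: by end_near. Qed.

Lemma lg_cE I J : Q %| 'X^(n.+1) * ('X - w%:P) ^+ 2 * I - 1 ->
  Q %| 'X^n * ('X - w%:P) ^+ 2 * J - 1 ->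
  forall u v x, lg_c k a u v x = rho Q (lgR a u * lgR a v * lgR a x * I * J).
Proof.
move=> HI HJ u v x; rewrite /lg_c.
have HIJ : Q %| 'X^(n.+1 + n) * ('X - w%:P) ^+ 4 * (I * J) - 1.
  have -> : 'X^(n.+1 + n) * ('X - w%:P) ^+ 4 * (I * J) - 1 =
    ('X^(n.+1) * ('X - w%:P) ^+ 2 * I - 1) * ('X^n * ('X - w%:P) ^+ 2 * J)
    + ('X^n * ('X - w%:P) ^+ 2 * J - 1) by rewrite exprD; ring.
  by rewrite dvdp_add // dvdp_mulr.
rewrite (sum_residues (f := - (lgR a u * lgR a v * lgR a x)) lgQ_at0 HIJ lg_critE).
  by rewrite mulNr raddfN /= opprK mulrA.
move=> phi0 c0; near=> phi.
have ne : cexp ('i * phi) != w by near: phi; exact: near_crit_neq.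
rewrite !dlamE // derive1_lam // -/w -/n -/Q.
have E0 : cexp ('i * phi) != 0 := cexp_neq0 _.
rewrite hornerN [(_ * lgR a x).[_]]hornerM [(lgR a u * _).[_]]hornerM.
rewrite [('X^_ * _).[_]]hornerM hornerXn horner_exp hornerXsubC.
have gen (z y r s r' q : R[i]) : z != 0 -> y != 0 ->
  r / (z ^+ n * y ^+ 2) * (s / (z ^+ n * y ^+ 2)) * (r' / (z ^+ n * y ^+ 2))
    / ('i * q / (z ^+ n * y ^+ 2)) =
  'i * z * (- (r * s * r') / (z ^+ (n.+1 + n) * y ^+ 4 * q)).
  move=> z0 y0; rewrite (exprD z n.+1 n) (exprS z n); have := expf_neq0 n z0.
  move: (z ^+ n) => t t0.
  have ii : 'i * 'i = -1 :> R[i] by rewrite -expr2 sqrCi.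
  have [->|q0] := eqVneq q 0; first by rewrite !(mulr0, mul0r, invr0).
  have i0 : 'i != 0 :> R[i] by rewrite neq0Ci.
  set L := LHS; have -> : L = - ('i * 'i) * L by rewrite ii opprK mul1r.
  by rewrite /L; field; rewrite i0 q0 y0 t0 z0.
by apply: gen => //; rewrite subr_eq0.
Unshelve. all: by end_near. Qed.

End AtPoint.
End LGStructure.

Section LGAlgebra.
Context {R : realType}.
Variables (k l : nat).
Hypotheses (hk : (0 < k)%N) (hkl : (k < l)%N).
Let n := (l - k)%N.
Implicit Types (u v x : 'rV[R[i]]_l.+2) (f I J : {poly R[i]}).
Variable a : 'rV[R[i]]_l.+2.
Hypothesis aD : lg_domain k l a.
Let Q := lgQ k a.
Let w := co a l.+2.
Let Pw : (lgP a).[w] != 0. Proof. by case/(lg_domain_polyE hk hkl): aD. Qed.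

Lemma coprimep_dvdl f g : coprimep g Q -> Q %| f * g -> Q %| f.
Proof. by move=> c; rewrite Gauss_dvdpl // coprimep_sym. Qed.

Lemma rho_lgR_nondeg f :
  (forall u, rho Q (f * lgR a u) = 0) -> Q %| f.
Proof.
move=> H; apply: rho_nondeg; first by rewrite (size_lgQ hk hkl).
move=> j; rewrite (size_lgQ hk hkl) /= => jl.
have [|u <-] := @lgR_surj _ _ a 'X^j Pw; last exact: H.
by rewrite size_polyXn.
Qed.

Lemma lgR_eq u v : Q %| lgR a u - lgR a v -> u = v.
Proof.
move=> d; apply/eqP; rewrite -subr_eq0; apply/eqP; apply: (lgR_inj Pw).
have -> : lgR a (u - v) = lgR a u - lgR a v.
  by rewrite -[u - v]addrC -scaleN1r lgR_linear polyCN polyC1 mulN1r addrC.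
apply/eqP; apply: contraTT d => d0; rewrite gtNdvdp // (size_lgQ hk hkl) ltnS.
apply: leq_trans (size_polyD _ _) _; rewrite size_polyN geq_max.
by rewrite !size_lgR.
Qed.

Variables (I J : {poly R[i]}).
Hypothesis HI : Q %| 'X^(n.+1) * ('X - w%:P) ^+ 2 * I - 1.
Hypothesis HJ : Q %| 'X^n * ('X - w%:P) ^+ 2 * J - 1.

Lemma coprimep_inv D f : Q %| D * f - 1 -> coprimep f Q.
Proof.
move=> /dvdpP[s e]; apply/Bezout_eq1_coprimepP; exists (D, - s) => /=.
by rewrite mulNr -e opprB addrC subrK.
Qed.

Lemma lg_metric_row u j : (u *m lg_metric k a) 0 j =
  (-1) ^+ k * rho Q (lgR a u * lgR a (delta_mx 0 j) * I).
Proof.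
rewrite mxE [lgR a u]lgR_sum !mulr_suml rho_sum mulr_sumr.
apply: eq_bigr => i _; rewrite mxE (lg_etaE hk hkl aD HI) -/Q.
by rewrite -!mulrA rhoCM mulrCA.
Qed.

Lemma eta_lg u v : Defs.eta (lg_frobenius R k l) a u v =
  (-1) ^+ k * rho Q (lgR a u * lgR a v * I).
Proof.
rewrite /Defs.eta /= mxE [in RHS](lgR_sum a v) mulr_sumr mulr_suml rho_sum mulr_sumr.
apply: eq_bigr => j _; rewrite lg_metric_row mxE.
have -> : lgR a u * ((v 0 j)%:P * lgR a (delta_mx 0 j)) * I =
    v 0 j *: (lgR a u * lgR a (delta_mx 0 j) * I) by rewrite -mul_polyC; ring.
by rewrite rhoZ -[LHS]mulrA; congr (_ * _); exact: mulrC.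
Qed.

Lemma lg_metric_unitmx : lg_metric k a \in unitmx.
Proof.
apply: row_free_unitmx => v v0; apply: lgR_eq; rewrite lgR0 subr0.
apply: (@coprimep_dvdl _ I); first exact: coprimep_inv HI.
apply: rho_lgR_nondeg => u; have := eta_lg v u.
rewrite /Defs.eta /= v0 mul0mx mxE => /esym/eqP.
rewrite mulf_eq0 signr_eq0 /= => /eqP <-; congr (rho _ _); ring.
Qed.

(** By nondegeneracy of the metric it is enough that eta(x, .) be the triple tensor at (u, v, .).
    Both are global residues against R of the last argument, so a congruence modulo Q suffices once
    the denominators are cleared with I and J. *)
Lemma lg_multE u v x :
  Q %| lgR a x * ('X^n * ('X - w%:P) ^+ 2) - (-1) ^+ k * (lgR a u * lgR a v) ->
  lg_mult k a u v = x.
Proof.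
move=> H; rewrite /lg_mult; apply: (canLR (mulmxK lg_metric_unitmx)).
apply/rowP => j; rewrite lg_metric_row mxE (lg_cE hk hkl aD HI HJ) -/Q.
have -> : (-1) ^+ k * rho Q (lgR a x * lgR a (delta_mx 0 j) * I) =
  rho Q ((-1) ^+ k * (lgR a x * lgR a (delta_mx 0 j) * I)).
  have -> : (-1) ^+ k = ((-1) ^+ k)%:P :> {poly R[i]}.
    by rewrite polyC_exp polyCN polyC1.
  by rewrite rhoCM.
apply: rho_mod; set z := lgR a (delta_mx 0 j).
have s2 : ((-1) ^+ k) * ((-1) ^+ k) = 1 :> {poly R[i]}.
  by rewrite -exprMn mulrNN mulr1 expr1n.
have -> : lgR a u * lgR a v * z * I * J - (-1) ^+ k * (lgR a x * z * I) =
  - (lgR a x * ('X^n * ('X - w%:P) ^+ 2) - (-1) ^+ k * (lgR a u * lgR a v))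
    * ((-1) ^+ k * z * I * J)
  + ('X^n * ('X - w%:P) ^+ 2 * J - 1) * ((-1) ^+ k * lgR a x * z * I).
  transitivity (((-1) ^+ k * (-1) ^+ k) * (lgR a u * lgR a v * z * I * J)
    - (-1) ^+ k * (lgR a x * z * I)); last by ring.
  by rewrite s2 mul1r.
by rewrite dvdp_add // dvdp_mulr // dvdpNr.
Qed.

End LGAlgebra.

(** * The map Phi *)

Section RowDifferentiability.
Variables (K : numFieldType) (V : normedModType K) (n : nat).
Implicit Types (f : V -> 'rV[K]_n) (x v : V).

Lemma differentiable_row f x :
  (forall i, differentiable (fun y => f y 0 i : K^o) x) -> differentiable f x.
Proof.
move=> df.
have -> : f = \sum_(i < n) (fun y => (f y 0 i : K^o) *: (delta_mx 0 i : 'rV[K]_n)).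
  apply/funext => y; rewrite [LHS]row_sum_delta fct_sumE.
  by apply: eq_bigr.
by apply: differentiable_sum => i; apply: differentiableZl.
Qed.

Lemma diff_row_coord f x v i : differentiable f x ->
  ('d f x v) 0 i = 'D_v (fun y => f y 0 i : K^o) x.
Proof.
move=> df; have dc := @differentiable_coord K 1 n (f x) 0 i.
rewrite deriveE; last exact: (differentiable_comp df dc).
rewrite (diff_comp df dc) /=.
have lin : linear (fun N : 'rV[K]_n => N 0 i : K^o) by move=> c A B; rewrite !mxE.
pose L : {linear 'rV[K]_n -> K^o} := HB.pack (fun N : 'rV[K]_n => N 0 i : K^o)
  (GRing.isLinear.Build _ _ _ _ _ lin).
have -> : 'd (fun N : 'rV[K]_n => N 0 i : K^o) (f x) = 'd L (f x) :> (_ -> _) by [].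
rewrite diff_lin //.
by move=> N; apply: differentiable_continuous; exact: differentiable_coord.
Qed.

End RowDifferentiability.

Section OrbitMap.
Context {R : realType} {l : nat}.
Variable k : nat.
Implicit Types (p u v : 'rV[R[i]]_l.+2).

Lemma coD u v j : co (u + v) j = co u j + co v j.
Proof. by rewrite /co mxE. Qed.

Lemma coZ c u j : co (c *: u) j = c * co u j.
Proof. by rewrite /co mxE. Qed.

Lemma co_sum (I : Type) (r : seq I) (P : pred I) (f : I -> 'rV[R[i]]_l.+2) j :
  co (\sum_(i <- r | P i) f i) j = \sum_(i <- r | P i) co (f i) j.
Proof. by rewrite /co summxE. Qed.

Lemma co_dir i j : (0 < i <= l.+2)%N -> (0 < j <= l.+2)%N ->
  co (dir i : 'rV[R[i]]_l.+2) j = (i == j)%:R.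
Proof.
move=> hi hj; rewrite /co /dir mxE eqxx /=; congr (_%:R); congr nat_of_bool.
apply/eqP/eqP => [/(congr1 val)|->//] /=; rewrite !inordK; lia.
Qed.

(** The index l + 1 gets the value 1: the top elementary symmetric function of the exp(2 pi i v_s)
    is 1 because the v_s sum to 0. *)
Definition orbY p j : R[i] := if (j <= l)%N then co p j else 1.
Definition orbdY u j : R[i] := if (j <= l)%N then co u j else 0.

(** The subtractions are truncated, so the exponents are max(j - k, 0) and max(j - k - 1, 0). They
    come from d_{j,r} = min(j,r) - j r/(l+1): after a common rescaling of the zeros only the excess
    of j over k, respectively over k + 1, remains. *)
Definition phico j p : R[i]^o :=
  (-1) ^+ j * (orbY p j * (co p l.+1 ^+ (j - k) * co p l.+2 ^+ (j - k.+1))).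

Definition dphico j p u : R[i] :=
  (-1) ^+ j * (orbdY u j * (co p l.+1 ^+ (j - k) * co p l.+2 ^+ (j - k.+1))
   + orbY p j *
     ((j - k)%:R * co p l.+1 ^+ (j - k).-1 * co u l.+1 * co p l.+2 ^+ (j - k.+1)
      + co p l.+1 ^+ (j - k)
        * ((j - k.+1)%:R * co p l.+2 ^+ (j - k.+1).-1 * co u l.+2))).

Definition Phi p : 'rV[R[i]]_l.+2 :=
  \row_i (if (i < l.+1)%N then phico i.+1 p else co p l.+1).

Definition dPhi p u : 'rV[R[i]]_l.+2 :=
  \row_i (if (i < l.+1)%N then dphico i.+1 p u else co u l.+1).

Lemma co_Phi p j : (0 < j <= l.+1)%N -> co (Phi p) j = phico j p.
Proof.
case/andP=> j0 jl; rewrite /co mxE inordK ?prednK //; last by lia.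
by rewrite jl.
Qed.

Lemma co_Phi_last p : co (Phi p) l.+2 = co p l.+1.
Proof. by rewrite {1}/co mxE inordK //= ltnn. Qed.

Lemma co_dPhi p u j : (0 < j <= l.+1)%N -> co (dPhi p u) j = dphico j p u.
Proof.
case/andP=> j0 jl; rewrite /co mxE inordK ?prednK //; last by lia.
by rewrite jl.
Qed.

Lemma co_dPhi_last p u : co (dPhi p u) l.+2 = co u l.+1.
Proof. by rewrite {1}/co mxE inordK //= ltnn. Qed.

Lemma is_derive_co j p u :
  is_derive p u (fun q : 'rV[R[i]]_l.+2 => co q j : R[i]^o) (co u j).
Proof.
by apply: is_derive_affine => h; rewrite co_linear addrC.
Qed.

Lemma differentiable_co j p :
  differentiable (fun q : 'rV[R[i]]_l.+2 => co q j : R[i]^o) p.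
Proof. exact: differentiable_coord. Qed.

End OrbitMap.

Section PowerRule.
Variables (K : numFieldType) (V : normedModType K).

Lemma is_derive_expK (f : V -> K^o) (x v : V) (d : K) j :
  is_derive x v f d ->
  is_derive x v (fun y => f y ^+ j : K^o) (j%:R * f x ^+ j.-1 * d).
Proof.
move=> df; elim: j => [|j IH].
  rewrite mul0r mul0r.
  have -> : (fun y => f y ^+ 0 : K^o) = cst 1 by apply/funext => y; rewrite expr0.
  exact: is_derive_cst.
have -> : (fun y => f y ^+ j.+1 : K^o) = (f * (fun y => f y ^+ j : K^o)).
  by apply/funext => y; rewrite exprS.
apply: (is_derive_eq (is_deriveM df IH)); rewrite /GRing.scale /=.
case: j {IH} => [|j]; first by rewrite expr0 /=; ring.
have gen (y : K) : y * (j.+1%:R * y ^+ j * d) + y ^+ j.+1 * d =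
    j.+2%:R * y ^+ j.+1 * d by rewrite -[j.+2%:R]natr1 exprS; ring.
exact: gen.
Qed.

Lemma differentiable_expK (f : V -> K^o) (x : V) j :
  differentiable f x -> differentiable (fun y => f y ^+ j : K^o) x.
Proof.
move=> df; elim: j => [|j IH].
  have -> : (fun y => f y ^+ 0 : K^o) = cst 1 by apply/funext => y; rewrite expr0.
  exact: differentiable_cst.
have -> : (fun y => f y ^+ j.+1 : K^o) = (f * (fun y => f y ^+ j : K^o)).
  by apply/funext => y; rewrite exprS.
exact: differentiableM.
Qed.

End PowerRule.

Section OrbitMapDerivative.
Context {R : realType} {l : nat}.
Variable k : nat.
Implicit Types (p u v : 'rV[R[i]]_l.+2).

Lemma is_derive_orbY j p u :
  is_derive p u (fun q => orbY q j : R[i]^o) (orbdY u j).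
Proof.
rewrite /orbY /orbdY; case: leqP => _; first exact: is_derive_co.
exact: is_derive_cst.
Qed.

Lemma is_derive_phico j p u : is_derive p u (phico k j) (dphico k j p u).
Proof.
have H1 := is_derive_expK (j - k) (@is_derive_co R l l.+1 p u).
have H2 := is_derive_expK (j - k.+1) (@is_derive_co R l l.+2 p u).
have H := is_deriveM (is_derive_cst ((-1) ^+ j : R[i]^o) p u)
  (is_deriveM (is_derive_orbY j p u) (is_deriveM H1 H2)).
apply: (is_derive_eq H); rewrite /dphico /GRing.scale /=.
have gen (s y y' A B cA cB A' B' a b x : R[i]) :
  s * (y * (A * (cB * B' * b) + B * (cA * A' * a)) + (A * B) * y') + x * 0 =
  s * (y' * (A * B) + y * (cA * A' * a * B + A * (cB * B' * b))) by ring.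
exact: gen.
Qed.

Lemma differentiable_phico j p : differentiable (phico k j) p.
Proof.
have H1 := differentiable_expK (j - k) (@differentiable_co R l l.+1 p).
have H2 := differentiable_expK (j - k.+1) (@differentiable_co R l l.+2 p).
have H3 : differentiable (fun q => orbY q j : R[i]^o) p.
  rewrite /orbY; case: leqP => _; first exact: differentiable_co.
  exact: differentiable_cst.
exact: (differentiableM (differentiable_cst _ _)
  (differentiableM H3 (differentiableM H1 H2))).
Qed.

Lemma differentiable_Phi p : differentiable (Phi k) p.
Proof.
apply: differentiable_row => i.
have -> : (fun q => Phi k q 0 i : R[i]^o) =
    if (i < l.+1)%N then phico k i.+1 else (fun q => co q l.+1).
  by apply/funext => q; rewrite mxE; case: ifP.
by case: ifP => _; [exact: differentiable_phico|exact: differentiable_co].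
Qed.

Lemma diff_Phi p u : 'd (Phi k) p u = dPhi k p u.
Proof.
apply/rowP => i; rewrite (diff_row_coord _ _ (differentiable_Phi p)) mxE.
have -> : (fun q => Phi k q 0 i : R[i]^o) =
    if (i < l.+1)%N then phico k i.+1 else (fun q => co q l.+1).
  by apply/funext => q; rewrite mxE; case: ifP.
case: ifP => _; last exact: (@derive_val _ _ _ _ _ _ _ (is_derive_co _ _ _)).
exact: (@derive_val _ _ _ _ _ _ _ (is_derive_phico _ _ _)).
Qed.

End OrbitMapDerivative.

(** * The unit and Euler fields under the map *)

Section OrbitAlgebra.
Context {R : realType} {l : nat}.
Variable k : nat.
Hypotheses (hk : (0 < k)%N) (hkl : (k < l)%N).
Let n := (l - k)%N.
Implicit Types (p u v : 'rV[R[i]]_l.+2).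

Definition edir : 'rV[R[i]]_l.+2 := dir k + dir k.+1.

Lemma orbit_unit_edir p : orbit_unit k p = edir.
Proof. by rewrite /orbit_unit /dy_vec (ltnW hkl) hkl. Qed.

Lemma co_edir j : (0 < j <= l.+2)%N -> co edir j = (j == k)%:R + (j == k.+1)%:R.
Proof.
move=> hj; rewrite /edir coD !co_dir // ?[_ == j]eq_sym //; lia.
Qed.

Lemma co_lineE p t j : (0 < j <= l.+2)%N ->
  co (p + t *: edir) j = co p j + t * ((j == k)%:R + (j == k.+1)%:R).
Proof. by move=> hj; rewrite coD coZ co_edir. Qed.

Definition Rp p u := lgR (Phi k p) (dPhi k p u).

Lemma lgP_PhiE p : lgP (Phi k p) =
  \sum_(0 <= j < l.+2) ((-1) ^+ j * (if j == 0%N then 1 else orbY p j)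
     * co p l.+1 ^+ (j - k) * co p l.+2 ^+ (j - k.+1))%:P * 'X^(l.+1 - j).
Proof.
rewrite big_nat_recl //= /lgP ?sub0n ?expr0 ?mul1r ?mulr1 ?polyC1 ?mul1r ?subn0.
congr (_ + _); rewrite big_mkord /lgV poly_def (reindex_inj rev_ord_inj) /=.
apply: eq_bigr => i _; rewrite -mul_polyC; congr (_%:P * _).
have -> : (l.+1 - (l.+1 - i.+1))%N = i.+1 by have := ltn_ord i; lia.
rewrite co_Phi /phico ?mulrA //; have := ltn_ord i; lia.
Qed.

(** The numerator vanishes at the pole exactly where [tsing] does; this matches the singular loci of
    the two manifolds. *)
Lemma lgP_Phi_q1 p :
  (lgP (Phi k p)).[co p l.+1] = co p l.+1 ^+ n.+1 * tsing k p.
Proof.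
rewrite lgP_PhiE horner_sum /tsing mulrDr !mulr_sumr.
rewrite (@big_cat_nat _ _ _ k.+1) //=; last by lia.
have YE j : (j <= l.+1)%N -> (if j == 0%N then 1 else orbY p j) =
  (if (0 < j <= l)%N then co p j else 1).
  by move=> jl; rewrite /orbY; case: j jl => //= j jl.
have gen1 (q s Y : R[i]) i j : s * Y * 1 * 1 * q ^+ (i + j) = q ^+ i * (s * Y * q ^+ j).
  by rewrite exprD; ring.
have gen2 (q r s Y : R[i]) i j : s * Y * q ^+ i * r * q ^+ j = q ^+ (i + j) * (s * Y * r).
  by rewrite exprD; ring.
congr (_ + _).
  apply: eq_big_nat => j hj; rewrite hornerM hornerC hornerXn YE; last by lia.
  have -> : (j - k = 0)%N by lia. have -> : (j - k.+1 = 0)%N by lia.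
  rewrite !expr0 -gen1; congr (_ * _ ^+ _); rewrite /n; lia.
apply: eq_big_nat => j hj; rewrite hornerM hornerC hornerXn YE; last by lia.
by rewrite gen2; congr (_ ^+ _ * _); rewrite /n; lia.
Qed.

Lemma lgP_Phi_0 p : (lgP (Phi k p)).[0] =
  (-1) ^+ l.+1 * (co p l.+1 ^+ n.+1 * co p l.+2 ^+ n).
Proof.
rewrite lgP0 co_Phi ?leqnn // /phico /orbY ltnn mul1r.
by congr (_ * (_ ^+ _ * _ ^+ _)); rewrite /n; lia.
Qed.

(** Only the indices k and k + 1 move, and their contributions combine into the denominator z^n (z -
    w): moving along the unit adds the constant (-1)^k t to lambda. Hence derivatives of lambda, and
    with them Q and the classes R_u, do not change. *)
Lemma lgP_Phi_line p t :
  lgP (Phi k (p + t *: edir)) =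
  lgP (Phi k p) + ((-1) ^+ k * t)%:P * ('X^n * ('X - (co p l.+1)%:P)).
Proof.
rewrite /lgP -addrA; congr (_ + _); apply/polyP => i.
rewrite coefD !coef_poly coefCM mulrBr -exprSr coefB coefMC !coefXn.
case: (ltnP i l.+1) => il; last first.
  have -> : (i == n.+1) = false by rewrite /n; lia.
  have -> : (i == n) = false by rewrite /n; lia.
  by rewrite mul0r subrr mulr0 addr0.
rewrite !co_Phi; [|lia..]; rewrite /phico !co_lineE; [|lia..].
have -> : (l.+1 == k) = false by lia. have -> : (l.+1 == k.+1) = false by lia.
have -> : (l.+2 == k) = false by lia. have -> : (l.+2 == k.+1) = false by lia.
rewrite addr0 mulr0 !addr0 /orbY.
have -> : (i == n.+1) = (l.+1 - i == k)%N by rewrite /n; lia.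
have -> : (i == n) = (l.+1 - i == k.+1)%N by rewrite /n; lia.
set j := (l.+1 - i)%N; have jb : (0 < j <= l.+1)%N by rewrite /j; lia.
have [->|jk] := eqVneq j k.
  have -> : (k == k.+1) = false by lia. rewrite (ltnW hkl) co_lineE; last by lia.
  rewrite eqxx (_ : (k == k.+1) = false); last by lia.
  have -> : (k - k.+1 = 0)%N by lia.
  by rewrite subnn !expr0 mulr1n mulr0n; move: ((-1) ^+ k) => s; ring.
have [->|jk1] := eqVneq j k.+1.
  rewrite hkl co_lineE; last by lia.
  rewrite eqxx (_ : (k.+1 == k) = false); last by lia.
  by rewrite subnn subSnn expr0 expr1 exprS mulr1n mulr0n; move: ((-1) ^+ k) => s; ring.
rewrite mul0r subrr mulr0 addr0; case: ifP => // jl; rewrite co_lineE; last by lia.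
by rewrite (negbTE jk) (negbTE jk1) addr0 mulr0 addr0.
Qed.

Lemma lgV_dPhi_line p t u :
  lgV (dPhi k (p + t *: edir) u) =
  lgV (dPhi k p u) - ((-1) ^+ k * t * co u l.+1)%:P * 'X^n.
Proof.
apply/polyP => i; rewrite coefB !coef_poly coefCM !coefXn.
case: (ltnP i l.+1) => il; last first.
  by rewrite (_ : (i == n) = false) ?mulr0 ?subr0 // /n; lia.
rewrite !co_dPhi; [|lia..]; rewrite /dphico !co_lineE; [|lia..].
have -> : (l.+1 == k) = false by lia. have -> : (l.+1 == k.+1) = false by lia.
have -> : (l.+2 == k) = false by lia. have -> : (l.+2 == k.+1) = false by lia.
rewrite addr0 mulr0 !addr0 /orbY.
have -> : (i == n) = (l.+1 - i == k.+1)%N by rewrite /n; lia.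
set j := (l.+1 - i)%N; have jb : (0 < j <= l.+1)%N by rewrite /j; lia.
have [->|jk1] := eqVneq j k.+1.
  rewrite hkl co_lineE; last by lia.
  rewrite eqxx (_ : (k.+1 == k) = false); last by lia.
  by rewrite subnn subSnn /= !expr0 expr1 exprS mulr1n ?mulr0n; move: ((-1) ^+ k) => s; ring.
rewrite mulr0 subr0; congr (_ * (_ + _)); case: ifP => // jl; rewrite co_lineE; last by lia.
rewrite (negbTE jk1) addr0.
have [->|jk] := eqVneq j k; last by rewrite mulr0 addr0.
have -> : (k - k.+1 = 0)%N by lia.
by rewrite subnn !mul0r mulr0 addr0 !mulr0.
Qed.

Lemma Rp_line p t u : Rp (p + t *: edir) u = Rp p u.
Proof.
rewrite /Rp /lgR !co_Phi_last !co_dPhi_last lgP_Phi_line lgV_dPhi_line.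
rewrite co_lineE; last by lia.
have -> : (l.+1 == k) = false by lia. have -> : (l.+1 == k.+1) = false by lia.
rewrite addr0 mulr0 addr0 !polyCM; ring.
Qed.

Lemma Rp_edir p :
  Rp p edir = ((-1) ^+ k)%:P * ('X^n * ('X - (co p l.+1)%:P) ^+ 2).
Proof.
rewrite /Rp /lgR !co_Phi_last !co_dPhi_last co_edir; last by lia.
have -> : (l.+1 == k) = false by lia. have -> : (l.+1 == k.+1) = false by lia.
rewrite addr0 polyC0 mul0r addr0.
suff -> : lgV (dPhi k p edir) = ((-1) ^+ k)%:P * ('X^n * ('X - (co p l.+1)%:P)).
  by ring.
apply/polyP => i; rewrite coef_poly coefCM mulrBr -exprSr coefB coefMC !coefXn.
case: (ltnP i l.+1) => il; last first.
  have -> : (i == n.+1) = false by rewrite /n; lia.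
  have -> : (i == n) = false by rewrite /n; lia.
  by rewrite mul0r subrr mulr0.
rewrite !co_dPhi; [|lia..]; rewrite /dphico !co_edir; [|lia..].
have -> : (l.+1 == k) = false by lia. have -> : (l.+1 == k.+1) = false by lia.
have -> : (l.+2 == k) = false by lia. have -> : (l.+2 == k.+1) = false by lia.
rewrite addr0 !mulr0 mul0r addr0 mulr0 addr0 /orbdY.
have -> : (i == n.+1) = (l.+1 - i == k)%N by rewrite /n; lia.
have -> : (i == n) = (l.+1 - i == k.+1)%N by rewrite /n; lia.
set j := (l.+1 - i)%N; have jb : (0 < j <= l.+1)%N by rewrite /j; lia.
have [->|jk] := eqVneq j k.
  have -> : (k == k.+1) = false by lia. rewrite (ltnW hkl) co_edir; last by lia.
  rewrite eqxx (_ : (k == k.+1) = false); last by lia.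
  have -> : (k - k.+1 = 0)%N by lia.
  by rewrite subnn !expr0 mulr1n mulr0n; move: ((-1) ^+ k) => s; ring.
have [->|jk1] := eqVneq j k.+1.
  rewrite hkl co_edir; last by lia.
  rewrite eqxx (_ : (k.+1 == k) = false); last by lia.
  by rewrite subnn subSnn expr0 expr1 exprS mulr1n mulr0n; move: ((-1) ^+ k) => s; ring.
rewrite mul0r subrr mulr0; case: ifP => jl; last by rewrite mul0r mulr0.
rewrite co_edir; last by lia.
by rewrite (negbTE jk) (negbTE jk1) addr0 mul0r mulr0.
Qed.

(** The differential is triangular: the last component gives u_{l+1}, the component l + 1 then gives
    u_{l+2} since k < l, and the others are multiplied by nonzero monomials. *)
Lemma dPhi_inj p u : co p l.+1 != 0 -> co p l.+2 != 0 -> dPhi k p u = 0 -> u = 0.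
Proof.
move=> q1 q2 H.
have u1 : co u l.+1 = 0 by rewrite -(co_dPhi_last k p) H /co mxE.
have e j : (0 < j <= l.+1)%N -> dphico k j p u = 0.
  by move=> hj; rewrite -co_dPhi // H /co mxE.
have u2 : co u l.+2 = 0.
  have /eqP := e l.+1 (leqnn _); rewrite /dphico /orbdY /orbY ltnn u1.
  rewrite mulr0 !mul0r !add0r mul1r !mulf_eq0 signr_eq0 !expf_eq0 pnatr_eq0.
  rewrite (negbTE q1) (negbTE q2) !andbF /= orbF.
  by rewrite subSS subn_eq0 leqNgt hkl /= => /eqP.
apply: co_eq => j /andP[j0 jl2]; rewrite [in RHS]/co mxE.
have [jl|jl] := leqP j l; last first.
  by have [->|->] : j = l.+1 \/ j = l.+2 by lia.
have jb : (0 < j <= l.+1)%N by rewrite j0 leqW.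
have /eqP := e j jb; rewrite /dphico /orbdY jl u1 u2 !mulr0 !mul0r addr0 mulr0 addr0.
by rewrite !mulf_eq0 signr_eq0 !expf_eq0 (negbTE q1) (negbTE q2) !andbF !orbF => /eqP.
Qed.

Lemma co_orbit_euler p j : (0 < j <= l.+2)%N -> co (orbit_euler k p) j =
  if (j <= l)%N then @ddeg R l k j * co p j else
  if j == l.+1 then k%:R^-1 * co p l.+1 else (l - k)%:R^-1 * co p l.+2.
Proof.
move=> hj; rewrite /orbit_euler !coD !coZ co_sum /dy_vec.
have -> : (l.+1 <= l)%N = false by lia. have -> : (l.+2 <= l)%N = false by lia.
rewrite !coZ !co_dir; [|lia..].
under eq_big_nat => i hi.
  rewrite (_ : (i <= l)%N); last by lia.
  rewrite coZ co_dir; [|lia..].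
  over.
case: (leqP j l) => jl.
  rewrite (_ : (l.+1 == j) = false); last by lia.
  rewrite (_ : (l.+2 == j) = false); last by lia.
  rewrite !mulr0 !addr0 (bigD1_seq j); [|by rewrite mem_index_iota; lia|exact: iota_uniq].
  rewrite eqxx mulr1 big1 /= ?addr0 // => i /negbTE ->.
  by rewrite mulr0.
rewrite big_nat big1 ?add0r; last first.
  by move=> i hi; rewrite (_ : (i == j) = false) ?mulr0 //; lia.
have [-> | ->] : j = l.+1 \/ j = l.+2 by lia.
  by rewrite eqxx (_ : (l.+2 == l.+1) = false) ?mulr0 ?addr0 ?mulr1 //; lia.
rewrite eqxx (_ : (l.+1 == l.+2) = false); last by lia.
by rewrite (_ : (l.+2 == l.+1) = false) ?mulr0 ?add0r ?mulr1 //; lia.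
Qed.

Lemma co_lg_euler (a : 'rV[R[i]]_l.+2) j : (0 < j <= l.+2)%N ->
  co (lg_euler k a) j = if (j <= l.+1)%N then j%:R / k%:R * co a j
                        else k%:R^-1 * co a l.+2.
Proof.
move=> hj; rewrite /lg_euler !coD !coZ co_sum co_dir // ?leqnn //.
under eq_big_nat => i hi.
  rewrite coZ co_dir; [|lia..].
  over.
rewrite /=.
case: (leqP j l.+1) => jl.
  rewrite (_ : (l.+2 == j) = false); last by lia.
  rewrite !mulr0 !addr0 (bigD1_seq j); [|by rewrite mem_index_iota; lia|exact: iota_uniq].
  rewrite eqxx mulr1 big1 /= ?addr0 // => i /negbTE ->.
  by rewrite mulr0.
rewrite big_nat big1 ?add0r; last first.
  by move=> i hi; rewrite (_ : (i == j) = false) ?mulr0 //; lia.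
by rewrite (_ : (l.+2 == j)) ?mulr1 //; lia.
Qed.

Lemma dPhi_euler p : dPhi k p (orbit_euler k p) = lg_euler k (Phi k p).
Proof.
have k0 : k%:R != 0 :> R[i] by rewrite pnatr_eq0; lia.
have n0 : (l - k)%:R != 0 :> R[i] by rewrite pnatr_eq0; lia.
have pw (y : R[i]) i : i%:R * y ^+ i.-1 * y = i%:R * y ^+ i.
  by case: i => [|i]; rewrite ?mul0r // -mulrA -exprSr.
apply: co_eq => j hj; rewrite co_lg_euler //.
case: (leqP j l.+1) => jl; last first.
  have -> : j = l.+2 by lia.
  rewrite co_dPhi_last co_Phi_last co_orbit_euler; last by lia.
  by rewrite ltnn eqxx.
rewrite co_dPhi ?co_Phi; [|lia..]; rewrite /dphico /phico !co_orbit_euler; [|lia..].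
rewrite (_ : (l.+1 <= l)%N = false); last by lia.
rewrite (_ : (l.+2 <= l)%N = false); last by lia.
rewrite eqxx (_ : (l.+2 == l.+1) = false); last by lia.
(* Comparison of weights: j/k is the sum of the degree of the j-th coordinate, (j-k)/k and
   (j-k-1)/(l-k), with truncated differences; the degree is 0 for j = l + 1. *)
have gen (s dY Y A B cA cB A' B' x y c C D : R[i]) :
    cA * A' * x = cA * A -> cB * B' * y = cB * B ->
    dY = D * Y -> D + c * cA + C * cB = c * j%:R ->
  s * (dY * (A * B) + Y * (cA * A' * (c * x) * B + A * (cB * B' * (C * y)))) =
  j%:R * c * (s * (Y * (A * B))).
  move=> eA eB -> e.
  transitivity (s * Y * (D * (A * B) + c * (cA * A' * x) * B + C * A * (cB * B' * y))).
    by ring.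
  rewrite eA eB; transitivity (s * Y * A * B * (D + c * cA + C * cB)); first by ring.
  by rewrite e; ring.
pose D : R[i] := if (j <= l)%N then @ddeg R l k j else 0.
apply: (@gen _ _ _ _ _ _ _ _ _ _ _ _ _ D); [exact: pw|exact: pw| |].
  rewrite /orbdY /orbY /D; case: ifP => jl1; last by rewrite mul0r.
  by rewrite co_orbit_euler ?jl1 //; lia.
rewrite /D /ddeg; case: (leqP j k) => jk.
  rewrite (_ : (j <= l)%N); last by lia.
  have -> : (j - k = 0)%N by lia. have -> : (j - k.+1 = 0)%N by lia.
  by rewrite !mulr0 !addr0 mulrC.
have nE : (l - k)%:R = l%:R - k%:R :> R[i] by rewrite natrB // ltnW.
rewrite nE in n0 *.
have -> : (j - k.+1)%:R = j%:R - k%:R - 1 :> R[i].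
  by rewrite natrB // -natr1; ring.
have -> : (j - k)%:R = j%:R - k%:R :> R[i] by rewrite natrB // ltnW.
case: ifP => jl1.
  have -> : ((l - j).+1)%:R = l%:R - j%:R + 1 :> R[i] by rewrite -natr1 natrB.
  by field; rewrite k0 n0.
have -> : j = l.+1 by lia.
by rewrite -natr1; field; rewrite k0 n0.
Qed.

End OrbitAlgebra.

(** * The intersection form of the orbit space *)

Section ElementarySymmetric.
Context {R : realType}.
Variable m : nat.
Implicit Types f : 'I_m -> R[i].

Lemma prodXsubC_esym f : \prod_s ('X - (f s)%:P) =
  \sum_(0 <= j < m.+1) ((-1) ^+ j * Defs.esym j f)%:P * 'X^(m - j).
Proof.
transitivity (\prod_s ((- f s)%:P + 'X)).
  by apply: eq_bigr => s _; rewrite polyCN addrC.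
rewrite bigA_distr /= (partition_big (fun J : {set 'I_m} => inord #|J| : 'I_m.+1) predT) //=.
rewrite big_mkord; apply: eq_bigr => j _.
have cardJ (J : {set 'I_m}) : (#|J| < m.+1)%N.
  by rewrite ltnS -[m in (_ <= m)%N]card_ord max_card.
rewrite (eq_bigl (fun J : {set 'I_m} => #|J| == j)) /=; last first.
  by move=> J; apply/eqP/eqP => [<-|E]; [rewrite inordK|apply/val_inj; rewrite /= inordK].
rewrite /Defs.esym mulr_sumr (rmorph_sum polyC) mulr_suml; apply: eq_bigr => J /eqP Jj.
rewrite big_if /= prodr_const; congr (_ * 'X^_); last first.
  transitivity #|~: J|%SET; first by apply: eq_card => i; rewrite !inE.
  by have := cardsC J; rewrite card_ord Jj; lia.
rewrite -(rmorph_prod polyC); congr _%:P.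
by rewrite -Jj -prodrN.
Qed.

Lemma esymZ c f j : Defs.esym j (fun s => c * f s) = c ^+ j * Defs.esym j f.
Proof.
rewrite /Defs.esym mulr_sumr; apply: eq_bigr => J /eqP <-.
by rewrite big_split /= prodr_const.
Qed.

Lemma esym0 f : Defs.esym 0 f = 1.
Proof.
rewrite /Defs.esym (big_pred1 (finset.set0 : {set 'I_m})) ?big_set0 // => J /=.
by rewrite cards_eq0.
Qed.

Lemma esym_full f : Defs.esym m f = \prod_s f s.
Proof.
rewrite /Defs.esym (big_pred1 (finset.setTfor 'I_m)); first by apply: eq_bigl => i; rewrite inE.
move=> J /=; rewrite finset.eqEsubset finset.subsetT /=.
apply/eqP/idP => [Jm|TJ].
  have := eqEcard J (finset.setTfor 'I_m).
  by rewrite finset.subsetT cardsT card_ord Jm leqnn => /eqP ->.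
have -> : J = (finset.setTfor 'I_m) by apply/eqP; rewrite finset.eqEsubset finset.subsetT.
by rewrite cardsT card_ord.
Qed.

End ElementarySymmetric.

(** * The zeros of the superpotential in the coordinates x *)

Section OrbitCoordinates.
Context {R : realType} {l : nat}.
Implicit Types (x : 'rV[R[i]]_l.+2).
Let m0 : l.+1%:R != 0 :> R[i]. Proof. by rewrite pnatr_eq0. Qed.

Lemma dirE (i : nat) (s : 'I_l.+1) : (0 < i <= l.+1)%N ->
  (dir i : 'rV[R[i]]_l.+1) 0 s = (i == s.+1)%:R.
Proof.
move=> hi; rewrite /dir mxE eqxx /=; congr (nat_of_bool _)%:R.
apply/eqP/eqP => [->|->] /=; first by rewrite inordK; lia.
by rewrite inord_val.
Qed.

Lemma alphaE j (s : 'I_l.+1) : (0 < j <= l)%N ->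
  (alpha j : 'rV[R[i]]_l.+1) 0 s = (j == s.+1)%:R - (j == s)%:R.
Proof. by move=> hj; rewrite /alpha mxE [(- _ : 'rV_ _) _ _]mxE !dirE; [|lia..]. Qed.

Lemma sum_alpha j : (0 < j <= l)%N -> \sum_s (alpha j : 'rV[R[i]]_l.+1) 0 s = 0.
Proof.
move=> hj; under eq_bigr => s _ do rewrite alphaE //.
rewrite sumrB.
have S i : (i <= l)%N -> \sum_(s < l.+1) ((i == s)%N%:R : R[i]) = 1.
  move=> il; rewrite (bigD1 (inord i)) //= inordK // eqxx big1 ?addr0 // => s.
  rewrite -val_eqE /= inordK // eq_sym => /negbTE -> //.
have -> : \sum_(s < l.+1) ((j == s.+1)%N%:R : R[i]) = 1.
  rewrite -[RHS](S j.-1); last by lia.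
  by apply: eq_bigr => s _; congr (nat_of_bool _)%:R; lia.
by rewrite S ?subrr //; lia.
Qed.

Lemma vpartE x s : vpart x 0 s = \sum_(1 <= j < l.+1) co x j * alpha j 0 s.
Proof. by rewrite /vpart summxE; apply: eq_bigr => j _; rewrite mxE. Qed.

Lemma sum_vpart x : \sum_s vpart x 0 s = 0.
Proof.
under eq_bigr => s _ do rewrite vpartE.
rewrite exchange_big big_nat big1 // => j hj.
by rewrite -mulr_sumr sum_alpha ?mulr0 //; lia.
Qed.

Lemma omegaE r (s : 'I_l.+1) : (r <= l)%N ->
  (omega r : 'rV[R[i]]_l.+1) 0 s = (s < r)%:R - r%:R / l.+1%:R.
Proof.
move=> rl; rewrite !mxE mulr1 summxE; congr (_ - _).
under eq_big_nat => i hi.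
  rewrite dirE; last by lia.
  over.
rewrite /=; case: (ltnP s r) => sr.
  rewrite (bigD1_seq s.+1); [|by rewrite mem_index_iota; lia|exact: iota_uniq].
  by rewrite eqxx big1 /= ?addr0 // => i /negbTE ->.
by rewrite big_nat big1 // => i hi; rewrite (_ : (i == s.+1) = false) //; lia.
Qed.

Lemma dcoefE a b : (a <= l)%N -> (b <= l)%N ->
  @dcoef R l a b = (minn a b)%:R - a%:R * b%:R / l.+1%:R :> R[i].
Proof.
move=> al bl; rewrite /dcoef {1}/inner mxE.
transitivity (\sum_(s < l.+1) (omega a : 'rV[R[i]]_l.+1) 0 s * (s < b)%:R).
  have : \sum_(s < l.+1) (omega a : 'rV[R[i]]_l.+1) 0 s = 0.
    apply: etrans (omega_sum (R := R) al); rewrite /inner mxE.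
    by apply: eq_bigr => s _; rewrite [(_^T) _ _]mxE [const_mx _ _ _]mxE mulr1.
  move=> S0; transitivity (\sum_(s < l.+1) (omega a : 'rV[R[i]]_l.+1) 0 s * (s < b)%:R
    - b%:R / l.+1%:R * \sum_(s < l.+1) (omega a : 'rV[R[i]]_l.+1) 0 s); last first.
    by rewrite S0 mulr0 subr0.
  rewrite mulr_sumr -sumrB.
  by apply: eq_bigr => s _; rewrite [(_^T) _ _]mxE (omegaE _ bl); ring.
have cnt c : (c <= l.+1)%N -> \sum_(s < l.+1) ((s < c)%N%:R : R[i]) = c%:R.
  move=> cl; rewrite -(big_mkord xpredT (fun s => ((s < c)%N%:R : R[i]))).
  rewrite (@big_cat_nat _ _ _ c) //= [X in _ + X](_ : _ = 0) ?addr0; last first.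
    by rewrite big_nat big1 // => i /andP[ci _]; rewrite ltnNge ci.
  under eq_big_nat => i hi do rewrite (_ : (i < c)%N) //.
  by rewrite sumr_const_nat subn0.
transitivity (\sum_(s < l.+1) (((s < minn a b)%N%:R : R[i])
    - a%:R / l.+1%:R * (s < b)%:R)).
  apply: eq_bigr => s _; rewrite omegaE // mulrBl; congr (_ - _).
  rewrite -natrM; congr _%:R; rewrite leq_min; by case: (s < a)%N; case: (s < b)%N.
rewrite sumrB -mulr_sumr !cnt; [by ring|lia..].
Qed.

Variable k : nat.
Let n := (l - k)%N.

(** The logarithms of the zeros, divided by 2 pi i. The shift is the same for all s and is chosen so
    that the product of the zeros is q1^(n+1) q2^n, with q1, q2 the exponentials of 2 pi i x_{l+1},
    2 pi i x_{l+2}. *)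
Definition Xi x (s : 'I_l.+1) : R[i] := vpart x 0 s
  + n.+1%:R / l.+1%:R * co x l.+1 + n%:R / l.+1%:R * co x l.+2.

Definition zpt x s : R[i] := cexp (twopii * Xi x s).

Lemma co_ytilde x j : (0 < j <= l)%N -> co (ytilde k x) j =
  cexp (twopii * (@dcoef R l j k * co x l.+1 + @dcoef R l j k.+1 * co x l.+2)) * yfun j x.
Proof.
case/andP=> j0 jl; rewrite {1}/co mxE inordK; last by lia.
by rewrite prednK // jl.
Qed.

Lemma co_ytilde_q j x : (l < j <= l.+2)%N ->
  co (ytilde k x) j = cexp (twopii * co x j).
Proof.
case/andP=> jl jl2; rewrite {1}/co mxE inordK; last by lia.
by rewrite (_ : (j.-1 < l)%N = false) //; lia.
Qed.

Hypotheses (hk : (0 < k)%N) (hkl : (k < l)%N).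

(** Vieta: a common factor C of the zeros multiplies the j-th elementary symmetric function by C^j,
    and the resulting exponents agree with those of [phico] by the formula for d_{j,r}. *)
Lemma lgP_ytilde x : lgP (Phi k (ytilde k x)) = \prod_s ('X - (zpt x s)%:P).
Proof.
pose C := cexp (twopii * (n.+1%:R / l.+1%:R * co x l.+1
                          + n%:R / l.+1%:R * co x l.+2)).
pose f := fun s : 'I_l.+1 => cexp (twopii * vpart x 0 s).
have zE s : zpt x s = C * f s by rewrite /zpt /Xi /C /f -cexpD; congr cexp; ring.
have eE j : Defs.esym j (zpt x) = C ^+ j * Defs.esym j f.
  by rewrite -esymZ /Defs.esym; apply: eq_bigr => J _; apply: eq_bigr => s _; rewrite zE.
rewrite prodXsubC_esym lgP_PhiE // big_nat [RHS]big_nat.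
apply: eq_bigr => j /andP[_ jl]; congr (_%:P * _).
rewrite -!mulrA; congr (_ * _); rewrite eE !co_ytilde_q; [|lia..].
have cX (a : R[i]) i : cexp a ^+ i = cexp (i%:R * a).
  by rewrite mulr_natl cexpMn.
rewrite !cX.
have nE : n%:R = l%:R - k%:R :> R[i] by rewrite natrB // ltnW.
have mE : l.+1%:R = l%:R + 1 :> R[i] by rewrite -natr1.
have l1 : l%:R + 1 != 0 :> R[i] by rewrite natr1.
have [->|j0] := eqVneq j 0%N; first by rewrite !sub0n !mul0r cexp0 esym0 !mulr1.
have [jl1|jl1] := leqP j l; last first.
  have -> : j = l.+1 by lia.
  rewrite esym_full /f -cexp_sum -mulr_sumr sum_vpart mulr0 cexp0 mulr1.
  rewrite /orbY ltnn mul1r -cexpD; congr cexp.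
  rewrite subSS (_ : (l.+1 - k)%N = n.+1); last by rewrite /n; lia.
  by rewrite -/n -[n.+1%:R]natr1 nE mE; field.
rewrite /orbY jl1 co_ytilde; last by lia.
rewrite /yfun -/f mulrAC [RHS]mulrC [in RHS]mulrC; congr (_ * _).
rewrite -!cexpD; congr cexp; rewrite !dcoefE //; [|lia..].
rewrite -[n.+1%:R]natr1 nE mE.
have c1 : (minn j k)%:R = j%:R - (j - k)%:R :> R[i].
  by rewrite -natrB; [congr _%:R; lia|lia].
have c2 : (minn j k.+1)%:R = j%:R - (j - k.+1)%:R :> R[i].
  by rewrite -natrB; [congr _%:R; lia|lia].
by rewrite c1 c2 -[k.+1%:R]natr1; field.
Qed.

End OrbitCoordinates.

Section ChainRule.
Variables (K : numFieldType) (V : normedModType K).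
Implicit Types (x v : V).

Lemma is_derive_comp_affine (g : K^o -> K^o) (f : V -> K^o) x v (d a : K) :
  (forall h : K, f (h *: v + x) = f x + h * d) ->
  is_derive (f x) (1 : K^o) g a ->
  is_derive x v (fun y => g (f y) : K^o) (a * d).
Proof.
move=> fE [gd ga].
have dg : differentiable g (f x) by apply/derivable1_diffP.
have E : (fun h : K => h^-1 *: ((g (f (h *: v + x)) : K^o) - g (f x))) =
    (fun h : K => h^-1 *: (g (h *: (d : K^o) + f x) - g (f x))).
  by apply/funext => h; rewrite fE [f x + _]addrC.
have dd : derivable g (f x) (d : K^o) by exact: diff_derivable.
apply: DeriveDef; first by rewrite /derivable E; exact: dd.
have -> : 'D_v (fun y => g (f y) : K^o) x = 'D_(d : K^o) g (f x).
  by rewrite /derive E.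
rewrite deriveE //.
have -> : 'd g (f x) (d : K^o) = d *: 'd g (f x) (1 : K^o).
  by rewrite -linearZ /=; congr ('d g (f x) _); rewrite /GRing.scale /= mulr1.
by rewrite -(deriveE _ dg) ga mulrC.
Qed.

Lemma is_derive_prod (I : eqType) (r : seq I) (f : I -> V -> K^o) x v (d : I -> K) :
  uniq r -> (forall i, is_derive x v (f i) (d i)) ->
  is_derive x v (fun y => \prod_(i <- r) f i y : K^o)
    (\sum_(i <- r) d i * \prod_(j <- r | j != i) f j x).
Proof.
move=> ur df; elim: r ur => [|i0 r IH] /=.
  move=> _; rewrite big_nil.
  have -> : (fun y => \prod_(i <- [::]) f i y : K^o) = cst 1.
    by apply/funext => y; rewrite big_nil.
  exact: is_derive_cst.
move=> /andP[i0r ur].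
have -> : (fun y => \prod_(i <- i0 :: r) f i y : K^o) =
    (f i0 * (fun y => \prod_(i <- r) f i y : K^o)).
  by apply/funext => y; rewrite big_cons.
apply: (is_derive_eq (is_deriveM (df i0) (IH ur))); rewrite /GRing.scale /=.
rewrite !big_cons eqxx /= addrC; congr (_ + _).
  rewrite mulrC; congr (_ * _); rewrite big_seq [RHS]big_seq_cond.
  apply: eq_bigl => j; case jr: (j \in r) => //=.
  by apply/esym; apply: contraNneq i0r => <-.
rewrite mulr_sumr !big_seq; apply: eq_bigr => i ir.
rewrite big_cons; have -> : i0 != i by apply: contraNneq i0r => ->.
by rewrite mulrCA.
Qed.

Lemma differentiable_sumK (I : Type) (r : seq I) (P : pred I) (f : I -> V -> K^o) x :
  (forall i, differentiable (f i) x) ->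
  differentiable (fun y => \sum_(i <- r | P i) f i y : K^o) x.
Proof.
move=> df; elim: r => [|i r IH].
  have -> : (fun y => \sum_(i <- [::] | P i) f i y : K^o) = cst 0.
    by apply/funext => y; rewrite big_nil.
  exact: differentiable_cst.
have -> : (fun y => \sum_(i <- i :: r | P i) f i y : K^o) =
    (if P i then f i + (fun y => \sum_(i <- r | P i) f i y : K^o)
     else (fun y => \sum_(i <- r | P i) f i y : K^o)).
  by apply/funext => y; rewrite big_cons; case: ifP.
by case: ifP => _ //; exact: differentiableD.
Qed.

Lemma differentiable_prodK (I : Type) (r : seq I) (P : pred I) (f : I -> V -> K^o) x :
  (forall i, differentiable (f i) x) ->
  differentiable (fun y => \prod_(i <- r | P i) f i y : K^o) x.
Proof.
move=> df; elim: r => [|i r IH].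
  have -> : (fun y => \prod_(i <- [::] | P i) f i y : K^o) = cst 1.
    by apply/funext => y; rewrite big_nil.
  exact: differentiable_cst.
have -> : (fun y => \prod_(i <- i :: r | P i) f i y : K^o) =
    (if P i then f i * (fun y => \prod_(i <- r | P i) f i y : K^o)
     else (fun y => \prod_(i <- r | P i) f i y : K^o)).
  by apply/funext => y; rewrite big_cons; case: ifP.
by case: ifP => _ //; exact: differentiableM.
Qed.

Lemma derive_compK (W : normedModType K) (f : V -> W) (g : W -> K^o) x v :
  differentiable f x -> differentiable g (f x) ->
  'D_v (fun y => g (f y) : K^o) x = 'D_('d f x v) g (f x).
Proof.
move=> df dg; have dgf : differentiable (fun y => g (f y) : K^o) x.
  exact: differentiable_comp.
by rewrite deriveE // (diff_comp df dg) /= -deriveE.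
Qed.

Lemma poly_ext_horner (p q : {poly K}) : (forall c, p.[c] = q.[c]) -> p = q.
Proof.
move=> H; apply/eqP; rewrite -subr_eq0; apply/eqP.
apply: (@roots_geq_poly_eq0 _ _ [seq i%:R | i <- iota 0 (size (p - q))]).
- by apply/allP => c _; rewrite /root hornerD hornerN H subrr.
- rewrite map_inj_uniq ?iota_uniq // => i j /eqP.
  by rewrite eqr_nat => /eqP.
- by rewrite size_map size_iota.
Qed.

End ChainRule.

(** * Tangent vectors in the coordinates x and their polynomials *)

Section OrbitTangent.
Context {R : realType} {l : nat}.
Variable k : nat.
Hypotheses (hk : (0 < k)%N) (hkl : (k < l)%N).
Let n := (l - k)%N.
Implicit Types (x v : 'rV[R[i]]_l.+2).

Lemma Xi_linear h v x s : Xi k (h *: v + x) s = Xi k x s + h * Xi k v s.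
Proof.
rewrite /Xi !co_linear !vpartE.
have -> : \sum_(1 <= j < l.+1) co (h *: v + x) j * alpha j 0 s =
    h * (\sum_(1 <= j < l.+1) co v j * alpha j 0 s)
    + \sum_(1 <= j < l.+1) co x j * alpha j 0 s.
  rewrite mulr_sumr -big_split /=; apply: eq_bigr => j _.
  by rewrite co_linear; ring.
ring.
Qed.

Lemma differentiable_cexp (f : 'rV[R[i]]_l.+2 -> R[i]^o) x :
  differentiable f x -> differentiable (fun y => cexp (twopii * f y) : R[i]^o) x.
Proof.
move=> df.
pose g y : R[i]^o := twopii * f y; pose c : R[i]^o -> R[i]^o := cexp.
have d2 : differentiable g x.
  exact: (differentiableM (differentiable_cst _ _) df).
have dc : differentiable c (g x).
  by apply/derivable1_diffP; have [] := is_derive_cexp (g x).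
exact: (differentiable_comp d2 dc).
Qed.

Lemma differentiable_ytilde x : differentiable (ytilde k) x.
Proof.
apply: differentiable_row => i.
have -> : (fun y => ytilde k y 0 i : R[i]^o) = if (i < l)%N then
    (fun y => cexp (twopii * (@dcoef R l i.+1 k * co y l.+1
        + @dcoef R l i.+1 k.+1 * co y l.+2)) * yfun i.+1 y : R[i]^o)
     else (fun y => cexp (twopii * y 0 i) : R[i]^o).
  by apply/funext => y; rewrite mxE; case: ifP.
case: ifP => _; last first.
  by apply: differentiable_cexp; exact: differentiable_coord.
apply: differentiableM.
  apply: differentiable_cexp; apply: differentiableD;
    apply: differentiableM; try exact: differentiable_cst;
    exact: differentiable_co.
apply: differentiable_sumK => A; apply: differentiable_prodK => s.
apply: differentiable_cexp.
have -> : (fun y => vpart y 0 s : R[i]^o) =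
    (fun y => \sum_(1 <= j < l.+1) co y j * alpha j 0 s : R[i]^o).
  by apply/funext => y; rewrite vpartE.
apply: differentiable_sumK => j; apply: differentiableM.
  exact: differentiable_co.
exact: differentiable_cst.
Qed.

Definition tau x v := 'd (ytilde k) x v.

Lemma co_tau x v j : co (tau x v) j = 'D_v (fun y => co (ytilde k y) j : R[i]^o) x.
Proof. by rewrite /co /tau diff_row_coord //; exact: differentiable_ytilde. Qed.

Lemma co_tau_q x v j : (l < j <= l.+2)%N ->
  co (tau x v) j = twopii * co v j * co (ytilde k x) j.
Proof.
move=> hj; rewrite co_tau.
have -> : (fun y : 'rV[R[i]]_l.+2 => co (ytilde k y) j : R[i]^o) =
    (fun y => (cexp : R[i]^o -> R[i]^o) (twopii * co y j : R[i]^o)).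
  by apply/funext => y; rewrite co_ytilde_q.
have H (h : R[i]) : twopii * co (h *: v + x) j = twopii * co x j + h * (twopii * co v j).
  by rewrite co_linear; ring.
rewrite (@derive_val _ _ _ _ _ _ _ (is_derive_comp_affine H (is_derive_cexp _))).
by rewrite co_ytilde_q // mulrC.
Qed.

Lemma is_derive_zpt x v s :
  is_derive x v (fun y => zpt k y s : R[i]^o) (twopii * Xi k v s * zpt k x s).
Proof.
have H (h : R[i]) : twopii * Xi k (h *: v + x) s = twopii * Xi k x s + h * (twopii * Xi k v s).
  by rewrite Xi_linear; ring.
by rewrite mulrC; exact: (is_derive_comp_affine H (is_derive_cexp _)).
Qed.

Lemma derive_lgP (a u : 'rV[R[i]]_l.+2) c :
  is_derive a u (fun b => (lgP b).[c] : R[i]^o) (lgV u).[c].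
Proof.
apply: is_derive_affine => h.
by rewrite /lgP lgV_linear !hornerD hornerM hornerC; ring.
Qed.

Lemma differentiable_lgP (a : 'rV[R[i]]_l.+2) c :
  differentiable (fun b => (lgP b).[c] : R[i]^o) a.
Proof.
have -> : (fun b => (lgP b).[c] : R[i]^o) = (fun b : 'rV[R[i]]_l.+2 =>
    c ^+ l.+1 + \sum_(i < l.+1) co b (l.+1 - i) * c ^+ i : R[i]^o).
  by apply/funext => b; rewrite /lgP hornerD hornerXn horner_poly.
apply: differentiableD; first exact: differentiable_cst.
apply: differentiable_sumK => j; apply: differentiableM.
  exact: differentiable_co.
exact: differentiable_cst.
Qed.

Lemma lgV_tau x v : lgV (dPhi k (ytilde k x) (tau x v)) =
  - \sum_s (twopii * Xi k v s * zpt k x s)%:P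
      * \prod_(t | t != s) ('X - (zpt k x t)%:P).
Proof.
apply: poly_ext_horner => c.
have dc := differentiable_comp (differentiable_ytilde x) (differentiable_Phi k (ytilde k x)).
have := derive_compK v dc (differentiable_lgP (Phi k (ytilde k x)) c).
rewrite (@derive_val _ _ _ _ _ _ _ (derive_lgP _ _ _)).
rewrite (diff_comp (differentiable_ytilde x) (differentiable_Phi k (ytilde k x))) /=.
rewrite diff_Phi -/(tau x v) => <-.
have -> : (fun y => (lgP ((Phi k \o ytilde k) y)).[c] : R[i]^o) =
    (fun y => \prod_(s <- index_enum 'I_l.+1) (c - zpt k y s) : R[i]^o).
  apply/funext => y; rewrite /= lgP_ytilde // horner_prod.
  by apply: eq_bigr => s _; rewrite hornerXsubC.
have df s : is_derive x v (fun y => c - zpt k y s : R[i]^o)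
    (- (twopii * Xi k v s * zpt k x s)).
  have H := is_deriveB (is_derive_cst (c : R[i]^o) x v) (is_derive_zpt x v s).
  by apply: (is_derive_eq H); rewrite sub0r.
rewrite (@derive_val _ _ _ _ _ _ _ (is_derive_prod (index_enum_uniq _) df)).
rewrite hornerN horner_sum -sumrN; apply: eq_bigr => s _.
rewrite hornerCM horner_prod mulNr; congr (- (_ * _)).
by apply: eq_bigr => t _; rewrite hornerXsubC.
Qed.

(** The zeros move by d log z_s = 2 pi i dX_s and the pole by d log w = 2 pi i dx_{l+1}; the
    resulting polynomials are those of [casimir]. *)
Lemma Rp_tau x v (P := \prod_s ('X - (zpt k x s)%:P)) (w := co (ytilde k x) l.+1) :
  Rp k (ytilde k x) (tau x v) =
  twopii%:P * (\sum_s (Xi k v s)%:P * (- (zpt k x s)%:P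
     * (\prod_(t | t != s) ('X - (zpt k x t)%:P) * ('X - w%:P)))
   + (co v l.+1)%:P * (w%:P * P)).
Proof.
rewrite /Rp /lgR lgV_tau co_Phi_last co_dPhi_last co_tau_q; last by lia.
rewrite -/w lgP_ytilde // -/P [in RHS]mulrDr.
congr (_ + _); last by rewrite !polyCM; ring.
rewrite mulNr mulr_suml [in RHS]mulr_sumr -sumrN.
apply: eq_bigr => s _; rewrite !polyCM; ring.
Qed.

Lemma inner_dir (u : 'rV[R[i]]_l.+2) j : inner u (dir j) = co u j.
Proof.
rewrite /inner mxE (bigD1 (inord j.-1)) //= big1 ?addr0.
  by rewrite !mxE !eqxx mulr1.
by move=> t ht; rewrite !mxE eqxx (negbTE ht) mulr0.
Qed.

Lemma inner_dirZ (u : 'rV[R[i]]_l.+2) c j : inner u (c *: dir j) = c * co u j.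
Proof. by rewrite -inner_dir /inner linearZ /= -scalemxAr mxE. Qed.

Lemma derive_ylog x v j : (0 < j <= l.+2)%N ->
  'D_v (ylog k j) x = inner (tau x v) (dy_cov (ytilde k x) j).
Proof.
move=> hj; rewrite /ylog /dy_cov; case: ifP => jl.
  by rewrite inner_dir co_tau.
rewrite inner_dirZ co_tau_q //; last by lia.
have H (h : R[i]) : twopii * co (h *: v + x) j = twopii * co x j + h * (twopii * co v j).
  by rewrite co_linear; ring.
rewrite (@derive_val _ _ _ _ _ _ _ (is_derive_affine H)).
rewrite [RHS]mulrC mulfK // co_ytilde_q ?cexp_neq0 //; lia.
Qed.

End OrbitTangent.

(** * Raising covectors by the intersection form *)

Section Contraction.
Context {R : realType} {l : nat}.
Variable k : nat.
Hypotheses (hk : (0 < k)%N) (hkl : (k < l)%N).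
Let n := (l - k)%N.
Implicit Types (x u v : 'rV[R[i]]_l.+2).

Let D a b : R[i] := 4 * (pi ^+ 2)%:C * @dxform R l k a b.

(* The coordinates X_1, .., X_{l+1} and x_{l+1} of the constant field dir a,   *)
(* the last one having index 0.                                                *)
Definition xi (a : nat) (s : 'I_l.+2) : R[i] :=
  if unlift ord0 s is Some t then Xi k (dir a) t else co (dir a : 'rV[R[i]]_l.+2) l.+1.

Lemma pi4_neq0 : 4 * (pi ^+ 2)%:C != 0 :> R[i].
Proof.
rewrite mulf_neq0 ?pnatr_eq0 //.
by rewrite eq_complex /= negb_and expf_neq0 // gt_eqF // pi_gt0.
Qed.

Let DE a b : D a b = if (a <= l)%N && (b <= l)%N then @dcoef R l a b
   else if (a == l.+1) && (b == l.+1) then - (k.+1%:R / k%:R)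
   else if (a == l.+2) && (b == l.+2) then - ((l - k).+1%:R / (l - k)%:R)
   else if (a <= l)%N || (b <= l)%N then 0
   else 1.
Proof. by rewrite /D /dxform mulVKf ?pi4_neq0. Qed.

Lemma vpart_dir a s : (0 < a <= l.+2)%N ->
  vpart (dir a : 'rV[R[i]]_l.+2) 0 s = if (a <= l)%N then alpha a 0 s else 0.
Proof.
move=> ha; rewrite vpartE //.
under eq_big_nat => j hj.
  rewrite co_dir; [|lia..].
  over.
rewrite /=; case: ifP => al.
  rewrite (bigD1_seq a); [|by rewrite mem_index_iota; lia|exact: iota_uniq].
  rewrite eqxx mul1r big1 /= ?addr0 // => i; rewrite eq_sym => /negbTE ->.
  by rewrite mul0r.
by rewrite big_nat big1 // => i hi; rewrite (_ : (a == i) = false) ?mul0r //; lia.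
Qed.

Lemma Xi_dir a s : (0 < a <= l.+2)%N ->
  Xi k (dir a : 'rV[R[i]]_l.+2) s = if (a <= l)%N then alpha a 0 s else
    if a == l.+1 then n.+1%:R / l.+1%:R else n%:R / l.+1%:R.
Proof.
move=> ha; rewrite /Xi vpart_dir // !co_dir //; [|lia..].
case: ifP => al.
  rewrite (_ : (a == l.+1) = false); last by lia.
  by rewrite (_ : (a == l.+2) = false) ?mulr0 ?addr0 //; lia.
have [-> | ->] : a = l.+1 \/ a = l.+2 by lia.
  rewrite eqxx (_ : (l.+1 == l.+2) = false); last by lia.
  by rewrite mulr0 addr0 mulr1 add0r.
rewrite eqxx (_ : (l.+2 == l.+1) = false); last by lia.
by rewrite mulr0 addr0 mulr1 add0r.
Qed.

Lemma sum_alphaM (f : nat -> R[i]) (s : 'I_l.+1) : f 0%N = 0 -> f l.+1 = 0 ->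
  \sum_(1 <= a < l.+1) f a * alpha a 0 s = f s.+1 - f s.
Proof.
move=> f0 fl; under eq_big_nat => a ha.
  rewrite alphaE; last by lia.
  rewrite mulrBr.
  over.
rewrite /= sumrB.
have S i : (i <= l.+1)%N -> \sum_(1 <= a < l.+1) f a * (a == i)%:R = f i.
  move=> il; have [hi|hi] := boolP (0 < i <= l)%N.
    rewrite (bigD1_seq i); [|by rewrite mem_index_iota; lia|exact: iota_uniq].
    by rewrite eqxx mulr1 big1 /= ?addr0 // => j /negbTE ->; rewrite mulr0.
  have -> : f i = 0 by have [->|->] : i = 0%N \/ i = l.+1 by lia.
  by rewrite big_nat big1 // => j hj; rewrite (_ : (j == i) = false) ?mulr0 //; lia.
rewrite !S //; have := ltn_ord s; lia.
Qed.

Let k0 : k%:R != 0 :> R[i]. Proof. by rewrite pnatr_eq0; lia. Qed.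
Let n0 : n%:R != 0 :> R[i]. Proof. by rewrite pnatr_eq0 /n; lia. Qed.
Let m0 : l.+1%:R != 0 :> R[i]. Proof. by rewrite pnatr_eq0. Qed.
Let mE : l.+1%:R = n%:R + k%:R + 1 :> R[i].
Proof. by rewrite -natr1 -natrD; congr (_%:R + 1); rewrite /n; lia. Qed.

(** Contraction with the roots takes second differences of d_{a,b} = min(a,b) - a b/(l+1); the first
    term gives the Kronecker symbol, the second a constant. *)
Lemma sum_dcoef (s t : 'I_l.+1) : \sum_(1 <= a < l.+1) \sum_(1 <= b < l.+1)
    @dcoef R l a b * alpha a 0 s * alpha b 0 t = (s == t)%:R - l.+1%:R^-1.
Proof.
pose dd a b : R[i] := (minn a b)%:R - a%:R * b%:R / l.+1%:R.
have dd0 b : dd 0%N b = 0 by rewrite /dd min0n !mul0r subrr.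
have ddm b : (b <= l.+1)%N -> dd l.+1 b = 0.
  by move=> bl; rewrite /dd (minn_idPr bl) mulrAC divff // mul1r subrr.
have ddC a b : dd a b = dd b a by rewrite /dd minnC; ring.
have st := ltn_ord s; have tt := ltn_ord t.
transitivity (\sum_(1 <= a < l.+1) (dd a t.+1 - dd a t) * alpha a 0 s).
  apply: eq_big_nat => a ha.
  rewrite -(@sum_alphaM (dd a)) 1?ddC ?dd0 ?ddm //; [|lia..].
  rewrite mulr_suml; apply: eq_big_nat => b hb.
  by rewrite dcoefE /dd; [ring|lia..].
rewrite (@sum_alphaM (fun a => dd a t.+1 - dd a t)); first last.
- by rewrite (ddm t.+1) ?(ddm t) ?subrr //; lia.
- by rewrite !dd0 subrr.
have -> : (s == t)%:R = (minn s.+1 t.+1)%:R - (minn s.+1 t)%:R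
    - ((minn s t.+1)%:R - (minn s t)%:R) :> R[i].
  rewrite -!natrB; [|lia..]; congr _%:R.
  by rewrite -val_eqE /=; case: eqP; lia.
have sE : s.+1%:R = s%:R + 1 :> R[i] by rewrite natr1.
have tE : t.+1%:R = t%:R + 1 :> R[i] by rewrite natr1.
by rewrite /dd sE tE; ring.
Qed.

(** The space V contributes delta - 1/(l+1) on the X_s. The constants (k+1)/k and (l-k+1)/(l-k) of
    the form are such that the two extra coordinates turn the constant into -1/k for all entries,
    the diagonal entry of x_{l+1} receiving an additional -1. *)
Lemma sum_dxform s t : \sum_(1 <= a < l.+3) \sum_(1 <= b < l.+3)
    D a b * xi a s * xi b t =
  (if s == ord0 then -1 else 1) * (s == t)%:R - k%:R^-1.
Proof.
have Dr a b : (a <= l)%N -> (l < b <= l.+2)%N -> D a b = 0.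
  move=> al bl; rewrite DE al; do !(rewrite (_ : (_ && _) = false); last by lia).
  by [].
have Dl a b : (b <= l)%N -> (l < a <= l.+2)%N -> D a b = 0.
  move=> bl al; rewrite DE bl orbT; do !(rewrite (_ : (_ && _) = false); last by lia).
  by [].
have D11 : D l.+1 l.+1 = - (k.+1%:R / k%:R).
  by rewrite DE ltnn eqxx.
have D22 : D l.+2 l.+2 = - (n.+1%:R / n%:R).
  rewrite DE eqxx; do !(rewrite (_ : (_ && _) = false); last by lia).
  by [].
have D12 : D l.+1 l.+2 = 1.
  rewrite DE eqxx; do !(rewrite (_ : (_ && _) = false); last by lia).
  by rewrite (_ : (_ || _) = false) //; lia.
have D21 : D l.+2 l.+1 = 1.
  rewrite DE eqxx; do !(rewrite (_ : (_ && _) = false); last by lia).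
  by rewrite (_ : (_ || _) = false) //; lia.
transitivity (\sum_(1 <= a < l.+1) \sum_(1 <= b < l.+1) @dcoef R l a b * xi a s * xi b t
  + (- (k.+1%:R / k%:R)) * xi l.+1 s * xi l.+1 t + xi l.+1 s * xi l.+2 t
  + xi l.+2 s * xi l.+1 t + (- (n.+1%:R / n%:R)) * xi l.+2 s * xi l.+2 t).
  have split3 (f : nat -> R[i]) : \sum_(1 <= a < l.+3) f a =
      \sum_(1 <= a < l.+1) f a + f l.+1 + f l.+2.
    by rewrite (@big_nat_recr _ _ _ l.+2) // (@big_nat_recr _ _ _ l.+1).
  rewrite !split3.
  rewrite D11 D22 D12 D21 !mul1r.
  rewrite [X in X + _ + _](_ : _ = \sum_(1 <= a < l.+1) \sum_(1 <= b < l.+1)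
    @dcoef R l a b * xi a s * xi b t); last first.
    apply: eq_big_nat => a ha; rewrite split3.
    rewrite !Dr; [|lia..]; rewrite !mul0r !addr0.
    apply: eq_big_nat => b hb; rewrite DE (_ : (a <= l)%N && (b <= l)%N) //; lia.
  have Z a : (l < a <= l.+2)%N -> \sum_(1 <= b < l.+1) D a b * xi a s * xi b t = 0.
    by move=> ha; rewrite big_nat big1 // => b hb; rewrite Dl ?mul0r //; lia.
  by rewrite !Z; [ring|lia..].
rewrite {1 2 3 4 5 6 7 8 9 10}/xi.
case: (unliftP ord0 s) => [s'|] ->; case: (unliftP ord0 t) => [t'|] -> /=.
- have -> : \sum_(1 <= a < l.+1) \sum_(1 <= b < l.+1)
      @dcoef R l a b * Xi k (dir a) s' * Xi k (dir b) t' = (s' == t')%:R - l.+1%:R^-1.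
    rewrite -sum_dcoef; apply: eq_big_nat => a ha; apply: eq_big_nat => b hb.
    rewrite !Xi_dir; [|lia..].
    have -> : (a <= l)%N = true by lia.
    by have -> : (b <= l)%N = true by lia.
  rewrite !Xi_dir; [|lia..]; rewrite ltnn eqxx.
  rewrite (_ : (l.+2 <= l)%N = false); last by lia.
  rewrite (_ : (l.+2 == l.+1) = false); last by lia.
  rewrite (inj_eq lift_inj) mul1r -[n.+1%:R]natr1 -[k.+1%:R]natr1 mE.
  have m1 : n%:R + k%:R + 1 != 0 :> R[i] by rewrite -mE.
  by field; rewrite k0 n0 m1.
- rewrite !Xi_dir; [|lia..]; rewrite !co_dir; [|lia..]; rewrite ltnn eqxx.
  rewrite (_ : (l.+2 <= l)%N = false); last by lia.
  rewrite (_ : (l.+2 == l.+1) = false); last by lia.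
  rewrite big_nat big1; last first.
    move=> a ha; rewrite big_nat big1 // => b hb; rewrite co_dir; [|lia..].
    by rewrite (_ : (b == l.+1) = false) ?mulr0 //; lia.
  have m1 : n%:R + k%:R + 1 != 0 :> R[i] by rewrite -mE.
  rewrite mulr1n mulr0n mE -[n.+1%:R]natr1 -[k.+1%:R]natr1.
  by field; rewrite ?n0 k0 m1.
- rewrite !Xi_dir; [|lia..]; rewrite !co_dir; [|lia..]; rewrite ltnn eqxx.
  rewrite (_ : (l.+2 <= l)%N = false); last by lia.
  rewrite (_ : (l.+2 == l.+1) = false); last by lia.
  rewrite big_nat big1; last first.
    move=> a ha; rewrite big_nat big1 // => b hb; rewrite co_dir; [|lia..].
    by rewrite (_ : (a == l.+1) = false) ?mulr0 ?mul0r //; lia.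
  have m1 : n%:R + k%:R + 1 != 0 :> R[i] by rewrite -mE.
  rewrite mulr1n mulr0n mE -[n.+1%:R]natr1 -[k.+1%:R]natr1.
  by field; rewrite ?n0 k0 m1.
- rewrite !co_dir; [|lia..]; rewrite eqxx.
  rewrite (_ : (l.+2 == l.+1) = false); last by lia.
  rewrite big_nat big1; last first.
    move=> a ha; rewrite big_nat big1 // => b hb; rewrite !co_dir; [|lia..].
    by rewrite (_ : (a == l.+1) = false) ?mulr0 ?mul0r //; lia.
  by rewrite mulr1n mulr0n -[k.+1%:R]natr1; field; rewrite ?n0 k0.
Qed.

Lemma contract (f g : 'I_l.+2 -> {poly R[i]}) :
  \sum_(1 <= a < l.+3) \sum_(1 <= b < l.+3) (D a b)%:P
    * (\sum_s (xi a s)%:P * f s) * (\sum_t (xi b t)%:P * g t) =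
  \sum_s (if s == ord0 then -1 else 1) * f s * g s
  - (k%:R^-1)%:P * (\sum_s f s) * (\sum_t g t).
Proof.
transitivity (\sum_s \sum_t (\sum_(1 <= a < l.+3) \sum_(1 <= b < l.+3)
    D a b * xi a s * xi b t)%:P * (f s * g t)).
  transitivity (\sum_(1 <= a < l.+3) \sum_(1 <= b < l.+3) \sum_s \sum_t
      (D a b * xi a s * xi b t)%:P * (f s * g t)).
    apply: eq_bigr => a _; apply: eq_bigr => b _.
    rewrite -mulrA big_distrlr mulr_sumr; apply: eq_bigr => s _.
    by rewrite mulr_sumr; apply: eq_bigr => t _; rewrite !polyCM /=; ring.
  under eq_bigr => a _ do (rewrite exchange_big; under eq_bigr => s _ do rewrite exchange_big).
  rewrite exchange_big; apply: eq_bigr => s _.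
  rewrite exchange_big; apply: eq_bigr => t _.
  rewrite (rmorph_sum polyC) mulr_suml; apply: eq_bigr => a _.
  by rewrite (rmorph_sum polyC) mulr_suml.
transitivity (\sum_s ((if s == ord0 then -1 else 1) * f s * g s
    - \sum_t (k%:R^-1)%:P * (f s * g t))).
  apply: eq_bigr => s _.
  under eq_bigr => t _ do rewrite sum_dxform polyCB mulrBl.
  rewrite sumrB; congr (_ - _); rewrite (bigD1 s) //= eqxx big1 ?addr0.
    by case: ifP => _; rewrite mulr1 ?polyCN polyC1; ring.
  by move=> t; rewrite eq_sym => /negbTE ->; rewrite mulr0 mul0r.
rewrite sumrB; congr (_ - _); rewrite -mulrA big_distrlr mulr_sumr.
by apply: eq_bigr => s _; rewrite mulr_sumr.
Qed.

Lemma dPhi_linear (p : 'rV[R[i]]_l.+2) c u v :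
  dPhi k p (c *: u + v) = c *: dPhi k p u + dPhi k p v.
Proof. by rewrite -!diff_Phi linearP. Qed.

Lemma Rp_linear (p : 'rV[R[i]]_l.+2) c u v :
  Rp k p (c *: u + v) = c%:P * Rp k p u + Rp k p v.
Proof. by rewrite /Rp dPhi_linear lgR_linear. Qed.

Lemma Rp_sum (p : 'rV[R[i]]_l.+2) (I : Type) (r : seq I) (c : I -> R[i]) f :
  Rp k p (\sum_(i <- r) c i *: f i) = \sum_(i <- r) (c i)%:P * Rp k p (f i).
Proof.
elim: r => [|i r IH]; last by rewrite !big_cons Rp_linear IH.
rewrite !big_nil; have := Rp_linear p (-1) 0 0.
by rewrite scaler0 addr0 polyCN polyC1 mulN1r addNr.
Qed.

Lemma Rp_sum1 (p : 'rV[R[i]]_l.+2) (I : Type) (r : seq I) f :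
  Rp k p (\sum_(i <- r) f i) = \sum_(i <- r) Rp k p (f i).
Proof.
transitivity (Rp k p (\sum_(i <- r) 1 *: f i)).
  by congr (Rp k p _); apply: eq_bigr => i _; rewrite scale1r.
by rewrite Rp_sum; apply: eq_bigr => i _; rewrite polyC1 mul1r.
Qed.

(** The covector [al] raised by the intersection form at [ytilde k x], computed in the frame of the
    coordinates x, where the form is constant. *)
Definition gsharp x (al : 'rV[R[i]]_l.+2) : 'rV[R[i]]_l.+2 :=
  \sum_(1 <= a < l.+3) \sum_(1 <= b < l.+3)
    (@dxform R l k a b * inner (tau k x (dir a)) al) *: tau k x (dir b).

Lemma gsharp_form x al be : inner (gsharp x al) be =
  \sum_(1 <= a < l.+3) \sum_(1 <= b < l.+3)
    inner (tau k x (dir a)) al * inner (tau k x (dir b)) be * @dxform R l k a b.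
Proof.
rewrite /inner /gsharp mulmx_suml summxE; apply: eq_bigr => a _.
rewrite mulmx_suml summxE; apply: eq_bigr => b _.
rewrite -scalemxAl mxE; set A := (_ *m _) 0 0; set B := (_ *m _) 0 0.
by rewrite -mulrA mulrC.
Qed.

Lemma gform_gsharp x i j : (0 < i <= l.+2)%N -> (0 < j <= l.+2)%N ->
  gform k i j x =
  inner (gsharp x (dy_cov (ytilde k x) i)) (dy_cov (ytilde k x) j).
Proof.
move=> hi hj; rewrite gsharp_form /gform; apply: eq_bigr => a _.
by apply: eq_bigr => b _; rewrite !derive_ylog.
Qed.

(** When [al] is represented by h in the residue pairing, the coefficients of the raised vector are
    residues of the polynomials in [casimir] times h, and [casimir] sums them up. The factor (2 pi
    i)^2 / (4 pi^2) accounts for a sign -1. *)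
Lemma Rp_gsharp x al h (p := ytilde k x) (Q := lgQ k (Phi k p)) :
  (forall u, inner u al = (-1) ^+ k * rho Q (Rp k p u * h)) ->
  Q %| Rp k p (gsharp x al) - ((-1) ^+ k)%:P
         * ('X * (lgP (Phi k p) * ('X - (co p l.+1)%:P)) * h).
Proof.
move=> H; set w := co p l.+1; pose P := \prod_s ('X - (zpt k x s)%:P).
pose Ps s := \prod_(t | t != s) ('X - (zpt k x t)%:P).
have PE : lgP (Phi k p) = P by rewrite /p lgP_ytilde.
have QE : Q = critp n P w by rewrite /Q /lgQ PE co_Phi_last.
pose G := P * ('X - w%:P).
pose Rs (s : 'I_l.+2) : {poly R[i]} :=
  if unlift ord0 s is Some t then - (zpt k x t)%:P * (Ps t * ('X - w%:P))
  else w%:P * P.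
pose f s : {poly R[i]} := (rho Q (Rs s * h))%:P.
have RsL t : Rs (lift ord0 t) = - (zpt k x t)%:P * (Ps t * ('X - w%:P)).
  by rewrite /Rs liftK.
have Rs0 : Rs ord0 = w%:P * P by rewrite /Rs unlift_none.
have tauE a : Rp k p (tau k x (dir a)) = twopii%:P * \sum_s (xi a s)%:P * Rs s.
  rewrite Rp_tau // -/p -/w -/P [in RHS]big_ord_recl Rs0 /xi unlift_none [in LHS]addrC.
  congr (_ * (_ + _)); apply: eq_bigr => s _.
  by rewrite RsL liftK.
have fE a : (inner (tau k x (dir a)) al)%:P =
    ((-1) ^+ k * twopii)%:P * \sum_s (xi a s)%:P * f s.
  rewrite H tauE -mulrA rhoCM [_ ^+ k * _]mulrA polyCM; congr (_ * _).
  rewrite mulr_suml rho_sum.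
  rewrite (rmorph_sum polyC); apply: eq_bigr => s _.
  by rewrite -polyCM -rhoCM mulrA.
have t2 : (4 * (pi ^+ 2)%:C)^-1 * twopii ^+ 2 = -1 :> R[i].
  have -> : twopii ^+ 2 = 4 * (pi ^+ 2)%:C * ('i ^+ 2) :> R[i].
    by rewrite /twopii rmorphXn /=; ring.
  by rewrite sqrCi mulKf ?pi4_neq0.
have E : Rp k p (gsharp x al) = - ((-1) ^+ k)%:P * (\sum_s (if s == ord0 then -1 else 1) * f s * Rs s
    - (k%:R^-1)%:P * (\sum_s f s) * (\sum_t Rs t)).
  rewrite -contract /gsharp mulr_sumr.
  transitivity (\sum_(1 <= a < l.+3) \sum_(1 <= b < l.+3)
     (@dxform R l k a b * inner (tau k x (dir a)) al)%:P * Rp k p (tau k x (dir b))).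
    rewrite Rp_sum1; apply: eq_bigr => a _.
    by rewrite Rp_sum.
  apply: eq_bigr => a _; rewrite mulr_sumr; apply: eq_bigr => b _.
  rewrite polyCM fE tauE; set A := \sum_s _; set B := \sum_s _.
  have -> : @dxform R l k a b = (4 * (pi ^+ 2)%:C)^-1 * D a b.
    by rewrite /D mulKf ?pi4_neq0.
  transitivity (((4 * (pi ^+ 2)%:C)^-1 * twopii ^+ 2)%:P * ((-1) ^+ k)%:P
    * ((D a b)%:P * A * B)); first by rewrite !(polyCM, polyC_exp); ring.
  by rewrite t2 polyCN polyC1; ring.
(* Homogeneity of degree k of lambda in z, its zeros and its pole: scaling all zeros and the pole
   acts as k - z d/dz. Through this the rank-one term -1/k of the form becomes the term in G of
   [casimir]. *)
have SE : \sum_s Rs s = k%:R%:P * G - Q.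
  rewrite big_ord_recl Rs0; under eq_bigr => s _ do rewrite RsL.
  have XP : \sum_s (zpt k x s)%:P * Ps s = 'X * P^`() - l.+1%:R%:P * P.
    rewrite [in X in 'X * X]/P deriv_prod ?index_enum_uniq // mulr_sumr.
    have -> : l.+1%:R%:P * P = \sum_(s < l.+1) P.
      by rewrite sumr_const card_ord (rmorph_nat polyC) mulr_natl.
    rewrite -sumrB; apply: eq_bigr => s _.
    have -> : P = ('X - (zpt k x s)%:P) * Ps s by rewrite /P (bigD1 s).
    by rewrite derivXsubC mul1r -/(Ps s); ring.
  have -> : \sum_s - (zpt k x s)%:P * (Ps s * ('X - w%:P)) =
     - ('X * P^`() - l.+1%:R%:P * P) * ('X - w%:P).
    rewrite -XP -sumrN mulr_suml; apply: eq_bigr => s _; ring.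
  by rewrite mE !polyCD polyC1 QE /critp /G; ring.
have C := @casimir _ l.+1 n k (zpt k x) w.
rewrite E.
have fS : \sum_s f s = (rho Q ((\sum_s Rs s) * h))%:P.
  by rewrite mulr_suml rho_sum (rmorph_sum polyC).
have rS : rho Q ((\sum_s Rs s) * h) = k%:R * rho Q (G * h).
  rewrite -rhoCM; apply: rho_mod; rewrite SE.
  by apply/dvdpP; exists (- h); ring.
rewrite fS rS SE.
have -> : \sum_s (if s == ord0 then -1 else 1) * f s * Rs s =
   \sum_s (rho Q (- (zpt k x s)%:P * (Ps s * ('X - w%:P)) * h))%:P
     * (- (zpt k x s)%:P * (Ps s * ('X - w%:P)))
   - (rho Q (w%:P * P * h))%:P * (w%:P * P).
  rewrite big_ord_recl /f eqxx Rs0 addrC; congr (_ + _); last by ring.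
  by apply: eq_bigr => s _; rewrite RsL /= mul1r.
rewrite QE in C *.
have lE : l.+1 = (n + k).+1 by rewrite /n; lia.
have {}C := C lE k0 h; rewrite -/P -/G in C.
have kk : (k%:R^-1)%:P * k%:R%:P = 1 :> {poly R[i]} by rewrite -polyCM mulVf.
set S1 := \sum_s _ in C *; set rw := (rho _ (w%:P * P * h))%:P in C *.
set rG := rho _ (G * h) in C *.
have -> : - ((-1) ^+ k)%:P * (S1 - rw * (w%:P * P)
    - (k%:R^-1)%:P * (k%:R * rG)%:P * (k%:R%:P * G - critp n P w))
    - ((-1) ^+ k)%:P * ('X * (lgP (Phi k p) * ('X - w%:P)) * h) =
  ((-1) ^+ k)%:P * (- S1 + rw * (w%:P * P) + (k%:R * rG)%:P * G - 'X * G * h)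
  + ((-1) ^+ k)%:P * ((k%:R^-1)%:P * k%:R%:P - 1) * ((k%:R * rG)%:P * G)
  - ((-1) ^+ k)%:P * ((k%:R^-1)%:P * (k%:R * rG)%:P) * critp n P w.
  by rewrite PE -/P /G; ring.
rewrite kk subrr mulr0 mul0r addr0 dvdp_sub //; first by rewrite dvdp_mull.
by rewrite dvdp_mull.
Qed.

End Contraction.

(** * Comparison of the metrics *)

Section OrbitMetric.
Context {R : realType} {l : nat}.
Implicit Types (p q x u v al be : 'rV[R[i]]_l.+2).

Lemma innerC u v : inner u v = inner v u.
Proof.
by rewrite /inner !mxE; apply: eq_bigr => i _; rewrite !mxE mulrC.
Qed.

Lemma innerDl u v al : inner (u + v) al = inner u al + inner v al.
Proof. by rewrite /inner mulmxDl mxE. Qed.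

Lemma innerZl c u al : inner (c *: u) al = c * inner u al.
Proof. by rewrite /inner -scalemxAl mxE. Qed.

Lemma inner_entry (A : 'M[R[i]]_l.+2) i j :
  inner (delta_mx 0 i *m A) (delta_mx 0 j) = A i j.
Proof. by rewrite /inner trmx_delta -rowE -colE !mxE. Qed.

Lemma inner_ext p u v : co p l.+1 != 0 -> co p l.+2 != 0 ->
  (forall j, (0 < j <= l.+2)%N -> inner u (dy_cov p j) = inner v (dy_cov p j)) ->
  u = v.
Proof.
move=> q1 q2 H; apply: co_eq => j hj; move: (H j hj); rewrite /dy_cov.
case: ifP => jl; first by rewrite !inner_dir.
rewrite !inner_dirZ; apply: mulfI; rewrite invr_neq0 //.
by have [->|->] : j = l.+1 \/ j = l.+2 by lia.
Qed.

Lemma linear_ext p (f g : 'rV[R[i]]_l.+2 -> 'rV[R[i]]_l.+2) :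
  co p l.+1 != 0 -> co p l.+2 != 0 -> linear f -> linear g ->
  (forall j, (0 < j <= l.+2)%N -> f (dy_cov p j) = g (dy_cov p j)) -> f =1 g.
Proof.
move=> q1 q2 lf lg H u.
have f0 : f 0 = 0.
  have := lf (-1) 0 0; rewrite scaler0 addr0 scaleN1r addNr => {1}->//.
have g0 : g 0 = 0.
  have := lg (-1) 0 0; rewrite scaler0 addr0 scaleN1r addNr => {1}->//.
have fg (i : 'I_l.+2) : f (delta_mx 0 i) = g (delta_mx 0 i).
  have ib : (0 < i.+1 <= l.+2)%N by rewrite /= ltn_ord.
  have dE : delta_mx 0 i = dir i.+1 :> 'rV[R[i]]_l.+2 by rewrite /dir /= inord_val.
  have := H i.+1 ib; rewrite /dy_cov; case: ifP => il; first by rewrite dE.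
  have c0 : co p i.+1 != 0.
    by have [->|->] : i.+1 = l.+1 \/ i.+1 = l.+2 by lia.
  have fZ (h : 'rV[R[i]]_l.+2 -> 'rV[R[i]]_l.+2) c w : linear h -> h 0 = 0 ->
      h (c *: w) = c *: h w.
    by move=> lh h0; rewrite -[c *: w]addr0 lh h0 addr0.
  rewrite !fZ // -dE => /(congr1 (fun z => co p i.+1 *: z)).
  by rewrite !scalerA divff // !scale1r.
rewrite (row_sum_delta u); elim: (index_enum _) => [|i r IH].
  by rewrite !big_nil f0 g0.
by rewrite !big_cons lf lg IH fg.
Qed.

Variable k : nat.
Hypotheses (hk : (0 < k)%N) (hkl : (k < l)%N).
Let n := (l - k)%N.

(** The conditions on coordinates alone; [orbit_domainE] shows that they characterize the orbit
    domain. *)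
Definition orbit_open_domain p :=
  [/\ co p l.+1 != 0, co p l.+2 != 0 & tsing k p != 0].

Lemma orbit_domain_open_domain p : orbit_domain l k p -> orbit_open_domain p.
Proof. by case=> -[_ [q1 q2]] t0; split. Qed.

Lemma orbit_domain_ytilde p : orbit_domain l k p -> exists x, p = ytilde k x.
Proof.
case=> -[[x xp] _] _; exists x.
have : (ytilde k @` Wtilde_orbit k x) (ytilde k x).
  by exists x => //; exact: Relation_Operators.rst_refl.
by rewrite xp.
Qed.

Lemma lg_domain_Phi p : orbit_open_domain p -> lg_domain k l (Phi k p).
Proof.
case=> q1 q2 t0; apply/(lg_domain_polyE hk hkl); rewrite co_Phi_last; split=> //.
  rewrite lgP_Phi_0 //; apply: mulf_neq0; first by rewrite signr_eq0.
  by rewrite mulf_neq0 ?expf_neq0.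
by rewrite lgP_Phi_q1 // mulf_neq0 ?expf_neq0.
Qed.

Definition dPhi_mx p : 'M[R[i]]_l.+2 := lin1_mx ('d (Phi k) p).

Lemma mul_dPhi_mx p u : u *m dPhi_mx p = dPhi k p u.
Proof. by rewrite mul_rV_lin1 /= diff_Phi. Qed.

Lemma dPhi_mx_unit p : co p l.+1 != 0 -> co p l.+2 != 0 -> dPhi_mx p \in unitmx.
Proof.
move=> q1 q2; apply: row_free_unitmx => u; rewrite mul_dPhi_mx.
exact: dPhi_inj.
Qed.

(** Gram matrix, in the coordinates of the orbit space, of the pullback of the Landau-Ginzburg
    metric; the orbit metric is shown to equal it. *)
Definition Mhat p : 'M[R[i]]_l.+2 :=
  dPhi_mx p *m lg_metric k (Phi k p) *m (dPhi_mx p)^T.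

Lemma MhatE p u v : (u *m Mhat p *m v^T) 0 0 =
  Defs.eta (lg_frobenius R k l) (Phi k p) (dPhi k p u) (dPhi k p v).
Proof. by rewrite /Defs.eta -!mul_dPhi_mx trmx_mul /Mhat !mulmxA. Qed.

Lemma Mhat_unit p : orbit_open_domain p -> Mhat p \in unitmx.
Proof.
move=> pD; have [q1 q2 _] := pD; have aD := lg_domain_Phi pD.
have [I HI] := lgQ_inverse hk hkl aD n.+1 2.
by rewrite !unitmx_mul unitmx_tr dPhi_mx_unit // (lg_metric_unitmx hk hkl aD HI).
Qed.

Lemma inner_Mhat p I u v : orbit_open_domain p ->
  lgQ k (Phi k p) %| 'X^(n.+1) * ('X - (co p l.+1)%:P) ^+ 2 * I - 1 ->
  inner u (v *m Mhat p) =
  (-1) ^+ k * rho (lgQ k (Phi k p)) (Rp k p u * (Rp k p v * I)).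
Proof.
move=> pD HI; have aD := lg_domain_Phi pD; rewrite innerC /inner MhatE.
rewrite -(co_Phi_last k) in HI.
rewrite (eta_lg hk hkl aD HI); congr (_ * rho _ _).
by rewrite /Rp; ring.
Qed.

Lemma lgQ_line p t : lgQ k (Phi k (p + t *: edir k)) = lgQ k (Phi k p).
Proof.
rewrite /lgQ /critp lgP_Phi_line // !co_Phi_last co_lineE //; last by lia.
have -> : (l.+1 == k) = false by lia. have -> : (l.+1 == k.+1) = false by lia.
rewrite addr0 mulr0 addr0 -/n; set w := co p l.+1; set c := (_ * t)%:P.
have dE : (lgP (Phi k p) + c * ('X^n * ('X - w%:P)))^`() =
    (lgP (Phi k p))^`() + c * (n%:R%:P * 'X^(n.-1) * ('X - w%:P) + 'X^n).
  rewrite derivD /c derivM derivC mul0r add0r derivM derivXn derivXsubC mulr1.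
  by rewrite (rmorph_nat polyC) mulr_natl.
rewrite dE.
have nE : 'X * 'X^(n.-1) = 'X^n :> {poly R[i]}.
  by rewrite -exprS prednK // /n subn_gt0.
rewrite -nE; ring.
Qed.

Lemma co_line_q p t : co (p + t *: edir k) l.+1 = co p l.+1 /\
  co (p + t *: edir k) l.+2 = co p l.+2.
Proof.
have e1 : (l.+1 == k) = false by lia.
have e2 : (l.+1 == k.+1) = false by lia.
have e3 : (l.+2 == k) = false by lia.
have e4 : (l.+2 == k.+1) = false by lia.
have b1 : (0 < l.+1 <= l.+2)%N by lia.
have b2 : (0 < l.+2 <= l.+2)%N by lia.
by rewrite !co_lineE // e1 e2 e3 e4 addr0 mulr0 !addr0.
Qed.

Lemma open_domain_line p t : orbit_open_domain p -> orbit_open_domain (p + t *: edir k).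
Proof.
move=> [q1 q2 t0]; have pw : (lgP (Phi k p)).[co p l.+1] != 0.
  by rewrite lgP_Phi_q1 // mulf_neq0 ?expf_neq0.
have [e1 e2] := co_line_q p t.
split; rewrite ?e1 ?e2 //.
have := lgP_Phi_q1 hk hkl (p + t *: edir k).
rewrite e1 lgP_Phi_line // hornerD hornerCM hornerM hornerXsubC subrr !mulr0 addr0.
by move=> E; apply: contraNneq pw => t0'; rewrite E t0' mulr0.
Qed.

Lemma Mhat_line p t : orbit_open_domain p -> Mhat (p + t *: edir k) = Mhat p.
Proof.
move=> pD; have pD' := open_domain_line t pD.
have [I HI] := lgQ_inverse hk hkl (lg_domain_Phi pD) n.+1 2.
rewrite co_Phi_last in HI.
have HI' : lgQ k (Phi k (p + t *: edir k)) %|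
    'X^(n.+1) * ('X - (co (p + t *: edir k) l.+1)%:P) ^+ 2 * I - 1.
  by rewrite (lgQ_line p t) (co_line_q p t).1.
apply/matrixP => i j.
have E := inner_Mhat (delta_mx 0 j) (delta_mx 0 i) pD HI.
have E' := inner_Mhat (delta_mx 0 j) (delta_mx 0 i) pD' HI'.
rewrite -[LHS]inner_entry -[RHS]inner_entry [LHS]innerC [RHS]innerC.
apply: (etrans E'); apply: etrans (esym E).
by rewrite (lgQ_line p t) !(Rp_line hk hkl p t).
Qed.

Lemma Rp_eq p u v : orbit_open_domain p ->
  lgQ k (Phi k p) %| Rp k p u - Rp k p v -> u = v.
Proof.
move=> pD; have [q1 q2 _] := pD => d.
have e := lgR_eq hk hkl (lg_domain_Phi pD) d.
apply/eqP; rewrite -subr_eq0; apply/eqP; apply: (dPhi_inj hk hkl q1 q2).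
have := dPhi_linear k p (-1) v u; rewrite !scaleN1r [- _ + u]addrC e => ->.
by rewrite addNr.
Qed.

(* Multiplication by the Euler field is multiplication of classes by lambda.   *)
Definition euler_rel p u v := lgQ k (Phi k p) %|
  'X^n * ('X - (co p l.+1)%:P) * Rp k p u - ((-1) ^+ k)%:P * lgP (Phi k p) * Rp k p v.

(** The covector v lowered by [Mhat] is represented by R_v I, with I the inverse of z^(n+1) (z-w)^2
    modulo Q; in [Rp_gsharp] this cancels all factors except lambda. *)
Lemma gsharp_euler_rel x v : orbit_open_domain (ytilde k x) ->
  euler_rel (ytilde k x) (gsharp k x (v *m Mhat (ytilde k x))) v.
Proof.
set p := ytilde k x => pD.
have [I HI] := lgQ_inverse hk hkl (lg_domain_Phi pD) n.+1 2.
rewrite co_Phi_last in HI.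
have := Rp_gsharp hk hkl (x := x) (h := Rp k p v * I)
  (fun u => inner_Mhat u v pD HI).
rewrite -/p /euler_rel; set g := Rp k p _; set Q := lgQ k (Phi k p) in HI *.
set w := co p l.+1 in HI *; set P := lgP (Phi k p) => H.
have -> : 'X^n * ('X - w%:P) * g - ((-1) ^+ k)%:P * P * Rp k p v =
  (g - ((-1) ^+ k)%:P * ('X * (P * ('X - w%:P)) * (Rp k p v * I)))
   * ('X^n * ('X - w%:P))
  + ('X^(n.+1) * ('X - w%:P) ^+ 2 * I - 1) * (((-1) ^+ k)%:P * P * Rp k p v).
  by rewrite ['X^(n.+1)]exprS; move: ('X^n) => Xn; ring.
by rewrite dvdp_add // dvdp_mulr.
Qed.

Lemma coprime_den p : orbit_open_domain p ->
  coprimep ('X^n * ('X - (co p l.+1)%:P)) (lgQ k (Phi k p)).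
Proof.
move=> pD; have := lgQ_coprime hk hkl (lg_domain_Phi pD) n 1.
by rewrite co_Phi_last expr1.
Qed.

(** Along e only lambda changes, by (-1)^k t, so the two relations differ by t R_v; the denominator
    is coprime to Q and cancels. *)
Lemma euler_rel_line p t u u' v : orbit_open_domain p ->
  euler_rel p u v -> euler_rel (p + t *: edir k) u' v -> u' = u + t *: v.
Proof.
move=> pD H H'; apply: (Rp_eq pD).
rewrite /euler_rel (lgQ_line p t) (co_line_q p t).1 !(Rp_line hk hkl p t) (lgP_Phi_line hk hkl p t) in H'.
rewrite [u + _]addrC Rp_linear.
have := dvdp_sub H' H; set w := co p l.+1; set P := lgP _.
have s2 : ((-1) ^+ k)%:P * ((-1) ^+ k)%:P = 1 :> {poly R[i]}.
  by rewrite -polyCM -exprMn mulrNN mulr1 expr1n.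
have -> : 'X^n * ('X - w%:P) * Rp k p u' -
    ((-1) ^+ k)%:P * (P + ((-1) ^+ k * t)%:P * ('X^n * ('X - w%:P))) * Rp k p v -
    ('X^n * ('X - w%:P) * Rp k p u - ((-1) ^+ k)%:P * P * Rp k p v) =
  'X^n * ('X - w%:P) * (Rp k p u' - (t%:P * Rp k p v + Rp k p u))
  - (((-1) ^+ k)%:P * ((-1) ^+ k)%:P - 1) * (t%:P * ('X^n * ('X - w%:P)) * Rp k p v).
  by rewrite polyCM; move: ('X^n) => Xn; ring.
rewrite s2 subrr mul0r subr0.
by rewrite Gauss_dvdpr // coprimep_sym coprime_den.
Qed.

End OrbitMetric.

Section NearAffine.
Variables (K : numFieldType) (V : normedModType K).

Lemma derive_near_affine (f : V -> K^o) (x v : V) (c d : K) :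
  (\forall h \near (0 : K), f (h *: v + x) = c + h * d) -> 'D_v f x = d.
Proof.
move=> fE.
have fx : f x = c.
  by have := nbhs_singleton fE; rewrite scale0r add0r mul0r addr0.
apply/cvg_lim; first exact: norm_hausdorff.
have c0 : (fun=> d : K^o) @ (0 : K)^' --> (d : K^o) by exact: cvg_cst.
apply: cvg_trans c0; apply: near_eq_cvg.
have fE' : \forall h \near (0 : K)^', f (h *: v + x) = c + h * d.
  exact: nbhs_dnbhs fE.
near=> h.
have h0 : h != 0 by near: h; exact: nbhs_dnbhs_neq.
have E : f (h *: v + x) = c + h * d by near: h.
rewrite -[(f \o _) _]/(f (h *: v + x)).
by rewrite E fx addrC addKr /GRing.scale /= mulKf.
Unshelve. all: by end_near. Qed.

Lemma near_line (D : set V) (x v : V) : open D -> D x ->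
  \forall h \near (0 : K), D (h *: v + x).
Proof.
move=> oD Dx.
have H1 : {for (0 : K), continuous (fun h : K => h *: v)}.
  exact: scalel_continuous.
have H2 : {for (0 : K), continuous (fun h : K => x)} by exact: cst_continuous.
have H := continuousD H1 H2.
apply: H; rewrite -[(_ + _) _]/(0 *: v + x) scale0r add0r.
exact: open_nbhs_nbhs.
Qed.

End NearAffine.

(** * The metric of the orbit space is the pulled-back one *)

Section OrbitFrobenius.
Context {R : realType} {l : nat}.
Variable k : nat.
Hypotheses (hk : (0 < k)%N) (hkl : (k < l)%N).
Variables (F : frob_data R l.+2) (HF : orbit_frobenius k F).
Let n := (l - k)%N.
Let D := @orbit_domain R l k.
Let FF := orbit_frob HF.
Implicit Types (p q x u v al be : 'rV[R[i]]_l.+2).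

Lemma eta_symF p u v : D p -> Defs.eta F p u v = Defs.eta F p v u.
Proof.
move=> pD; rewrite /Defs.eta -{1}(frob_metric_sym FF pD).
have -> : u *m (metric F p)^T *m v^T = (v *m metric F p *m u^T)^T.
  by rewrite !trmx_mul trmxK mulmxA.
by rewrite mxE.
Qed.

(** Invariance of the metric moves a factor across the pairing: the intersection form is the metric
    composed with multiplication by the Euler field. *)
Lemma intersection_euler p al be : D p -> intersection F p al be =
  inner (mult F p (euler F p) (sharp F p al)) be.
Proof.
move=> pD; rewrite /intersection (frob_mult_comm FF _ _ pD).
rewrite (frob_invariant FF _ _ _ pD) eta_symF // (frob_mult_comm FF _ _ pD).
rewrite /Defs.eta /sharp /inner trmx_mul trmx_inv (frob_metric_sym FF pD).
by rewrite -!mulmxA mulKVmx // (frob_metric_nondeg FF pD).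
Qed.

Lemma mult_linr p u : D p -> linear (mult F p u).
Proof.
move=> pD c v w; rewrite ![mult F p u _](frob_mult_comm FF _ _ pD).
exact: (frob_mult_lin FF _ _ _ _ pD).
Qed.

Lemma gsharp_linear x : linear (gsharp k x : 'rV[R[i]]_l.+2 -> 'rV[R[i]]_l.+2).
Proof.
move=> c u v; rewrite /gsharp scaler_sumr -big_split; apply: eq_bigr => a _.
rewrite /= scaler_sumr -big_split; apply: eq_bigr => b _ /=.
rewrite scalerA -scalerDl; congr (_ *: _).
have -> : inner (tau k x (dir a)) (c *: u + v) =
    c * inner (tau k x (dir a)) u + inner (tau k x (dir a)) v.
  by rewrite ![inner (tau _ _ _) _]innerC innerDl innerZl.
by ring.
Qed.

Lemma euler_sharp x : D (ytilde k x) -> forall al,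
  mult F (ytilde k x) (euler F (ytilde k x)) (sharp F (ytilde k x) al) = gsharp k x al.
Proof.
set p := ytilde k x => pD; have [q1 q2 _] := orbit_domain_open_domain pD.
apply: (linear_ext (f := fun al => mult F p (euler F p) (sharp F p al))
  (g := gsharp k x) q1 q2).
- move=> c u v; rewrite /sharp mulmxDl -scalemxAl.
  exact: (mult_linr _ pD).
- exact: gsharp_linear.
move=> i hi; apply: (inner_ext q1 q2) => j hj.
rewrite -intersection_euler // (orbit_intersection HF) //.
by rewrite gform_gsharp.
Qed.

Lemma dy_cov_line p t i : (0 < i <= l.+2)%N ->
  dy_cov (t *: edir k + p) i = dy_cov p i.
Proof.
move=> hi; rewrite /dy_cov; case: ifP => // il; rewrite addrC.
have [e1 e2] := co_line_q hk hkl p t.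
have iE : i = l.+1 \/ i = l.+2 by lia.
by case: iE => ->; rewrite ?e1 ?e2.
Qed.

Lemma gsharp_rel p x v : p = ytilde k x -> orbit_open_domain k p ->
  euler_rel k p (gsharp k x (v *m Mhat k p)) v.
Proof. by move=> ->; exact: gsharp_euler_rel. Qed.

(** Let v be dy^i raised by [Mhat]. Near p on the line along e, dy^i raised by the intersection form
    is its value at p plus t v, because [Mhat] is constant on the line. Its derivative v is
    therefore, by definition of the orbit metric, dy^i raised by that metric. *)
Lemma metric_Mhat p : D p -> metric F p = Mhat k p.
Proof.
move=> pD; have pO := orbit_domain_open_domain pD; have [q1 q2 _] := pO.
have [x px] := orbit_domain_ytilde pD.
have Mu := frob_metric_nondeg FF pD; have Mhu := Mhat_unit hk hkl pO.
suff E : forall al, al *m invmx (metric F p) = al *m invmx (Mhat k p).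
  have : invmx (metric F p) = invmx (Mhat k p).
    by apply/row_matrixP => i; rewrite !rowE.
  by move=> /(congr1 invmx); rewrite !invmxK.
apply: (linear_ext (f := fun al => al *m invmx (metric F p))
  (g := fun al => al *m invmx (Mhat k p)) q1 q2) => [c u v|c u v|i hi]; rewrite ?mulmxDl ?scalemxAl //.
set v := dy_cov p i *m invmx (Mhat k p).
have vE : v *m Mhat k p = dy_cov p i by rewrite /v mulmxKV.
apply: (inner_ext q1 q2) => j hj; rewrite (orbit_metric HF) // orbit_unit_edir //.
apply: (derive_near_affine (c := inner (gsharp k x (dy_cov p i)) (dy_cov p j))).
have near_D := near_line (edir k) (frob_open FF) pD.
near=> t.
have qD : D (t *: edir k + p) by near: t.
have [y qy] := orbit_domain_ytilde qD.
rewrite !dy_cov_line // intersection_euler // qy euler_sharp -?qy //.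
have r1 : euler_rel k p (gsharp k x (dy_cov p i)) v.
  by rewrite -vE; exact: gsharp_rel px pO.
have r2 : euler_rel k (p + t *: edir k) (gsharp k y (dy_cov p i)) v.
  rewrite -vE -(Mhat_line hk hkl t pO); apply: gsharp_rel; first by rewrite addrC.
  exact: open_domain_line.
by rewrite (euler_rel_line hk hkl pO r1 r2) innerDl innerZl.
Unshelve. all: by end_near. Qed.

Lemma mult_euler_rel p v : D p -> euler_rel k p (mult F p (euler F p) v) v.
Proof.
move=> pD; have pO := orbit_domain_open_domain pD.
have [x px] := orbit_domain_ytilde pD.
have vE : v = sharp F p (v *m Mhat k p).
  by rewrite /sharp metric_Mhat // mulmxK // (Mhat_unit hk hkl).
have E : mult F p (euler F p) v = gsharp k x (v *m Mhat k p).
  by rewrite {1}vE px euler_sharp -px.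
by rewrite E; exact: gsharp_rel px pO.
Qed.

Lemma eta_Phi p u v : D p ->
  Defs.eta (lg_frobenius R k l) (Phi k p) (dPhi k p u) (dPhi k p v) =
  Defs.eta F p u v.
Proof. by move=> pD; rewrite -MhatE -metric_Mhat. Qed.

End OrbitFrobenius.

(** * Comparison of the products *)

Section PolynomialDependence.
Variable K : fieldType.
Implicit Types (f g : K -> K) (F G : K -> {poly K}).

(** Polynomial dependence on a parameter t, of scalars here and of polynomials in [bipoly]; it gives
    nonvanishing outside a finite set from nonvanishing at one value. *)
Definition polyf f := exists p : {poly K}, forall t, f t = p.[t].
Definition bipoly F := exists B : {poly {poly K}},
  forall t, F t = map_poly (horner_eval t) B.

Lemma polyf_cst c : polyf (fun=> c).
Proof. by exists c%:P => t; rewrite hornerC. Qed.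

Lemma polyf_id : polyf id.
Proof. by exists 'X => t; rewrite hornerX. Qed.

Lemma polyfD f g : polyf f -> polyf g -> polyf (fun t => f t + g t).
Proof. by move=> [p pE] [q qE]; exists (p + q) => t; rewrite hornerD pE qE. Qed.

Lemma polyfM f g : polyf f -> polyf g -> polyf (fun t => f t * g t).
Proof. by move=> [p pE] [q qE]; exists (p * q) => t; rewrite hornerM pE qE. Qed.

Lemma polyfX f j : polyf f -> polyf (fun t => f t ^+ j).
Proof. by move=> [p pE]; exists (p ^+ j) => t; rewrite horner_exp pE. Qed.

Lemma polyf_sum (I : Type) (r : seq I) (P : pred I) (f : I -> K -> K) :
  (forall i, polyf (f i)) -> polyf (fun t => \sum_(i <- r | P i) f i t).
Proof.
move=> H; elim: r => [|i r IH].
  by exists 0 => t; rewrite big_nil horner0.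
have [p pE] := IH; have [q qE] := H i.
exists (if P i then q + p else p) => t.
by rewrite big_cons; case: ifP => _; rewrite ?hornerD -pE ?qE.
Qed.

Lemma polyf_ext f g : (forall t, f t = g t) -> polyf f -> polyf g.
Proof. by move=> e [p pE]; exists p => t; rewrite -e. Qed.

Lemma bipoly_ext F G : (forall t, F t = G t) -> bipoly F -> bipoly G.
Proof. by move=> e [p pE]; exists p => t; rewrite -e. Qed.

Lemma bipolyC f : polyf f -> bipoly (fun t => (f t)%:P).
Proof.
by move=> [p pE]; exists p%:P => t; rewrite map_polyC /= /horner_eval pE.
Qed.

Lemma bipoly_cst p : bipoly (fun=> p).
Proof.
exists (map_poly polyC p) => t; rewrite -map_poly_comp.
rewrite (eq_map_poly (g := id)) ?map_poly_id // => c /=.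
by rewrite /horner_eval hornerC.
Qed.

Lemma bipolyD F G : bipoly F -> bipoly G -> bipoly (fun t => F t + G t).
Proof. by move=> [p pE] [q qE]; exists (p + q) => t; rewrite rmorphD pE qE. Qed.

Lemma bipolyM F G : bipoly F -> bipoly G -> bipoly (fun t => F t * G t).
Proof. by move=> [p pE] [q qE]; exists (p * q) => t; rewrite rmorphM pE qE. Qed.

Lemma bipolyN F : bipoly F -> bipoly (fun t => - F t).
Proof. by move=> [p pE]; exists (- p) => t; rewrite rmorphN pE. Qed.

Lemma bipolyX F j : bipoly F -> bipoly (fun t => F t ^+ j).
Proof. by move=> [p pE]; exists (p ^+ j) => t; rewrite rmorphXn pE. Qed.

Lemma bipoly_deriv F : bipoly F -> bipoly (fun t => (F t)^`()).
Proof. by move=> [p pE]; exists p^`() => t; rewrite pE deriv_map. Qed.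

Lemma bipoly_sum (I : Type) (r : seq I) (P : pred I) (F : I -> K -> {poly K}) :
  (forall i, bipoly (F i)) -> bipoly (fun t => \sum_(i <- r | P i) F i t).
Proof.
move=> H; elim: r => [|i r IH].
  by exists 0 => t; rewrite big_nil rmorph0.
have [p pE] := IH; have [q qE] := H i.
exists (if P i then q + p else p) => t.
by rewrite big_cons pE; case: ifP => _ //; rewrite rmorphD qE.
Qed.

Lemma polyf_coef F i : bipoly F -> polyf (fun t => (F t)`_i).
Proof. by move=> [B BE]; exists B`_i => t; rewrite BE coef_map. Qed.

Section ParametricResidue.
Variables (Q : K -> {poly K}) (N : nat) (c : K).
Hypotheses (bQ : bipoly Q) (sQ : forall t, size (Q t) = N.+1)
  (lQ : forall t, lead_coef (Q t) = c).

(** The leading coefficient of Q does not depend on t, so reducing powers of X modulo Q introduces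
    no denominators in t. *)
Lemma polyf_rhoXn i : polyf (fun t => rho (Q t) 'X^i).
Proof.
have c0 : c != 0 by rewrite -(lQ 0) lead_coef_eq0 -size_poly_gt0 sQ.
elim/ltn_ind: i => i IH; have [iN|Ni] := ltnP i N.
  apply: (polyf_ext _ (polyf_cst ((i == N.-1)%:R / c))) => t.
  rewrite rho_small ?sQ ?size_polyXn // lQ coefXn eq_sym.
  by case: N iN {IH} => //.
have step t : rho (Q t) 'X^i =
    - c^-1 * \sum_(j < N) (Q t)`_j * rho (Q t) 'X^(i - N + j).
  have : rho (Q t) ('X^(i - N) * Q t) = 0.
    have <- : rho (Q t) 0 = 0 by exact: raddf0.
    by apply: rho_mod; rewrite subr0 dvdp_mull.
  rewrite {2}(_ : Q t = \sum_(j < N.+1) (Q t)`_j *: 'X^j); last first.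
    by rewrite -[LHS]coefK poly_def sQ.
  rewrite mulr_sumr rho_sum big_ord_recr /=.
  have -> : (Q t)`_N = c by rewrite -(lQ t) lead_coefE sQ.
  under eq_bigr => j _ do rewrite -scalerAr -exprD rhoZ.
  rewrite -scalerAr -exprD rhoZ subnK // => /eqP; rewrite addrC addr_eq0 => /eqP e.
  by apply: (mulfI c0); rewrite e mulrA mulrN divff // mulN1r.
apply: (polyf_ext (fun t => esym (step t))).
apply: polyfM; first exact: polyf_cst.
apply: polyf_sum => j; apply: polyfM; first exact: polyf_coef.
apply: IH; have := ltn_ord j; lia.
Qed.

Lemma polyf_rho F : bipoly F -> polyf (fun t => rho (Q t) (F t)).
Proof.
move=> [B BE].
apply: (@polyf_ext (fun t => \sum_(i < size B) (F t)`_i * rho (Q t) 'X^i)) => [t|].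
  have sF : (size (F t) <= size B)%N by rewrite BE size_poly.
  rewrite [in RHS](_ : F t = \sum_(i < size B) (F t)`_i *: 'X^i).
    by rewrite rho_sum; apply: eq_bigr => i _; rewrite rhoZ.
  apply/polyP => j; rewrite -poly_def coef_poly; case: ltnP => // Bj.
  by rewrite nth_default // (leq_trans sF).
apply: polyf_sum => i; apply: polyfM; last exact: polyf_rhoXn.
by apply: polyf_coef; exists B.
Qed.

End ParametricResidue.

Lemma polyf_det n (M : K -> 'M[K]_n) : (forall i j, polyf (fun t => M t i j)) ->
  polyf (fun t => \det (M t)).
Proof.
move=> H; have /choice[A AE] : forall i, exists p : 'I_n -> {poly K},
    forall j t, M t i j = (p j).[t].
  by move=> i; have /choice[p pE] := H i; exists p.
exists (\det (\matrix_(i, j) A i j)) => t.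
rewrite -[RHS]/(horner_eval t _) -det_map_mx; congr (\det _).
by apply/matrixP => i j; rewrite !mxE AE.
Qed.

Lemma polyf_ext0 f : polyf f -> forall t0, f t0 != 0 ->
  exists p : {poly K}, p != 0 /\ forall t, f t = p.[t].
Proof.
move=> [p pE] t0 ft0; exists p; split=> //.
by apply: contraNneq ft0 => p0; rewrite pE p0 horner0.
Qed.

End PolynomialDependence.

(** * Determinants detecting common roots and cyclic elements *)

Section Hankel.
Variable K : fieldType.
Implicit Types (Q C P d f : {poly K}).

Lemma rowfree_det (n : nat) (A : 'M[K]_n) :
  (forall u : 'rV_n, u *m A = 0 -> u = 0) -> \det A != 0.
Proof. by move=> /row_free_unitmx; rewrite unitmxE unitfE. Qed.

Lemma rVpoly_sum n (u : 'rV[K]_n) : rVpoly u = \sum_(i < n) u 0 i *: 'X^i.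
Proof.
apply/polyP => j; rewrite coef_sum; case: (ltnP j n) => jn.
  rewrite (coef_rVpoly_ord u (Ordinal jn)) (bigD1 (Ordinal jn)) //= big1 ?addr0.
    by rewrite coefZ coefXn eqxx mulr1.
  move=> i; rewrite coefZ coefXn -val_eqE /= eq_sym => /negbTE ->.
  by rewrite mulr0.
rewrite big1 => [|i _].
  by rewrite nth_default // (leq_trans _ jn) // size_poly.
by rewrite coefZ coefXn gtn_eqF ?mulr0 // (leq_trans (ltn_ord i)).
Qed.

(** Gram matrix of the form (f, g) -> rho Q (C f g) on the monomials; its determinant is used like a
    resultant of Q and C. *)
Definition hankel n Q C : 'M[K]_n := \matrix_(i, j) rho Q (C * 'X^i * 'X^j).

Lemma mul_hankel n Q C (u : 'rV[K]_n) j :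
  (u *m hankel n Q C) 0 j = rho Q (C * rVpoly u * 'X^j).
Proof.
rewrite mxE rVpoly_sum mulr_sumr mulr_suml rho_sum; apply: eq_bigr => i _.
by rewrite mxE -scalerAr -scalerAl rhoZ.
Qed.

Lemma hankel_const n Q (c : K) : size Q = n.+1 -> (0 < n)%N -> c != 0 ->
  \det (hankel n Q c%:P) != 0.
Proof.
move=> sQ n0 c0; apply: rowfree_det => u u0.
have : Q %| c%:P * rVpoly u.
  apply: rho_nondeg; rewrite sQ // => j jn.
  by rewrite -(mul_hankel Q c%:P u (Ordinal jn)) u0 mxE.
have su : (size (rVpoly u) <= n)%N by rewrite size_poly.
rewrite mul_polyC dvdpZr // => /(dvdp_leq _) H.
rewrite -[u]rVpolyK; have [->|/H] := eqVneq (rVpoly u) 0; first by rewrite raddf0.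
by rewrite sQ ltnNge su.
Qed.

Lemma hankel_common_root n Q C y : size Q = n.+1 -> root Q y -> root C y ->
  \det (hankel n Q C) = 0.
Proof.
move=> sQ /factor_theorem[q qE] Cy; apply/eqP; apply: contraTT isT => dA.
have Q0 : Q != 0 by rewrite -size_poly_gt0 sQ.
have q0 : q != 0 by apply: contraNneq Q0 => q0; rewrite qE q0 mul0r.
have sq : (size q <= n)%N.
  by have := sQ; rewrite qE size_Mmonic ?monicXsubC // size_XsubC addn2 => -[->].
have uA : poly_rV q *m hankel n Q C = 0.
  apply/rowP => j; rewrite mul_hankel poly_rV_K // mxE.
  have <- : rho Q 0 = 0 by exact: raddf0.
  apply: rho_mod; rewrite subr0 dvdp_mulr //.
  have [c ->] := factor_theorem _ _ Cy.
  by rewrite qE; apply/dvdpP; exists c; ring.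
have Au : hankel n Q C \in unitmx by rewrite unitmxE unitfE.
have : (poly_rV q : 'rV_n) = 0 by rewrite -(mulmxK Au (poly_rV q)) uA mul0mx.
by move/(congr1 rVpoly); rewrite poly_rV_K // raddf0 => /eqP; rewrite (negbTE q0).
Qed.

(** Row i pairs (P/d)^i, multiplied by d^(n-1) to stay polynomial, with the monomials. For d prime
    to Q, invertibility means that the powers of P/d form a basis of K[z]/(Q). *)
Definition cycmx n Q P d : 'M[K]_n :=
  \matrix_(i, j) rho Q (P ^+ i * d ^+ (n.-1 - i) * 'X^j).

Lemma mul_cycmx n Q P d (u : 'rV[K]_n) j : (u *m cycmx n Q P d) 0 j =
  rho Q ((\sum_(i < n) u 0 i *: (P ^+ i * d ^+ (n.-1 - i))) * 'X^j).
Proof.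
rewrite mxE mulr_suml rho_sum; apply: eq_bigr => i _.
by rewrite mxE -scalerAl rhoZ.
Qed.

(** A linear relation between the rows is a polynomial of degree < n that vanishes at the n distinct
    values of P/d on the roots of Q. *)
Lemma cycmx_distinct n Q P d (s : seq K) : size Q = n.+1 -> (0 < n)%N ->
  uniq s -> size s = n -> all (root Q) s ->
  {in s, forall z, d.[z] != 0} ->
  {in s &, injective (fun z => P.[z] / d.[z])} ->
  \det (cycmx n Q P d) != 0.
Proof.
move=> sQ n0 us ss rs dz linj; apply: rowfree_det => u u0.
set f := \sum_(i < n) u 0 i *: (P ^+ i * d ^+ (n.-1 - i)).
have Qf : Q %| f.
  apply: rho_nondeg; rewrite sQ // => j jn.
  by rewrite -(mul_cycmx Q P d u (Ordinal jn)) u0 mxE.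
have : rVpoly u = 0.
  apply: (@roots_geq_poly_eq0 _ _ [seq P.[z] / d.[z] | z <- s]).
  - apply/allP => _ /mapP[z zs ->]; have d0 := dz z zs.
    have fz : f.[z] = 0.
      apply/eqP; rewrite -/(root f z) root_factor_theorem (dvdp_trans _ Qf) //.
      by rewrite -root_factor_theorem; exact: (allP rs).
    apply/eqP; apply: (mulfI (expf_neq0 n.-1 d0)); rewrite mulr0 -fz.
    rewrite rVpoly_sum /f !horner_sum mulr_sumr; apply: eq_bigr => i _.
    rewrite !hornerZ hornerM !horner_exp hornerX.
    have -> : d.[z] ^+ n.-1 = d.[z] ^+ i * d.[z] ^+ (n.-1 - i).
      by rewrite -exprD subnKC //; have := ltn_ord i; lia.
    rewrite expr_div_n; have := expf_neq0 i d0.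
    move: (d.[z] ^+ i) (d.[z] ^+ (n.-1 - i)) => x y x0.
    by field.
  - by rewrite map_inj_in_uniq.
  - by rewrite size_map ss size_poly.
by move=> e; rewrite -[u]rVpolyK e raddf0.
Qed.

End Hankel.

(** * A superpotential with distinct critical values *)

Section GoodPoint.
Variable K : numClosedFieldType.
Variables (n k : nat).
Hypotheses (hn : (0 < n)%N) (hk : (0 < k)%N).
Let m := (n + k).+1.
Implicit Types (b z y : K).

Let A : {poly K} := 'X^m * (k%:R%:P * 'X - k.+1%:R%:P).
Let B : {poly K} := n.+1%:R%:P * 'X - n%:R%:P.
Let h : {poly K} := 'X^n * (k%:R%:P * 'X - k.+1%:R%:P).
Let P b : {poly K} := 'X^m + b%:P.
Let Q b : {poly K} := critp n (P b) 1.
Let d : {poly K} := 'X^n * ('X - 1%:P).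

Let QE b : Q b = A - b%:P * B.
Proof.
rewrite /Q /critp /P /A /B derivD derivXn derivC addr0 mulrnAr -exprS.
have -> : 'X^(m.-1.+1) *+ m = (n%:R + k%:R + 1)%:P * 'X^m :> {poly K}.
  have -> : n%:R + k%:R + 1 = m%:R :> K by rewrite -natrD natr1.
  by rewrite -[LHS]mulr_natl (rmorph_nat polyC).
rewrite -[n.+1%:R]natr1 -[k.+1%:R]natr1 !polyCD !polyC1.
by move: ('X^m) => Y; ring.
Qed.

Let sP b : size (P b) = m.+1.
Proof. by rewrite /P size_polyDl size_polyXn // size_polyC; case: eqP. Qed.

Let mP b : P b \is monic.
Proof.
apply/monicP; rewrite lead_coefDl ?lead_coefXn // size_polyXn size_polyC.
by case: eqP.
Qed.

Let k0 : k%:R != 0 :> K. Proof. by rewrite pnatr_eq0; lia. Qed.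
Let n0 : n%:R != 0 :> K. Proof. by rewrite pnatr_eq0; lia. Qed.
Let n1 : n.+1%:R != 0 :> K. Proof. by rewrite pnatr_eq0. Qed.

Let sQ b : size (Q b) = m.+2.
Proof. exact: (size_critp _ (erefl m) (sP b) (mP b) k0). Qed.

Let QzE b z : (Q b).[z] = z ^+ m * (k%:R * z - k.+1%:R) - b * (n.+1%:R * z - n%:R).
Proof. by rewrite QE /A /B !hornerE. Qed.

(** The root of B. There [C] reduces to a nonzero constant, which shows that the determinant in
    [res_poly] is not identically zero. *)
Let z0 : K := n%:R / n.+1%:R.
Let z00 : z0 != 0. Proof. by rewrite mulf_neq0 ?invr_eq0. Qed.

Let Az0 : z0 ^+ m * (k%:R * z0 - k.+1%:R) != 0.
Proof.
rewrite mulf_neq0 ?expf_neq0 // subr_eq0 /z0 mulrA.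
apply/eqP => e; have : k%:R * n%:R = k.+1%:R * n.+1%:R :> K by rewrite -e divfK.
by move/eqP; rewrite -!natrM eqr_nat; nia.
Qed.

Let Broot b z : root (Q b) z -> n.+1%:R * z - n%:R != 0.
Proof.
move=> /eqP; rewrite QzE => Qz; apply/eqP => Bz.
have zE : z = z0 by rewrite /z0 -(subr0_eq Bz) mulrC mulKf.
by move: Az0; rewrite Bz mulr0 subr0 in Qz; rewrite -zE Qz eqxx.
Qed.

Let S j z : {poly K} := \poly_(i < j) (z ^+ (j.-1 - i)).

Let SE j z : (z%:P - 'X) * S j z = (z ^+ j)%:P - 'X^j.
Proof.
rewrite polyC_exp subrXX /S poly_def; congr (_ * _); apply: eq_bigr => i _.
rewrite -mul_polyC polyC_exp; congr (_ ^+ _ * _); lia.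
Qed.

Let sS j z : size (S j z) = j.
Proof.
case: j => [|j]; first by rewrite /S poly_def big_ord0 size_poly0.
by rewrite /S size_poly_eq //= subnn expr0 oner_neq0.
Qed.

Let bS j : bipoly (S j).
Proof.
apply: (@bipoly_ext _ (fun z => \sum_(i < j) (z ^+ (j.-1 - i))%:P * 'X^i)) => [z|].
  by rewrite /S poly_def; apply: eq_bigr => i _; rewrite mul_polyC.
apply: bipoly_sum => i; apply: bipolyM; last exact: bipoly_cst.
by apply: bipolyC; apply: polyfX; exact: polyf_id.
Qed.

(* The difference quotients (h z - h y) / (z - y) and                          *)
(* (z^(k+1) B y - y^(k+1) B z) / (z - y), as polynomials in y.                 *)
Let H z : {poly K} := k%:R%:P * S n.+1 z - k.+1%:R%:P * S n z.
Let C z : {poly K} := (n.+1%:R * z)%:P * 'X * S k z - n%:R%:P * S k.+1 z.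

Let sH z : size (H z) = n.+1.
Proof.
rewrite /H !mul_polyC size_polyDl size_scale ?sS // size_polyN.
by rewrite (leq_ltn_trans (size_scale_leq _ _)) ?sS.
Qed.

Let lH z : lead_coef (H z) = k%:R.
Proof.
rewrite lead_coefE sH /= /H coefB !coefCM !coef_poly ltnSn ltnn /= subnn.
by rewrite expr0 mulr1 mulr0 subr0.
Qed.

Let bH : bipoly H.
Proof.
apply: bipolyD; first by apply: bipolyM; [exact: bipoly_cst|exact: bS].
by apply: bipolyN; apply: bipolyM; [exact: bipoly_cst|exact: bS].
Qed.

Let bC : bipoly C.
Proof.
apply: bipolyD.
  apply: bipolyM; last exact: bS.
  apply: bipolyM; last exact: bipoly_cst.
  by apply: bipolyC; apply: polyfM; [exact: polyf_cst|exact: polyf_id].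
by apply: bipolyN; apply: bipolyM; [exact: bipoly_cst|exact: bS].
Qed.

Let HE z : (z%:P - 'X) * H z = h.[z]%:P - h.
Proof.
have -> : (z%:P - 'X) * H z = k%:R%:P * ((z%:P - 'X) * S n.+1 z)
    - k.+1%:R%:P * ((z%:P - 'X) * S n z) by rewrite /H; ring.
rewrite !SE /h hornerM hornerXn hornerD hornerN hornerM !hornerC hornerX.
rewrite !exprS !(polyCM, polyCB, polyC_exp).
by move: ('X^n) (z%:P ^+ n) => Y Z; ring.
Qed.

Let CE z : (z%:P - 'X) * C z = (z ^+ k.+1)%:P * B - 'X^(k.+1) * B.[z]%:P.
Proof.
have -> : (z%:P - 'X) * C z = (n.+1%:R * z)%:P * 'X * ((z%:P - 'X) * S k z)
    - n%:R%:P * ((z%:P - 'X) * S k.+1 z) by rewrite /C; ring.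
rewrite !SE /B hornerD hornerN hornerM !hornerC hornerX.
rewrite !exprS !(polyCM, polyCB, polyC_exp).
by move: ('X^k) (z%:P ^+ k) => Y Z; ring.
Qed.

Let Cz0 : C z0 = (- (n.+1%:R * z0 ^+ k.+1))%:P.
Proof.
have x0 : z0%:P - 'X != 0 by rewrite -opprB oppr_eq0 polyXsubC_eq0.
apply: (mulfI x0); rewrite CE.
have Bz : B.[z0] = 0 by rewrite /B hornerD hornerN hornerM !hornerC hornerX /z0 mulrC divfK // subrr.
have BE : B = n.+1%:R%:P * ('X - z0%:P).
  by rewrite /B mulrBr -polyCM /z0 [_ * (_ / _)]mulrC divfK.
by rewrite Bz polyC0 mulr0 subr0 BE polyCN polyCM; ring.
Qed.

Let res_poly : exists r : {poly K}, r != 0 /\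
  forall z, \det (hankel n (H z) (C z)) = r.[z].
Proof.
apply: (@polyf_ext0 _ (fun z => \det (hankel n (H z) (C z))) _ z0).
  apply: polyf_det => i j.
  apply: (@polyf_ext _ (fun z => rho (H z) (C z * 'X^i * 'X^j))) => [z|].
    by rewrite mxE.
  apply: (polyf_rho bH sH lH).
  by apply: bipolyM; [apply: bipolyM; [exact: bC|]|]; exact: bipoly_cst.
rewrite Cz0; apply: hankel_const; [exact: sH|exact: hn|].
by rewrite oppr_eq0 mulf_neq0 ?expf_neq0.
Qed.

(** A common root of A - b B and its derivative is a root of this Wronskian, whatever b is. *)
Let W : {poly K} := A^`() * B - A * B^`().

Let hornerBM (p q r t : {poly K}) x :
  (p * q - r * t).[x] = p.[x] * q.[x] - r.[x] * t.[x].
Proof. by rewrite hornerD hornerN !hornerM. Qed.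

Let hornerBCM b (p q : {poly K}) x : (p - b%:P * q).[x] = p.[x] - b * q.[x].
Proof. by rewrite hornerD hornerN hornerM hornerC. Qed.

Let hornerXM z (p : {poly K}) y : ((z%:P - 'X) * p).[y] = (z - y) * p.[y].
Proof. by rewrite hornerM hornerD hornerN hornerC hornerX. Qed.

Let WE z : W.[z] = A^`().[z] * B.[z] - A.[z] * B^`().[z].
Proof. exact: hornerBM. Qed.

Let W0 : W != 0.
Proof.
apply: contraTneq isT => W0; have := congr1 (horner^~ z0) W0.
have Bz : B.[z0] = 0 by rewrite /B hornerD hornerN hornerM !hornerC hornerX /z0 mulrC divfK // subrr.
have B' : B^`().[z0] = n.+1%:R.
  by rewrite /B derivB derivM !derivC derivX mul0r add0r mulr1 subr0 hornerC.
rewrite WE Bz B' mulr0 sub0r horner0 => /eqP.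
rewrite oppr_eq0 mulf_eq0 (negbTE n1) orbF.
have AE : z0 ^+ m * (k%:R * z0 - k.+1%:R) = A.[z0] by rewrite /A !hornerE.
by rewrite -AE (negbTE Az0).
Qed.

Lemma infinite_notin (s : seq K) : exists b, b \notin s.
Proof.
apply: contrapT => /forallNP H1.
have : \prod_(a <- s) ('X - a%:P) = 0 :> {poly K}.
  apply: poly_ext_horner => c; rewrite horner0; apply/eqP.
  have /negP := H1 c; rewrite negbK => cs.
  by rewrite -/(root _ _) root_prod_XsubC.
by apply/eqP; rewrite monic_neq0 // monic_prod_XsubC.
Qed.

(** A critical point z satisfies b = A(z)/B(z) and has critical value m z^(k+1)/B(z). If z and y are
    distinct critical points of equal value, y is a common root of [H z] and [C z], so z is a root
    of the nonzero polynomial r; a multiple critical point is a root of W. Thus finitely many b are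
    excluded, together with b = 0 and b = -1, for which 0, respectively 1, would be critical. *)
Lemma good_point : exists b, [/\ b != 0 &
  \det (cycmx m.+1 (Q b) (P b) d) != 0].
Proof.
have [r [r0 rE]] := res_poly.
have [rs rsE] := closed_field_poly_normal (W * r).
have Wr0 : W * r != 0 by exact: mulf_neq0 W0 r0.
have [b] := infinite_notin (0 :: -1 :: [seq A.[z] / B.[z] | z <- rs]).
rewrite !inE !negb_or => /and3P[b0 b1 bs]; exists b; split=> //.
have good z : root (Q b) z -> W.[z] != 0 /\ r.[z] != 0.
  move=> Qz; apply/andP; rewrite -negb_or -mulf_eq0 -hornerM -/(root _ z).
  apply: contra bs => Wz; apply/mapP; exists z.
    by move: Wz; rewrite rsE rootZ ?lead_coef_eq0 // root_prod_XsubC.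
  have Bz : B.[z] != 0 by rewrite /B !hornerE (Broot Qz).
  apply: (mulIf Bz); rewrite divfK //; move/eqP: Qz.
  by rewrite QE hornerBCM => /subr0_eq ->.
have [s sE] := closed_field_poly_normal (Q b).
have Q0 : Q b != 0 by rewrite -size_poly_gt0 sQ.
have us : uniq s.
  rewrite -separable.separable_prod_XsubC -(@separable.eqp_separable _ (Q b)); last first.
    by rewrite [X in X %= _]sE eqp_scale // lead_coef_eq0.
  rewrite separable.separable_poly.unlock.
  apply: Pdiv.ClosedField.root_coprimep => z Qz; apply/eqP => Q'z.
  have [/eqP Wz _] := good z Qz; apply: Wz.
  move/eqP: Qz; move: Q'z.
  have -> : (Q b)^`() = A^`() - b%:P * B^`().
    by rewrite QE derivB [(b%:P * B)^`()]derivM derivC mul0r add0r.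
  by rewrite QE !hornerBCM WE => /subr0_eq -> /subr0_eq ->; ring.
have ss : size s = m.+1.
  have := sQ b; rewrite sE size_scale ?lead_coef_eq0 // size_prod_XsubC.
  by move=> -[].
have rts : all (root (Q b)) s.
  by apply/allP => z zs; rewrite sE rootZ ?lead_coef_eq0 // root_prod_XsubC.
have zn0 z : root (Q b) z -> z != 0.
  move=> /eqP Qz; apply: contraNneq b0 => z0'; move: Qz.
  rewrite QzE z0' expr0n /= mul0r !mulr0 !sub0r mulrN opprK => /eqP.
  by rewrite mulf_eq0 (negbTE n0) orbF.
have zn1 z : root (Q b) z -> z - 1 != 0.
  move=> /eqP Qz; apply: contraNneq b1 => /subr0_eq z1; move: Qz.
  rewrite QzE z1 expr1n !mulr1 mul1r -[k.+1%:R]natr1 -[n.+1%:R]natr1.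
  move=> e; rewrite -subr_eq0 opprK -oppr_eq0 -e; apply/eqP; ring.
apply: (cycmx_distinct (sQ b) (ltn0Sn _) us ss rts) => [z zs|z y zs ys].
  have Qz := allP rts z zs.
  rewrite /d hornerM hornerXn hornerXsubC.
  by apply: mulf_neq0; [apply: expf_neq0; exact: zn0|exact: zn1].
have Qz := allP rts z zs; have Qy := allP rts y ys.
move=> lam_eq; apply: contrapT => /eqP zy.
have lE x : root (Q b) x ->
    (P b).[x] / d.[x] * (n.+1%:R * x - n%:R) = m%:R * x ^+ k.+1.
  move=> Qx; have x0 := zn0 x Qx; have x1 := zn1 x Qx.
  rewrite /P /d hornerD hornerM !hornerXn hornerC hornerXsubC.
  move/eqP: Qx; rewrite QzE => /subr0_eq Qx.
  have mE : m%:R = n%:R + k%:R + 1 :> K by rewrite -natrD natr1.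
  have xm : x ^+ m = x ^+ n * x ^+ k.+1 by rewrite -exprD /m addnS.
  have PB : (x ^+ m + b) * (n.+1%:R * x - n%:R) =
      x ^+ n * x ^+ k.+1 * (m%:R * (x - 1)).
    by rewrite mulrDl -Qx xm mE -[n.+1%:R]natr1 -[k.+1%:R]natr1; ring.
  rewrite mulrAC PB; have := expf_neq0 n x0.
  move: (x ^+ n) (x ^+ k.+1) => X1 X2 X10.
  by field; rewrite x1 X10.
have BE x : B.[x] = n.+1%:R * x - n%:R by rewrite /B !hornerE.
have m0 : m%:R != 0 :> K by rewrite pnatr_eq0.
have cross : z ^+ k.+1 * (n.+1%:R * y - n%:R) = y ^+ k.+1 * (n.+1%:R * z - n%:R).
  by apply: (mulfI m0); rewrite !mulrA -!lE // lam_eq; ring.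
have zy0 : z - y != 0 by rewrite subr_eq0.
have Cy : root (C z) y.
  have cM (c : K) (p : {poly K}) : (c%:P * p - 'X^(k.+1) * B.[z]%:P).[y] =
      c * p.[y] - y ^+ k.+1 * B.[z].
    by rewrite hornerBM !hornerC (hornerXn y k.+1).
  have := congr1 (horner^~ y) (CE z).
  rewrite /= hornerXM cM !BE cross subrr => /eqP.
  by rewrite mulf_eq0 (negbTE zy0).
have Hy : root (H z) y.
  have := congr1 (horner^~ y) (HE z).
  have hB (c : K) (p : {poly K}) : (c%:P - p).[y] = c - p.[y].
    by rewrite hornerD hornerN hornerC.
  rewrite /= hornerXM hB.
  have hE x : root (Q b) x -> h.[x] * x ^+ k.+1 = b * (n.+1%:R * x - n%:R).
    move=> /eqP; rewrite QzE => /subr0_eq <-.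
    by rewrite /h !hornerE /m -addnS exprD; ring.
  have yk : y ^+ k.+1 * z ^+ k.+1 != 0 by rewrite mulf_neq0 ?expf_neq0 ?zn0.
  have -> : h.[z] = h.[y].
    apply: (mulIf yk); rewrite mulrCA [RHS]mulrA !hE //.
    by rewrite mulrCA -cross; ring.
  by rewrite subrr => /eqP; rewrite mulf_eq0 (negbTE zy0).
have := (good z Qz).2; rewrite -rE (hankel_common_root (sH z) Hy Cy).
by rewrite eqxx.
Qed.

End GoodPoint.

(** * The product at points where the Euler field generates the algebra *)

Section CyclicMultiplication.
Context {R : realType} {l : nat}.
Variable k : nat.
Hypotheses (hk : (0 < k)%N) (hkl : (k < l)%N).
Let n := (l - k)%N.
Implicit Types (p q u v x y : 'rV[R[i]]_l.+2).

Definition den p : {poly R[i]} := 'X^(l - k) * ('X - (co p l.+1)%:P).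

(** Its nonvanishing says that lambda generates K[z]/(Q). It is polynomial along lines
    ([polyf_Vdet]) because the degree and leading coefficient of Q are constant. *)
Definition Vdet p : R[i] :=
  \det (cycmx l.+2 (lgQ k (Phi k p)) (lgP (Phi k p)) (den p)).

Section Lines.
Variables p g : 'rV[R[i]]_l.+2.
Let q t := t *: g + p.

Let polyf_co j : polyf (fun t => co (q t) j).
Proof.
apply: (@polyf_ext _ (fun t => t * co g j + co p j)) => [t|].
  by rewrite /q co_linear.
by apply: polyfD; [apply: polyfM; [exact: polyf_id|]|]; exact: polyf_cst.
Qed.

Let polyf_Y j : polyf (fun t => orbY (q t) j).
Proof. by rewrite /orbY; case: (j <= l)%N; [exact: polyf_co|exact: polyf_cst]. Qed.

Let polyf_coX j i : polyf (fun t => co (q t) j ^+ i).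
Proof. by apply: polyfX; exact: polyf_co. Qed.

Let polyf_Phi j : polyf (fun t => co (Phi k (q t)) j).
Proof.
rewrite /co; set i := inord j.-1.
apply: (@polyf_ext _ (fun t => if (i < l.+1)%N then (-1) ^+ i.+1 * (orbY (q t) i.+1 *
    (co (q t) l.+1 ^+ (i.+1 - k) * co (q t) l.+2 ^+ (i.+1 - k.+1)))
  else co (q t) l.+1)).
  by move=> t; rewrite /Phi mxE.
case: (i < l.+1)%N; last exact: polyf_co.
apply: polyfM; first exact: polyf_cst.
by apply: polyfM; [exact: polyf_Y|apply: polyfM; exact: polyf_coX].
Qed.

Let polyf_dPhi u j : polyf (fun t => co (dPhi k (q t) u) j).
Proof.
rewrite /co; set i := inord j.-1.
apply: (@polyf_ext _ (fun t => if (i < l.+1)%N then dphico k i.+1 (q t) u else co u l.+1)).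
  by move=> t; rewrite /dPhi mxE.
case: (i < l.+1)%N; last exact: polyf_cst.
rewrite /dphico; apply: polyfM; first exact: polyf_cst.
apply: polyfD; first by apply: polyfM; [exact: polyf_cst|apply: polyfM; exact: polyf_coX].
apply: polyfM; first exact: polyf_Y.
apply: polyfD.
  apply: polyfM; last exact: polyf_coX.
  apply: polyfM; last exact: polyf_cst.
  by apply: polyfM; [exact: polyf_cst|exact: polyf_coX].
apply: polyfM; first exact: polyf_coX.
apply: polyfM; last exact: polyf_cst.
by apply: polyfM; [exact: polyf_cst|exact: polyf_coX].
Qed.

Let bipoly_lgV (u : R[i] -> 'rV[R[i]]_l.+2) :
  (forall j, polyf (fun t => co (u t) j)) -> bipoly (fun t => lgV (u t)).
Proof.
move=> H; apply: (@bipoly_ext _ (fun t => \sum_(i < l.+1) (co (u t) (l.+1 - i))%:P * 'X^i)).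
  by move=> t; rewrite /lgV poly_def; apply: eq_bigr => i _; rewrite mul_polyC.
apply: bipoly_sum => i; apply: bipolyM; last exact: bipoly_cst.
by apply: bipolyC.
Qed.

Let bipoly_lgP : bipoly (fun t => lgP (Phi k (q t))).
Proof. by apply: bipolyD; [exact: bipoly_cst|apply: bipoly_lgV; exact: polyf_Phi]. Qed.

Let bipoly_Xw : bipoly (fun t => 'X - (co (q t) l.+1)%:P).
Proof.
by apply: bipolyD; [exact: bipoly_cst|apply: bipolyN; apply: bipolyC; exact: polyf_co].
Qed.

Let bipoly_den : bipoly (fun t => den (q t)).
Proof. by apply: bipolyM; [exact: bipoly_cst|exact: bipoly_Xw]. Qed.

Let bipoly_Rp u : bipoly (fun t => Rp k (q t) u).
Proof.
apply: (@bipoly_ext _ (fun t => lgV (dPhi k (q t) u) * ('X - (co (q t) l.+1)%:P)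
  + (co (dPhi k (q t) u) l.+2)%:P * lgP (Phi k (q t)))) => [t|].
  by rewrite /Rp /lgR co_Phi_last.
apply: bipolyD; apply: bipolyM; [|exact: bipoly_Xw| |exact: bipoly_lgP].
  by apply: bipoly_lgV; exact: polyf_dPhi.
by apply: bipolyC; exact: polyf_dPhi.
Qed.

Let bipoly_lgQ : bipoly (fun t => lgQ k (Phi k (q t))).
Proof.
apply: (@bipoly_ext _ (fun t => 'X * (lgP (Phi k (q t)))^`() * ('X - (co (q t) l.+1)%:P)
  + - (n%:R%:P * (lgP (Phi k (q t)) * ('X - (co (q t) l.+1)%:P)))
  + - ('X * lgP (Phi k (q t))))) => [t|].
  by rewrite /lgQ /critp co_Phi_last.
apply: bipolyD; [apply: bipolyD|apply: bipolyN].
- apply: bipolyM; last exact: bipoly_Xw.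
  by apply: bipolyM; [exact: bipoly_cst|apply: bipoly_deriv; exact: bipoly_lgP].
- apply: bipolyN; apply: bipolyM; first exact: bipoly_cst.
  by apply: bipolyM; [exact: bipoly_lgP|exact: bipoly_Xw].
by apply: bipolyM; [exact: bipoly_cst|exact: bipoly_lgP].
Qed.

Let rho_line G : bipoly G -> polyf (fun t => rho (lgQ k (Phi k (q t))) (G t)).
Proof.
move=> bG; apply: (polyf_rho (N := l.+2) (c := k%:R) bipoly_lgQ) => // t.
  exact: size_lgQ.
exact: lead_coef_lgQ.
Qed.

Lemma polyf_Vdet : polyf (fun t => Vdet (q t)).
Proof.
apply: polyf_det => i j.
apply: (@polyf_ext _ (fun t => rho (lgQ k (Phi k (q t)))
  (lgP (Phi k (q t)) ^+ i * den (q t) ^+ (l.+1 - i) * 'X^j))) => [t|].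
  by rewrite mxE.
apply: rho_line; apply: bipolyM; last exact: bipoly_cst.
by apply: bipolyM; apply: bipolyX; [exact: bipoly_lgP|exact: bipoly_den].
Qed.

Lemma polyf_rho_Rp u v j : polyf (fun t =>
  rho (lgQ k (Phi k (q t))) (Rp k (q t) u * Rp k (q t) v * 'X^j)).
Proof.
apply: rho_line; apply: bipolyM; last exact: bipoly_cst.
by apply: bipolyM; exact: bipoly_Rp.
Qed.

End Lines.

Lemma good_orbit_point : exists p, Vdet p != 0.
Proof.
have hn : (0 < n)%N by rewrite /n subn_gt0.
have [b [_ bV]] := good_point R[i] hn hk.
(* The constant term of the numerator is (-1)^(l+1) q1^(n+1) q2^n; with q1 = 1 this root makes it
   b. *)
pose q2 : R[i] := n.-root ((-1) ^+ l.+1 * b).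
pose p : 'rV[R[i]]_l.+2 := \row_i (if (i < l)%N then 0 else if i == l :> nat then 1 else q2).
have p1 : co p l.+1 = 1 by rewrite /co mxE inordK //= ltnn eqxx.
have p2 : co p l.+2 = q2.
  by rewrite /co mxE inordK //= ltnNge leqnSn /= (_ : (l.+1 == l) = false) //; lia.
have pj j : (0 < j <= l)%N -> co p j = 0.
  move=> hj; rewrite /co mxE inordK; last by lia.
  by rewrite (_ : (j.-1 < l)%N = true) //; lia.
have PE : lgP (Phi k p) = 'X^(l.+1) + b%:P.
  rewrite lgP_PhiE // big_nat_recl // big_mkord big_ord_recr /= big1 => [|j _].
    rewrite add0r p1 p2 /orbY ltnn !expr1n !mulr1 ?sub0n ?expr0 ?mulr1 subn0 polyC1 mul1r.
    rewrite subnn expr0 mulr1 subSS -/n /q2 rootCK // mulrA -exprMn.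
    by rewrite mulrNN mulr1 expr1n mul1r.
  have jl := ltn_ord j; rewrite /orbY jl pj ?mulr0 ?mul0r ?polyC0 ?mul0r //.
exists p; rewrite /Vdet /lgQ /den PE co_Phi_last p1 -/n.
have lE : l = (n + k)%N by rewrite /n subnK // ltnW.
by move: bV; rewrite -lE.
Qed.

Section WithF.
Variables (F : frob_data R l.+2) (HF : orbit_frobenius k F).
Let FF := orbit_frob HF.

Section AtPoint.
Variable p : 'rV[R[i]]_l.+2.
Hypotheses (pD : orbit_domain l k p) (pV : Vdet p != 0).
Let pO := orbit_domain_open_domain pD.
Let Q := lgQ k (Phi k p).
Let P := lgP (Phi k p).
Let d := den p.
Let U v := mult F p (euler F p) v.
Let s : {poly R[i]} := ((-1) ^+ k)%:P.

Let iterU_rel i v : Q %| d ^+ i * Rp k p (iter i U v) - (s * P) ^+ i * Rp k p v.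
Proof.
elim: i => [|i IH]; first by rewrite !expr0 subrr dvdp0.
have H : Q %| d * Rp k p (iter i.+1 U v) - s * P * Rp k p (iter i U v).
  exact: (mult_euler_rel hk hkl HF (iter i U v) pD).
set a := Rp k p (iter i.+1 U v) in H *; set b := Rp k p (iter i U v) in H IH.
have -> : d ^+ i.+1 * a - (s * P) ^+ i.+1 * Rp k p v =
    d ^+ i * (d * a - s * P * b) + (s * P) * (d ^+ i * b - (s * P) ^+ i * Rp k p v).
  by rewrite !exprS; move: (d ^+ i) ((s * P) ^+ i) => X1 X2; ring.
by rewrite dvdp_add // dvdp_mull.
Qed.

Let cyc (c : 'I_l.+2 -> R[i]) : {poly R[i]} :=
  \sum_i (c i)%:P * (d ^+ (l.+1 - i) * (s * P) ^+ i).

Let sum_iterU_rel (c : 'I_l.+2 -> R[i]) y :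
  Q %| d ^+ l.+1 * Rp k p (\sum_(i < l.+2) c i *: iter i U y)
  - cyc c * Rp k p y.
Proof.
rewrite Rp_sum mulr_sumr mulr_suml -sumrB.
apply: (big_ind (fun f => Q %| f)) => [||i _]; [exact: dvdp0|move=> a b; exact: dvdp_add|].
have -> : d ^+ l.+1 = d ^+ (l.+1 - i) * d ^+ i.
  by rewrite -exprD subnK // -ltnS.
have := iterU_rel i y; set a := Rp k p (iter i U y); set b := Rp k p y => H.
have -> : d ^+ (l.+1 - i) * d ^+ i * ((c i)%:P * a) -
    (c i)%:P * (d ^+ (l.+1 - i) * (s * P) ^+ i) * b =
    (c i)%:P * d ^+ (l.+1 - i) * (d ^+ i * a - (s * P) ^+ i * b).
  by move: (d ^+ (l.+1 - i)) (d ^+ i) ((s * P) ^+ i) => X1 X2 X3; ring.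
by rewrite dvdp_mull.
Qed.

Let d_coprime i : coprimep (d ^+ i) Q.
Proof.
case: i => [|i]; first by rewrite expr0 coprime1p.
by rewrite coprimep_pexpl //; exact: (coprime_den hk hkl pO).
Qed.

Let e := unitv F p.

Let eE : e = edir k.
Proof. by rewrite /e (orbit_unitE HF) // orbit_unit_edir. Qed.

Let Re_coprime : coprimep (Rp k p e) Q.
Proof.
rewrite eE Rp_edir // mul_polyC coprimepZl ?signr_eq0 //.
by have := lgQ_coprime hk hkl (lg_domain_Phi hk hkl pO) n 2; rewrite co_Phi_last.
Qed.

Let iterU_mult i v : iter i U v = mult F p (iter i U e) v.
Proof.
elim: i => [|i IH] /=; first by rewrite (frob_unitE FF).
by rewrite IH /U (frob_mult_assoc FF).
Qed.

(** The rows are the powers of the Euler field in the tangent algebra. *)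
Let A : 'M[R[i]]_l.+2 := \matrix_(i < l.+2) iter i U e.

Let mulA (c : 'rV[R[i]]_l.+2) : c *m A = \sum_(i < l.+2) c 0 i *: iter i U e.
Proof. by rewrite mulmx_sum_row; apply: eq_bigr => i _; rewrite rowK. Qed.

Let A_unit : A \in unitmx.
Proof.
apply: row_free_unitmx => u; rewrite mulA => u0.
have := sum_iterU_rel (u 0) e; rewrite u0.
have -> : Rp k p 0 = 0.
  by have := Rp_linear k p (-1) 0 0; rewrite scaler0 addr0 polyCN polyC1 mulN1r addNr.
rewrite mulr0 sub0r dvdpNr Gauss_dvdpl; last by rewrite coprimep_sym.
(* The signs from (s P)^i are absorbed into the coefficients of the relation. *)
move=> Qc; pose u' : 'rV[R[i]]_l.+2 := \row_i (u 0 i * ((-1) ^+ k) ^+ i).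
have uA : u' *m cycmx l.+2 Q P d = 0.
  apply/rowP => j; rewrite mul_cycmx mxE.
  have -> : 0 = rho Q 0 by apply/esym; exact: raddf0.
  apply: rho_mod; rewrite subr0 dvdp_mulr //.
  rewrite [X in Q %| X](_ : _ = cyc (u 0)) //; apply: eq_bigr => i _.
  rewrite mxE -mul_polyC polyCM polyC_exp [(s * P) ^+ _]exprMn -/s -[l.+2.-1]/l.+1.
  by move: (d ^+ (l.+1 - i)) (P ^+ i) (s ^+ i) => X1 X2 X3; ring.
have cu : cycmx l.+2 Q P d \in unitmx by rewrite unitmxE unitfE.
have u'0 : u' = 0 by rewrite -(mulmxK cu u') uA mul0mx.
apply/rowP => i; have := congr1 (fun M : 'rV[R[i]]_l.+2 => M 0 i) u'0.
rewrite !mxE => /eqP; rewrite mulf_eq0 expf_eq0 signr_eq0 andbF orbF.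
by move/eqP.
Qed.

(** Write x as a combination of powers of the Euler field. By associativity multiplication by x is
    the same polynomial in multiplication by the Euler field, hence acts on classes as one fixed
    polynomial in lambda; applying it to e and to v and eliminating it gives the relation. *)
Lemma mult_cyclic x v :
  Q %| Rp k p (edir k) * Rp k p (mult F p x v) - Rp k p x * Rp k p v.
Proof.
rewrite -eE; pose c := x *m invmx A.
have xE : x = \sum_(i < l.+2) c 0 i *: iter i U e by rewrite -mulA /c (mulmxKV A_unit).
have xvE : mult F p x v = \sum_(i < l.+2) c 0 i *: iter i U v.
  rewrite {1}xE; have lin (r : seq 'I_l.+2) :
    mult F p (\sum_(i <- r) c 0 i *: iter i U e) v = \sum_(i <- r) c 0 i *: iter i U v.
    elim: r => [|i r IH].
      rewrite !big_nil; have := frob_mult_lin FF (-1) 0 0 v pD.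
      by rewrite scaler0 addr0 scaleN1r addNr.
    by rewrite !big_cons (frob_mult_lin FF) // IH -iterU_mult.
  exact: lin.
have H1 := sum_iterU_rel (c 0) e; have H2 := sum_iterU_rel (c 0) v.
rewrite -xE in H1; rewrite -xvE in H2.
have : Q %| d ^+ l.+1 * (Rp k p e * Rp k p (mult F p x v) - Rp k p x * Rp k p v).
  set r := Rp k p _ in H1 H2 *; set rxv := Rp k p (mult F p x v) in H2 *.
  have -> : d ^+ l.+1 * (Rp k p e * rxv - Rp k p x * Rp k p v) =
    Rp k p e * (d ^+ l.+1 * rxv - cyc (c 0) * Rp k p v)
    - Rp k p v * (d ^+ l.+1 * Rp k p x - cyc (c 0) * Rp k p e).
    by move: (d ^+ _) => X1; ring.
  by rewrite dvdp_sub // dvdp_mull.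
by rewrite Gauss_dvdpr // coprimep_sym.
Qed.

End AtPoint.

End WithF.

End CyclicMultiplication.

(** * Extension of the product formula to the whole domain *)

Section Density.
Context {R : realType} {l : nat}.
Variable k : nat.
Hypotheses (hk : (0 < k)%N) (hkl : (k < l)%N).
Variables (F : frob_data R l.+2) (HF : orbit_frobenius k F).
Let FF := orbit_frob HF.
Implicit Types (p q u v x y : 'rV[R[i]]_l.+2).

Lemma polyf_continuous (f : R[i]^o -> R[i]^o) : polyf f -> continuous f.
Proof.
move=> [p pE]; have -> : f = horner p by apply/funext => t; rewrite pE.
exact: horner_continuous.
Qed.

Lemma near_horner_neq0 (p : {poly R[i]}) : p != 0 ->
  \forall t \near (0 : R[i]^o)^', p.[t] != 0.
Proof.
move=> p0; have [j [q [q0 qE]]] : exists j, exists q : {poly R[i]},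
    q.[0] != 0 /\ p = q * 'X^j.
  have [j [q qr qE]] := multiplicity_XsubC p 0.
  rewrite p0 /= in qr; exists j, q; split=> //.
  by rewrite qE polyC0 subr0.
have qn : \forall t \near (0 : R[i]^o), q.[t] != 0.
  have cq : (horner q : R[i]^o -> R[i]^o) @ (0 : R[i]^o) --> (q.[0] : R[i]^o).
    exact: horner_continuous.
  exact: (cvgr_neq0 _ cq q0).
have qn' := nbhs_dnbhs qn.
near=> t; rewrite qE hornerM hornerXn mulf_neq0 ?expf_neq0 //.
  by near: t.
by near: t; exact: nbhs_dnbhs_neq.
Unshelve. all: by end_near. Qed.

Lemma cvg_sumMB (I : Type) (r : seq I) (a b : I -> R[i]^o -> R[i]^o)
    (c : R[i]^o -> R[i]^o) :
  (forall i, a i @ (0 : R[i]^o) --> a i 0) ->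
  (forall i, b i @ (0 : R[i]^o) --> b i 0) -> c @ (0 : R[i]^o) --> c 0 ->
  (fun t : R[i]^o => \sum_(i <- r) a i t * b i t - c t : R[i]^o) @ (0 : R[i]^o)
  --> (\sum_(i <- r) a i 0 * b i 0 - c 0 : R[i]^o).
Proof.
move=> ca cb cc.
suff cS : (fun t : R[i]^o => \sum_(i <- r) a i t * b i t : R[i]^o) @ (0 : R[i]^o)
    --> (\sum_(i <- r) a i 0 * b i 0 : R[i]^o) by exact: (cvgB cS cc).
elim: r => [|i r IH].
  have -> : (fun t : R[i]^o => \sum_(i <- [::]) a i t * b i t : R[i]^o) = cst 0.
    by apply/funext => t; rewrite big_nil.
  by rewrite big_nil; exact: (@cst_continuous R[i]^o R[i]^o 0 0).
have -> : (fun t : R[i]^o => \sum_(i <- i :: r) a i t * b i t : R[i]^o) =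
    (a i * b i + (fun t : R[i]^o => \sum_(i <- r) a i t * b i t : R[i]^o)).
  by apply/funext => t; rewrite big_cons.
by rewrite big_cons; exact: (cvgD (cvgM (ca i) (cb i)) IH).
Qed.

(** On the line from p to a point where [Vdet] is nonzero, the relation holds for all small t other
    than 0. Its residues against the powers of X are continuous in t, so they vanish at t = 0, and
    [rho_nondeg] gives divisibility. *)
Lemma mult_Rp p x v : orbit_domain l k p -> lgQ k (Phi k p) %|
  Rp k p (edir k) * Rp k p (mult F p x v) - Rp k p x * Rp k p v.
Proof.
move=> pD; have [ps psV] := @good_orbit_point R l k hk hkl.
pose g := ps - p; pose q t := t *: g + p.
have q0 : q 0 = p by rewrite /q scale0r add0r.
have q1 : q 1 = ps by rewrite /q scale1r subrK.
have [Vp [Vp0 VpE]] : exists V : {poly R[i]}, V != 0 /\ forall t, Vdet k (q t) = V.[t].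
  by apply: (polyf_ext0 (polyf_Vdet hk hkl p g) (t0 := 1)); rewrite -/(q 1) q1.
apply: rho_nondeg; first by rewrite (size_lgQ hk hkl).
move=> j; rewrite (size_lgQ hk hkl) /= => jl.
pose f (t : R[i]^o) : R[i]^o := rho (lgQ k (Phi k (q t)))
  ((Rp k (q t) (edir k) * Rp k (q t) (mult F (q t) x v)
    - Rp k (q t) x * Rp k (q t) v) * 'X^j).
rewrite -[LHS]/(rho _ _) -{1 2 3 4 5 6}q0 -/(f 0).
pose a (i : 'I_l.+2) (t : R[i]^o) : R[i]^o := (mult F (q t) x v) 0 i.
pose b (i : 'I_l.+2) (t : R[i]^o) : R[i]^o := rho (lgQ k (Phi k (q t)))
  (Rp k (q t) (edir k) * Rp k (q t) (delta_mx 0 i) * 'X^j).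
pose c (t : R[i]^o) : R[i]^o := rho (lgQ k (Phi k (q t)))
  (Rp k (q t) x * Rp k (q t) v * 'X^j).
have fE : f = (fun t : R[i]^o =>
    \sum_(i <- index_enum 'I_l.+2) a i t * b i t - c t : R[i]^o).
  apply/funext => t; rewrite /f mulrBl rhoB; congr (_ - _).
  rewrite {1}(row_sum_delta (mult F (q t) x v)) Rp_sum mulr_sumr mulr_suml rho_sum.
  apply: eq_bigr => i _; rewrite /a /b -rhoCM.
  by move: ((mult F (q t) x v 0 i)%:P) (Rp _ _ _) (Rp _ _ _) => A B C; congr (rho _ _); ring.
have cq : {for (0 : R[i]), continuous (fun t : R[i] => q t)}.
  have H1 : {for (0 : R[i]), continuous (fun h : R[i] => h *: g)}.
    exact: scalel_continuous.
  have H2 : {for (0 : R[i]), continuous (fun h : R[i] => p)} by exact: cst_continuous.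
  exact: (continuousD H1 H2).
have ca i : a i @ (0 : R[i]^o) --> a i 0.
  have dm := frob_mult_holo FF x v pD.
  have cmp := differentiable_continuous dm; rewrite -q0 in cmp.
  have ci : continuous (fun N : 'rV[R[i]]_l.+2 => N 0 i : R[i]^o).
    by move=> N; apply: differentiable_continuous; exact: differentiable_coord.
  exact: (cvg_comp _ _ (cvg_comp _ _ cq cmp) (ci _)).
have cb i : b i @ (0 : R[i]^o) --> b i 0.
  apply: polyf_continuous.
  exact: (polyf_rho_Rp hk hkl p g (edir k) (delta_mx 0 i) j).
have cc : c @ (0 : R[i]^o) --> c 0.
  apply: polyf_continuous; exact: (polyf_rho_Rp hk hkl p g x v j).
have cf : f @ (0 : R[i]^o) --> (f 0 : R[i]^o).
  have H := @cvg_sumMB _ (index_enum 'I_l.+2) a b c ca cb cc.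
  have f0E := congr1 (fun h : R[i]^o -> R[i]^o => h 0) fE; rewrite /= in f0E.
  by rewrite f0E fE; exact: H.
have f0 : \forall t \near (0 : R[i]^o)^', f t = 0.
  have n1 := near_horner_neq0 Vp0.
  have n2 := nbhs_dnbhs (near_line g (frob_open FF) pD).
  near=> t.
  have tD : orbit_domain l k (q t) by near: t; exact: n2.
  have tV : Vdet k (q t) != 0 by rewrite VpE; near: t.
  rewrite /f; have <- : rho (lgQ k (Phi k (q t))) 0 = 0 by exact: raddf0.
  by apply: rho_mod; rewrite subr0 dvdp_mulr // (mult_cyclic hk hkl HF).
have c1 : f @ (0 : R[i]^o)^' --> (f 0 : R[i]^o).
  by apply: cvg_within_filter; exact: cf.
have c2 : f @ (0 : R[i]^o)^' --> (0 : R[i]^o).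
  have c0 : (fun=> 0 : R[i]^o) @ (0 : R[i]^o)^' --> (0 : R[i]^o).
    by apply: cvg_within_filter; exact: (@cst_continuous R[i]^o R[i]^o 0 0).
  apply: cvg_trans c0; apply: near_eq_cvg; near=> t; apply/esym; near: t.
  exact: f0.
exact: (norm_cvg_unique c1 c2).
Unshelve. all: by end_near. Qed.

End Density.

Section Preservation.
Context {R : realType} {l : nat}.
Variable k : nat.
Hypotheses (hk : (0 < k)%N) (hkl : (k < l)%N).
Variables (F : frob_data R l.+2) (HF : orbit_frobenius k F).
Implicit Types (p u v : 'rV[R[i]]_l.+2).

Lemma preserves_Phi p : orbit_domain l k p ->
  preserves_structure F (lg_frobenius R k l) (Phi k) p.
Proof.
move=> pD; have pO := orbit_domain_open_domain pD.
have aD := lg_domain_Phi hk hkl pO.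
have [I HI] := lgQ_inverse hk hkl aD (l - k).+1 2.
have [J HJ] := lgQ_inverse hk hkl aD (l - k) 2.
have s2 : ((-1) ^+ k)%:P * (-1) ^+ k = 1 :> {poly R[i]}.
  by rewrite polyC_exp polyCN polyC1 -exprMn mulrNN mulr1 expr1n.
have unit_mul u : lg_mult k (Phi k p) (dPhi k p (edir k)) u = u.
  apply: (lg_multE hk hkl aD HI HJ).
  have -> : lgR (Phi k p) (dPhi k p (edir k)) = Rp k p (edir k) by [].
  rewrite Rp_edir // co_Phi_last; set d := 'X^(l - k) * _; set r := lgR _ _.
  have -> : r * d - (-1) ^+ k * (((-1) ^+ k)%:P * d * r) =
      (1 - ((-1) ^+ k)%:P * (-1) ^+ k) * (r * d).
    by move: (_ ^+ k) => s; ring.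
  by rewrite s2 subrr mul0r dvdp0.
have lg_multC u v : lg_mult k (Phi k p) u v = lg_mult k (Phi k p) v u.
  have E : \row_j lg_c k (Phi k p) u v (delta_mx 0 j) =
      \row_j lg_c k (Phi k p) v u (delta_mx 0 j).
    apply/rowP => j; rewrite [LHS]mxE [RHS]mxE.
    apply: (etrans (lg_cE hk hkl aD HI HJ _ _ _)).
    apply: (etrans _ (esym (lg_cE hk hkl aD HI HJ _ _ _))).
    by move: (lgR _ u) (lgR _ v) => A B; rewrite [A * B]mulrC.
  exact: (congr1 (fun M : 'rV[R[i]]_l.+2 => M *m invmx (lg_metric k (Phi k p))) E).
split=> [u v|u v||]; rewrite ?diff_Phi.
- exact: (eta_Phi hk hkl HF).
- apply/esym/(lg_multE hk hkl aD HI HJ).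
  have := mult_Rp hk hkl HF u v pD; rewrite Rp_edir //.
  rewrite co_Phi_last -/(Rp k p (mult F p u v)) -/(Rp k p u) -/(Rp k p v).
  set d := 'X^(l - k) * _; set r := Rp _ _ (mult _ _ _ _) => H.
  have -> : r * d - (-1) ^+ k * (Rp k p u * Rp k p v) =
    (-1) ^+ k * (((-1) ^+ k)%:P * d * r - Rp k p u * Rp k p v)
    - (((-1) ^+ k)%:P * (-1) ^+ k - 1) * (r * d).
    move: (Rp k p u) (Rp k p v) => A B.
    move: ((-1) ^+ k : {poly R[i]}) => s; ring.
  by rewrite s2 subrr mul0r subr0 dvdp_mull.
- rewrite (orbit_unitE HF) // orbit_unit_edir //.
  (* [lg_unit] is a choice among units; by commutativity any unit e equals the image of the orbit
     unit. *)
  apply/esym/xget_unique => [u|e He]; first exact: unit_mul.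
  by rewrite -[LHS](unit_mul e) lg_multC He.
by rewrite (orbit_eulerE HF) // dPhi_euler.
Qed.

End Preservation.

(** * Invariance and surjectivity of the orbit coordinates *)

Section OrbitSurjectivity.
Context {R : realType} {l : nat}.
Variable k : nat.
Hypotheses (hk : (0 < k)%N) (hkl : (k < l)%N).
Let n := (l - k)%N.
Implicit Types (p q x : 'rV[R[i]]_l.+2).

Lemma lgP_coef (a : 'rV[R[i]]_l.+2) j : (0 < j <= l.+1)%N ->
  (lgP a)`_(l.+1 - j) = co a j.
Proof.
move=> hj; rewrite /lgP coefD coefXn coef_poly.
rewrite (_ : (l.+1 - j == l.+1)%N = false); last by lia.
rewrite (_ : (l.+1 - j < l.+1)%N); last by lia.
by rewrite add0r subKn //; lia.
Qed.

Lemma Phi_lgP_inj p q : co p l.+1 != 0 -> co p l.+2 != 0 ->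
  co p l.+1 = co q l.+1 -> co p l.+2 = co q l.+2 ->
  lgP (Phi k p) = lgP (Phi k q) -> p = q.
Proof.
move=> q1 q2 e1 e2 e; apply: co_eq => j hj.
have [jl|jl] := leqP j l; last by have [->|->] : j = l.+1 \/ j = l.+2 by lia.
have jb : (0 < j <= l.+1)%N by lia.
have := lgP_coef (Phi k q) jb; rewrite -e lgP_coef // !co_Phi // /phico -e1 -e2.
rewrite /orbY jl => /(mulfI _) /(mulIf _); apply.
  by rewrite mulf_neq0 ?expf_neq0.
by rewrite signr_eq0.
Qed.

Lemma cexp_int (z : int) : cexp (twopii * z%:~R) = 1 :> R[i].
Proof.
have c1 : cexp twopii = 1 :> R[i].
  have -> : twopii = 0 +i* (2 * pi) :> R[i].
    rewrite /twopii -[Num.imaginary]complexiE; simpc.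
    by rewrite ?mulr0 ?mul0r ?subr0 ?addr0 ?add0r ?mulr1.
  by rewrite /cexp /= expR0 [2 * pi]mulr_natl cos2pi sin2pi; simpc.
have cn (i : nat) : cexp (twopii * i%:R) = 1 :> R[i].
  by rewrite mulr_natr cexpMn c1 expr1n.
case: z => i; first exact: cn.
by rewrite NegzE mulrNz mulrN cexpN cn invr1.
Qed.

Lemma cexp_shift (a : R[i]) (z : int) :
  cexp (twopii * (a + z%:~R)) = cexp (twopii * a).
Proof. by rewrite mulrDr cexpD cexp_int mulr1. Qed.

(** The value of [ytilde] is recovered from q1, q2 and the polynomial with zeros exp(2 pi i X_s),
    none of which sees permutations of the X_s or integer shifts. *)
Lemma ytilde_periodic x x' (w : 'S_l.+1) (N : 'I_l.+1 -> int) (a b : int) :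
  (forall s, Xi k x' s = Xi k x (w s) + (N s)%:~R) ->
  co x' l.+1 = co x l.+1 + a%:~R -> co x' l.+2 = co x l.+2 + b%:~R ->
  ytilde k x' = ytilde k x.
Proof.
move=> XE ea eb; apply: Phi_lgP_inj.
- by rewrite co_ytilde_q ?cexp_neq0 //; lia.
- by rewrite co_ytilde_q ?cexp_neq0 //; lia.
- by rewrite !co_ytilde_q ?ea ?cexp_shift //; lia.
- by rewrite !co_ytilde_q ?eb ?cexp_shift //; lia.
rewrite !lgP_ytilde // [RHS](reindex_inj (@perm_inj _ w)) /=.
apply: eq_bigr => s _; congr ('X - _%:P).
by rewrite /zpt XE cexp_shift.
Qed.

(** The translation by omega_k with x_{l+1} lowered by 1 changes X_s by 0 for the first k indices
    and by -1 for the others, because k + (n+1) = l + 1; the translation by omega_{k+1} behaves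
    alike with k + 1 and n. *)
Lemma ytilde_gen x x' : Wtilde_gen k x x' -> ytilde k x' = ytilde k x.
Proof.
have nE : n%:R = l%:R - k%:R :> R[i] by rewrite natrB // ltnW.
have mE : l.+1%:R = l%:R + 1 :> R[i] by rewrite -natr1.
have l1 : l%:R + 1 != 0 :> R[i] by rewrite natr1.
case=> [w m ev e1 e2|ev e1 e2|ev e1 e2].
- apply: (@ytilde_periodic x x' w (fun s => \sum_(1 <= j < l.+1)
    (m j * ((j == s.+1)%:Z - (j == s)%:Z))%R) 0 0); rewrite ?addr0 // => s.
  rewrite /Xi e1 e2 ev !mxE -!addrA; congr (_ + _).
  rewrite addrC -!addrA; congr (_ + (_ + _)).
  rewrite summxE (raddf_sum (intr : int -> R[i])); apply: eq_big_nat => j hj.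
  rewrite mxE alphaE; last by lia.
  have iM (a b c : int) : (a * (b - c))%:~R = a%:~R * (b%:~R - c%:~R) :> R[i].
    by rewrite rmorphM rmorphB.
  exact: (esym (iM (m j) (j == s.+1)%:Z (j == s)%:Z)).
- apply: (@ytilde_periodic x x' 1%g (fun s => (s < k)%:Z - 1) (-1) 0);
    rewrite ?addr0 // => s.
  rewrite perm1 /Xi e1 e2 ev mxE (omegaE _ (ltnW hkl)) -/n rmorphB /=.
  by rewrite -[n.+1%:R]natr1 nE mE; field.
apply: (@ytilde_periodic x x' 1%g (fun s => (s < k.+1)%:Z - 1) 0 (-1));
  rewrite ?addr0 // => s.
rewrite perm1 /Xi e1 e2 ev mxE (omegaE _ hkl) -/n rmorphB /=.
by rewrite -[n.+1%:R]natr1 -[k.+1%:R]natr1 nE mE; field.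
Qed.

Lemma ytilde_orbit x x' : Wtilde_orbit k x x' -> ytilde k x' = ytilde k x.
Proof.
elim=> [y y' /ytilde_gen //|y //|y y' _ -> //|y y' y'' _ e1 _ e2].
by rewrite e2.
Qed.

Lemma cexp_twopii_surj (z : R[i]) : z != 0 -> exists a, cexp (twopii * a) = z.
Proof.
move=> z0; have [phi [_ _ <-]] := cexpi_surj z0.
have pi0 : 2 * pi%:C != 0 :> R[i].
  by rewrite mulf_neq0 ?pnatr_eq0 // eq_complex /= negb_and gt_eqF ?pi_gt0.
exists (phi / (2 * pi%:C)); congr cexp; rewrite /twopii.
by rewrite [2 * pi%:C * 'i]mulrC -mulrA [(2 * _) * _]mulrC divfK.
Qed.

Lemma vpart_surj (v : 'I_l.+1 -> R[i]) (a b : R[i]) : \sum_s v s = 0 ->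
  exists x, [/\ forall s, vpart x 0 s = v s, co x l.+1 = a & co x l.+2 = b].
Proof.
move=> v0; pose f (j : nat) : R[i] := \sum_(s < l.+1 | (s < j)%N) v s.
pose x : 'rV[R[i]]_l.+2 :=
  \row_i (if (i < l)%N then f i.+1 else if i == l :> nat then a else b).
exists x; split=> [s||].
- rewrite vpartE; transitivity (\sum_(1 <= j < l.+1) f j * alpha j 0 s).
    apply: eq_big_nat => j hj; rewrite /co mxE inordK; last by lia.
    have jE : (j.-1 < l)%N = true by lia.
    by rewrite jE prednK //; lia.
  rewrite (sum_alphaM hk hkl).
  + have -> : f s.+1 = v s + f s; last by rewrite addrK.
    rewrite /f (bigD1 s) ?ltnS //=; congr (_ + _); apply: eq_bigl => i.
    by rewrite ltnS [RHS]ltn_neqAle andbC -val_eqE.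
  + by rewrite /f big_pred0.
  by rewrite /f -[RHS]v0; apply: eq_bigl => i; rewrite ltn_ord.
- by rewrite /co mxE inordK //= ltnn eqxx.
by rewrite /co mxE inordK //= ltnNge leqnSn /= gtn_eqF.
Qed.

Lemma ytilde_surj p : co p l.+1 != 0 -> co p l.+2 != 0 ->
  exists x, ytilde k x = p.
Proof.
move=> q1 q2.
have [a1 a1E] := cexp_twopii_surj q1; have [a2 a2E] := cexp_twopii_surj q2.
have [rs rsE] := closed_field_poly_normal (lgP (Phi k p)).
rewrite (monicP (monic_lgP _)) scale1r in rsE.
have srs : size rs = l.+1.
  by have := size_lgP (Phi k p); rewrite rsE size_prod_XsubC => -[].
have P0 : (lgP (Phi k p)).[0] = (-1) ^+ l.+1 * (co p l.+1 ^+ n.+1 * co p l.+2 ^+ n).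
  exact: lgP_Phi_0.
have PE : lgP (Phi k p) = \prod_(s < l.+1) ('X - (rs`_s)%:P).
  by rewrite rsE (big_nth 0) srs big_mkord.
have prs : \prod_(s < l.+1) rs`_s = co p l.+1 ^+ n.+1 * co p l.+2 ^+ n.
  move: P0; rewrite PE horner_prod.
  under eq_bigr => s _ do rewrite hornerXsubC sub0r.
  rewrite prodrN card_ord => /(mulfI _); apply.
  by rewrite signr_eq0.
have rs0 (s : 'I_l.+1) : rs`_s != 0.
  have : \prod_(s < l.+1) rs`_s != 0 by rewrite prs mulf_neq0 ?expf_neq0.
  by move/prodf_neq0; apply.
have /choice[X XE] : forall s : 'I_l.+1, exists a, cexp (twopii * a) = rs`_s.
  by move=> s; exact: cexp_twopii_surj.
pose c := n.+1%:R / l.+1%:R * a1 + n%:R / l.+1%:R * a2.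
(* The logarithms of the zeros must sum to (l+1) c. All but the last are chosen freely and the last
   one corrects the sum; it is still a logarithm of its zero because the product of the zeros is
   known ([prs]). *)
pose Y (s : 'I_l.+1) := if s == ord_max then
  l.+1%:R * c - \sum_(t < l.+1 | t != ord_max) X t else X s.
have Ysum : \sum_s (Y s - c) = 0.
  have YX : \sum_(t < l.+1 | t != ord_max) Y t = \sum_(t < l.+1 | t != ord_max) X t.
    by apply: eq_bigr => t tm; rewrite /Y (negbTE tm).
  rewrite sumrB sumr_const card_ord -[c *+ _]mulr_natl (bigD1 ord_max) //= {1}/Y eqxx.
  by rewrite YX subrK subrr.
have YE s : cexp (twopii * Y s) = rs`_s.
  rewrite /Y; case: eqP => [->|_]; last exact: XE.
  have cS : cexp (twopii * \sum_(t < l.+1 | t != ord_max) X t) =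
      \prod_(t < l.+1 | t != ord_max) rs`_t.
    rewrite mulr_sumr -big_filter cexp_sum big_filter.
    by apply: eq_bigr => t _; exact: XE.
  rewrite mulrBr cexpD cexpN cS.
  have -> : cexp (twopii * (l.+1%:R * c)) = co p l.+1 ^+ n.+1 * co p l.+2 ^+ n.
    have cX (z : R[i]) i : cexp z ^+ i = cexp (i%:R * z) by rewrite mulr_natl cexpMn.
    rewrite -a1E -a2E !cX -cexpD; congr cexp.
    have l1 : l.+1%:R != 0 :> R[i] by rewrite pnatr_eq0.
    by rewrite /c; field.
  rewrite -prs (bigD1 ord_max) //= mulfK //.
  by apply/prodf_neq0 => t _; exact: rs0.
have [x [xv x1 x2]] := vpart_surj a1 a2 Ysum.
exists x; apply: Phi_lgP_inj.
- by rewrite co_ytilde_q ?cexp_neq0 //; lia.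
- by rewrite co_ytilde_q ?cexp_neq0 //; lia.
- by rewrite co_ytilde_q ?x1 //; lia.
- by rewrite co_ytilde_q ?x2 //; lia.
rewrite lgP_ytilde // PE; apply: eq_bigr => s _; congr ('X - _%:P).
by rewrite /zpt /Xi xv x1 x2 -YE; congr cexp; rewrite /c -/n; ring.
Qed.

(** Constancy of [ytilde] on orbits and its surjectivity reduce membership in the orbit space to the
    nonvanishing of the last two coordinates. *)
Lemma orbit_domainE p : orbit_domain l k p <-> orbit_open_domain k p.
Proof.
split; first exact: orbit_domain_open_domain.
case=> q1 q2 t0; split=> //; split=> //.
have [x xp] := ytilde_surj q1 q2; exists x; apply/seteqP; split=> [_ [y xy <-]|_ ->].
  by rewrite /= (ytilde_orbit xy).
by exists x => //; exact: Relation_Operators.rst_refl.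
Qed.

End OrbitSurjectivity.

(** * Local biholomorphy *)

Section LocalRoot.
Context {R : realType}.
Variable n : nat.
Hypothesis n0 : (0 < n)%N.
Implicit Types (z y w : R[i]).

(** The difference quotient of z^n. Its nonvanishing on O x O makes the power map injective on O,
    and on the diagonal it is the derivative. *)
Definition powsum z y : R[i] := \sum_(i < n) z ^+ (n.-1 - i) * y ^+ i.

Lemma powsumE z y : z ^+ n - y ^+ n = (z - y) * powsum z y.
Proof. exact: subrXX. Qed.

Lemma powsum_diag z : powsum z z = n%:R * z ^+ n.-1.
Proof.
rewrite /powsum (eq_bigr (fun=> z ^+ n.-1)) => [|i _].
  by rewrite sumr_const card_ord mulr_natl.
by rewrite -exprD subnK //; have := ltn_ord i; lia.
Qed.

Lemma cvg_powsum (T : Type) (F : set_system T) (FF : Filter F)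
    (a b : T -> R[i]^o) (a0 b0 : R[i]^o) :
  a @ F --> a0 -> b @ F --> b0 ->
  (fun t => powsum (a t) (b t) : R[i]^o) @ F --> (powsum a0 b0 : R[i]^o).
Proof.
move=> ca cb; rewrite /powsum.
have cX (c : T -> R[i]^o) (c0 : R[i]^o) j : c @ F --> c0 ->
    (fun t => c t ^+ j : R[i]^o) @ F --> (c0 ^+ j : R[i]^o).
  move=> cc; have := cvg_comp _ _ cc (@horner_continuous _ 'X^j c0).
  rewrite /= (hornerXn c0 j).
  have -> : (horner 'X^j : R[i]^o -> R[i]^o) \o c = (fun t => c t ^+ j : R[i]^o).
    by apply/funext => t; rewrite /= hornerXn.
  by [].
suff gen (r : seq 'I_n) :
  (fun t => \sum_(i <- r) a t ^+ (n.-1 - i) * b t ^+ i : R[i]^o) @ F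
  --> (\sum_(i <- r) a0 ^+ (n.-1 - i) * b0 ^+ i : R[i]^o) by exact: gen.
elim: r => [|i r IH].
  have -> : (fun t => \sum_(i <- @nil 'I_n) a t ^+ (n.-1 - i) * b t ^+ i : R[i]^o) =
      (fun=> 0 : R[i]^o) by apply/funext => t; rewrite big_nil.
  by rewrite big_nil; exact: (@cvg_cst _ (0 : R[i]^o) _ F FF).
have -> : (fun t => \sum_(i <- i :: r) a t ^+ (n.-1 - i) * b t ^+ i : R[i]^o) =
    ((fun t => a t ^+ (n.-1 - i) : R[i]^o) * (fun t => b t ^+ i : R[i]^o)
     + (fun t => \sum_(i <- r) a t ^+ (n.-1 - i) * b t ^+ i : R[i]^o)).
  by apply/funext => t; rewrite big_cons.
by rewrite big_cons; exact: (cvgD (cvgM (cX a a0 _ ca) (cX b b0 _ cb)) IH).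
Qed.

Lemma powsum_near (c0 : R[i]) : c0 != 0 -> exists O : set R[i]^o,
  [/\ open O, O c0 & forall z y, O z -> O y -> powsum z y != 0].
Proof.
move=> c00.
pose F := filter_prod (nbhs (c0 : R[i]^o)) (nbhs (c0 : R[i]^o)).
have FF : Filter F by exact: filter_prod_filter.
have c1 : fst @ F --> (c0 : R[i]^o) by exact: cvg_fst.
have c2 : snd @ F --> (c0 : R[i]^o) by exact: cvg_snd.
have c := cvg_powsum FF c1 c2.
have d0 : powsum c0 c0 != 0.
  by rewrite powsum_diag mulf_neq0 ?expf_neq0 // pnatr_eq0 -lt0n.
have [[A B] [/= cA cB] AB] := cvgr_neq0 _ c d0.
exists (interior (A `&` B)); split.
- exact: open_interior.
- exact: (filterI cA cB).
move=> z y /interior_subset[Az _] /interior_subset[_ By].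
exact: (AB (z, y)).
Qed.

(** The distances from z to the n roots of w, counted with multiplicity, have product |z^n - w|, so
    they cannot all be at least e. *)
Lemma near_root z w (e : R[i]) : 0 < e -> `|z ^+ n - w| < e ^+ n ->
  exists y, y ^+ n = w /\ `|z - y| < e.
Proof.
move=> e0 H; pose p : {poly R[i]} := 'X^n - w%:P.
have [rs rsE] := closed_field_poly_normal p.
have lp : lead_coef p = 1 by rewrite lead_coefXnsubC.
have sp : size p = n.+1 by rewrite size_XnsubC.
rewrite lp scale1r in rsE.
have srs : size rs = n by move: sp; rewrite rsE size_prod_XsubC => -[].
apply: contrapT => /forallNP N.
have far y : y \in rs -> e <= `|z - y|.
  move=> yrs; have yw : y ^+ n = w.
    have : root p y by rewrite rsE root_prod_XsubC.
    by rewrite /root /p hornerD hornerN hornerXn hornerC subr_eq0 => /eqP.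
  have er : e \is Num.real := gtr0_real e0.
  have nr : `|z - y| \is Num.real := normr_real _.
  rewrite (real_leNgt er nr); apply/negP => lt.
  by case: (N y).
have pz : z ^+ n - w = \prod_(y <- rs) (z - y).
  have : p.[z] = z ^+ n - w by rewrite /p hornerD hornerN hornerXn hornerC.
  move=> <-; rewrite rsE horner_prod; apply: eq_bigr => y _.
  by rewrite hornerXsubC.
have : e ^+ size rs <= `|\prod_(y <- rs) (z - y)|.
  elim: rs far {rsE srs pz} => [|y rs IH] far.
    by rewrite big_nil normr1.
  rewrite big_cons normrM exprS; apply: ler_pM; rewrite ?exprn_ge0 ?(ltW e0) //.
    by apply: far; rewrite mem_head.
  by apply: IH => y' yr; apply: far; rewrite in_cons yr orbT.
rewrite srs -pz => H2; have := lt_le_trans H H2; by rewrite ltxx.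
Qed.

Variable O : set R[i]^o.
Hypotheses (oO : open O) (OS : forall z y, O z -> O y -> powsum z y != 0).

Definition lroot w : R[i] := xget 0 [set z | O z /\ z ^+ n = w].
Definition lpow : set R[i]^o := [set w | exists2 z, O z & z ^+ n = w].

Lemma lroot_pow z : O z -> lroot (z ^+ n) = z.
Proof.
move=> Oz; apply: xget_unique => [//|y [Oy yz]].
have : (z - y) * powsum z y = 0 by rewrite -powsumE yz subrr.
by move/eqP; rewrite mulf_eq0 (negbTE (OS Oz Oy)) orbF subr_eq0 => /eqP.
Qed.

Lemma lpowP w : lpow w -> O (lroot w) /\ lroot w ^+ n = w.
Proof. by case=> z Oz <-; rewrite lroot_pow. Qed.

Lemma near_lroot z (A : set R[i]^o) : O z -> nbhs (z : R[i]^o) A ->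
  \forall w \near (z ^+ n : R[i]^o), lpow w /\ A (lroot w).
Proof.
move=> Oz Az; have AO : nbhs (z : R[i]^o) (A `&` O).
  by apply: filterI => //; exact: open_nbhs_nbhs.
have /nbhs_ballP[e e0 eAO] := AO.
have en0 : 0 < e ^+ n by rewrite exprn_gt0.
have : nbhs (z ^+ n : R[i]^o) (ball (z ^+ n : R[i]^o) (e ^+ n)).
  exact: nbhsx_ballx.
apply: filterS => w; rewrite -ball_normE /= => zw.
have [y [yw zy]] := near_root e0 zw.
have [Ay Oy] : (A `&` O) y by apply: eAO; rewrite -ball_normE.
by split; [exists y|rewrite -yw lroot_pow].
Qed.

Lemma open_lpow : open lpow.
Proof.
rewrite openE => _ [z Oz <-].
have zT : nbhs (z : R[i]^o) setT by exact: filterT.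
have := near_lroot Oz zT.
by apply: filterS => w [].
Qed.

Lemma lroot_continuous w : lpow w -> (lroot : R[i]^o -> R[i]^o) @ (w : R[i]^o)
  --> (lroot w : R[i]^o).
Proof.
move=> [z Oz <-] A; rewrite lroot_pow // => zA.
have := near_lroot Oz zA; apply: filterS => w' [] //.
Qed.

Lemma lroot_differentiable w : lpow w ->
  differentiable (lroot : R[i]^o -> R[i]^o) (w : R[i]^o).
Proof.
move=> wP; have [Oz zw] := lpowP wP; set z := lroot w in Oz zw.
apply/derivable1_diffP; apply/cvg_ex; exists ((powsum z z)^-1 : R[i]^o).
have c1 : (fun h : R[i]^o => (powsum (lroot (h + w)) z)^-1 : R[i]^o) @ (0 : R[i]^o)^'
    --> ((powsum z z)^-1 : R[i]^o).
  apply: cvgV; first exact: OS.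
  apply: cvg_powsum; last first.
    by apply: cvg_within_filter; exact: (@cst_continuous R[i]^o R[i]^o z 0).
  apply: cvg_within_filter.
  have ch : (fun h : R[i]^o => h + w : R[i]^o) @ (0 : R[i]^o) --> (0 + w : R[i]^o).
    have i1 : (fun h : R[i]^o => h) @ (0 : R[i]^o) --> (0 : R[i]^o) by exact: cvg_id.
    exact: (cvgD i1 (@cst_continuous R[i]^o R[i]^o w 0)).
  rewrite add0r in ch; exact: (cvg_comp _ _ ch (lroot_continuous wP)).
apply: cvg_trans c1; apply: near_eq_cvg.
have nP : \forall h \near (0 : R[i]^o), lpow (h + w).
  have ch : (fun h : R[i]^o => h + w : R[i]^o) @ (0 : R[i]^o) --> (0 + w : R[i]^o).
    have i1 : (fun h : R[i]^o => h) @ (0 : R[i]^o) --> (0 : R[i]^o) by exact: cvg_id.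
    exact: (cvgD i1 (@cst_continuous R[i]^o R[i]^o w 0)).
  rewrite add0r in ch; apply: ch; apply: open_nbhs_nbhs; split=> //.
  exact: open_lpow.
have nP' := nbhs_dnbhs nP.
near=> h.
have h0 : h != 0 by near: h; exact: nbhs_dnbhs_neq.
have hP : lpow (h + w) by near: h.
have [Oy yw] := lpowP hP.
suff : (powsum (lroot (h + w)) z)^-1 = h^-1 * (lroot (h + w) - lroot w).
  by move=> ->; rewrite /GRing.scale /= mulr1.
rewrite -/z.
set y := lroot (h + w) in Oy yw *.
have hE : h = (y - z) * powsum y z by rewrite -powsumE yw zw addrK.
have yz : y - z != 0 by apply: contraNneq h0 => e; rewrite hE e mul0r.
have S0 := OS Oy Oz.
by rewrite {1}hE invfM mulrAC mulVf // mul1r.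
Unshelve. all: by end_near. Qed.

End LocalRoot.

Section Biholomorphism.
Context {R : realType} {l : nat}.
Variable k : nat.
Hypotheses (hk : (0 < k)%N) (hkl : (k < l)%N).
Let n := (l - k)%N.
Let n0 : (0 < n)%N. Proof. by rewrite /n subn_gt0. Qed.
Implicit Types (p q a : 'rV[R[i]]_l.+2).

(** The value of q2^n forced by the constant term a_{l+1} = (-1)^(l+1) w^(n+1) q2^n. Once a root s
    is chosen, [PsiR] solves for the remaining coordinates rationally. *)
Definition powq2 a : R[i]^o := (-1) ^+ l.+1 * co a l.+1 / co a l.+2 ^+ n.+1.

Definition PsiR a (s : R[i]) : 'rV[R[i]]_l.+2 := \row_i
  (if (i < l)%N then (-1) ^+ i.+1 * co a i.+1
                     / (co a l.+2 ^+ (i.+1 - k) * s ^+ (i.+1 - k.+1))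
   else if i == l :> nat then co a l.+2 else s).

Lemma co_PsiR a s j : (0 < j <= l)%N -> co (PsiR a s) j =
  (-1) ^+ j * co a j / (co a l.+2 ^+ (j - k) * s ^+ (j - k.+1)).
Proof.
move=> hj; rewrite {1}/co mxE inordK; last by lia.
have -> : (j.-1 < l)%N = true by lia.
by rewrite prednK //; lia.
Qed.

Lemma co_PsiR1 a s : co (PsiR a s) l.+1 = co a l.+2.
Proof. by rewrite {1}/co mxE inordK //= ltnn eqxx. Qed.

Lemma co_PsiR2 a s : co (PsiR a s) l.+2 = s.
Proof. by rewrite {1}/co mxE inordK //= ltnNge leqnSn /= gtn_eqF. Qed.

Let sgn_sq (j : nat) : (-1) ^+ j * (-1) ^+ j = 1 :> R[i].
Proof. by rewrite -exprMn mulrNN mulr1 expr1n. Qed.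

Lemma Phi_PsiR a (s : R[i]) : co a l.+2 != 0 -> s != 0 -> s ^+ n = powq2 a ->
  Phi k (PsiR a s) = a.
Proof.
move=> w0 s0 sE; apply: co_eq => j hj; have [jl|jl] := leqP j l.+1; last first.
  have -> : j = l.+2 by lia.
  by rewrite co_Phi_last co_PsiR1.
rewrite co_Phi; last by lia.
rewrite /phico co_PsiR1 co_PsiR2 /orbY; case: (leqP j l) => jl1.
  rewrite co_PsiR; last by lia.
  set d := _ * s ^+ _; have d0 : d != 0 by rewrite mulf_neq0 ?expf_neq0.
  by rewrite divfK // mulrA sgn_sq mul1r.
have -> : j = l.+1 by lia.
rewrite mul1r subSS -/n sE (_ : (l.+1 - k)%N = n.+1); last by rewrite /n; lia.
have gen (e c u : R[i]) : c != 0 -> e * e = 1 -> e * (c * (e * u / c)) = u.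
  move=> c0 ee; transitivity (e * e * u); first by field.
  by rewrite ee mul1r.
by rewrite /powq2; apply: gen; [rewrite expf_neq0|exact: sgn_sq].
Qed.

Lemma powq2_Phi q : co q l.+1 != 0 -> powq2 (Phi k q) = co q l.+2 ^+ n.
Proof.
move=> q1; rewrite /powq2 co_Phi ?co_Phi_last; last by lia.
rewrite /phico /orbY ltnn mul1r mulrA sgn_sq mul1r.
rewrite subSS -/n (_ : (l.+1 - k)%N = n.+1); last by rewrite /n; lia.
by rewrite mulrAC divff ?expf_neq0 // mul1r.
Qed.

Lemma PsiR_Phi q : co q l.+1 != 0 -> co q l.+2 != 0 ->
  PsiR (Phi k q) (co q l.+2) = q.
Proof.
move=> q1 q2; apply: co_eq => j hj; have [jl|jl] := leqP j l; last first.
  have jE : j = l.+1 \/ j = l.+2 by lia.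
  by case: jE => ->; rewrite ?co_PsiR1 ?co_PsiR2 ?co_Phi_last.
rewrite co_PsiR; last by lia.
rewrite !co_Phi_last co_Phi; last by lia.
rewrite /phico /orbY jl; set d := _ * _ ^+ (j - k.+1).
have d0 : d != 0 by rewrite mulf_neq0 ?expf_neq0.
by rewrite [_ * ((-1) ^+ j * _)]mulrA sgn_sq mul1r mulfK.
Qed.

Lemma PsiR_domain a (s : R[i]) : lg_domain k l a -> s ^+ n = powq2 a ->
  orbit_domain l k (PsiR a s) /\ Phi k (PsiR a s) = a.
Proof.
move=> aD sE; have [P0 w0 Pw] := (lg_domain_polyE hk hkl a).1 aD.
have s0 : s != 0.
  apply: contraNneq P0 => s0; rewrite lgP0; move/esym/eqP: sE.
  rewrite s0 expr0n gtn_eqF // /powq2 !mulf_eq0 signr_eq0 invr_eq0 expf_eq0.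
  by rewrite (negbTE w0) andbF orbF.
have E := Phi_PsiR w0 s0 sE; split=> //; apply/(orbit_domainE hk hkl).
split; rewrite ?co_PsiR1 ?co_PsiR2 //.
have := lgP_Phi_q1 hk hkl (PsiR a s); rewrite E co_PsiR1 => e.
by apply: contraNneq Pw => t0; rewrite e t0 mulr0.
Qed.

Lemma Phi_image : Phi k @` (@orbit_domain R l k) = lg_domain k l.
Proof.
apply/seteqP; split=> [_ [p pD <-]|a aD].
  exact: (lg_domain_Phi hk hkl (orbit_domain_open_domain pD)).
have sE : (n.-root (powq2 a : R[i])) ^+ n = powq2 a by rewrite rootCK.
by have [D E] := PsiR_domain aD sE; exists (PsiR a (n.-root (powq2 a : R[i]))).
Qed.

Lemma differentiable_powq2 a : co a l.+2 != 0 -> differentiable powq2 a.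
Proof.
move=> w0; have dw := differentiable_expK n.+1 (@differentiable_co R l l.+2 a).
have d1 := differentiableM (differentiable_cst ((-1) ^+ l.+1 : R[i]^o) a)
  (@differentiable_co R l l.+1 a).
by apply: (differentiableM d1); apply: differentiableV; rewrite ?expf_neq0.
Qed.

Lemma near_lg_domain a : lg_domain k l a -> \forall b \near a, lg_domain k l b.
Proof.
move=> aD; have [P0 w0 Pw] := (lg_domain_polyE hk hkl a).1 aD.
have c0 := differentiable_continuous (differentiable_lgP a 0).
have cw := differentiable_continuous (@differentiable_co R l l.+2 a).
have dPw : differentiable (fun b : 'rV[R[i]]_l.+2 => (lgP b).[co b l.+2] : R[i]^o) a.
  have -> : (fun b : 'rV[R[i]]_l.+2 => (lgP b).[co b l.+2] : R[i]^o) =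
    (fun b : 'rV[R[i]]_l.+2 => co b l.+2 ^+ l.+1
      + \sum_(i < l.+1) co b (l.+1 - i) * co b l.+2 ^+ i : R[i]^o).
    by apply/funext => b; rewrite /lgP hornerD hornerXn horner_poly.
  apply: differentiableD; first by apply: differentiable_expK; exact: differentiable_co.
  apply: differentiable_sumK => j; apply: differentiableM.
    exact: differentiable_co.
  by apply: differentiable_expK; exact: differentiable_co.
have cPw := differentiable_continuous dPw.
have n1 := cvgr_neq0 _ c0 P0; have n2 := cvgr_neq0 _ cw w0.
have n3 := cvgr_neq0 _ cPw Pw.
near=> b; apply/(lg_domain_polyE hk hkl); split; near: b.
- exact: n1.
- exact: n2.
exact: n3.
Unshelve. all: by end_near. Qed.

(** Near p the coordinate q2 is confined to an open set B where the n-th power map is injective; the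
    inverse of [Phi] uses the branch of the n-th root with values in B, and the image is open
    because the powers of B form an open set. *)
Lemma local_biholomorphism_Phi : open (@orbit_domain R l k) ->
  local_biholomorphism (@orbit_domain R l k) (Phi k).
Proof.
move=> oD p pD; have [p1 p2 _] := orbit_domain_open_domain pD.
have [B [oB Bp BS]] := powsum_near n0 p2.
pose r := lroot n B; pose Psi a := PsiR a (r (powq2 a)).
pose U := [set q | orbit_domain l k q /\ B (co q l.+2)].
have rE q : U q -> r (powq2 (Phi k q)) = co q l.+2.
  case=> qD Oq; have [q1 _ _] := orbit_domain_open_domain qD.
  by rewrite powq2_Phi // /r (lroot_pow BS).
have imE : Phi k @` U = [set a | lg_domain k l a /\ lpow n B (powq2 a)].
  apply/seteqP; split=> [_ [q [qD Oq] <-]|a [aD /(lpowP BS)[Or rn]]].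
    have qO := orbit_domain_open_domain qD; have [q1 _ _] := qO.
    split; first exact: (lg_domain_Phi hk hkl qO).
    by rewrite powq2_Phi //; exists (co q l.+2).
  have [D E] := PsiR_domain aD rn; exists (Psi a) => //.
  by split=> //; rewrite /Psi co_PsiR2.
exists U, Psi; split.
- rewrite openE => q [qD Oq]; apply: filterI.
    exact: open_nbhs_nbhs.
  have c := differentiable_continuous (@differentiable_co R l l.+2 q).
  by apply: c; exact: open_nbhs_nbhs.
- by [].
- by move=> q [].
- rewrite imE openE => a [aD aP]; apply: filterI; first exact: near_lg_domain.
  have [_ w0 _] := (lg_domain_polyE hk hkl a).1 aD.
  have c := differentiable_continuous (differentiable_powq2 w0).
  by apply: c; apply: open_nbhs_nbhs; split=> //; exact: (open_lpow n0 oB BS).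
split.
- by move=> q _; exact: differentiable_Phi.
- rewrite imE => a [aD aP]; have [_ w0 _] := (lg_domain_polyE hk hkl a).1 aD.
  have [D _] := PsiR_domain aD (lpowP BS aP).2.
  have [_ r0 _] := orbit_domain_open_domain D; rewrite co_PsiR2 in r0.
  have dr : differentiable (fun b => r (powq2 b) : R[i]^o) a.
    exact: (differentiable_comp (differentiable_powq2 w0)
      (lroot_differentiable n0 oB BS aP)).
  apply: differentiable_row => i.
  have -> : (fun b => Psi b 0 i : R[i]^o) = if (i < l)%N then
      (fun b => (-1) ^+ i.+1 * co b i.+1
         / (co b l.+2 ^+ (i.+1 - k) * r (powq2 b) ^+ (i.+1 - k.+1)) : R[i]^o)
    else if i == l :> nat then (fun b => co b l.+2 : R[i]^o)
    else (fun b => r (powq2 b) : R[i]^o).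
    apply/funext => b; rewrite mxE; case: (i < l)%N => //.
    by case: (i == l :> nat).
  case: (i < l)%N; last by case: (i == l :> nat) => //; exact: differentiable_co.
  have dw := differentiable_expK (i.+1 - k) (@differentiable_co R l l.+2 a).
  have dd := differentiableM dw (differentiable_expK (i.+1 - k.+1) dr).
  have d1 := differentiableM (differentiable_cst ((-1) ^+ i.+1 : R[i]^o) a)
    (@differentiable_co R l i.+1 a).
  apply: (differentiableM d1); apply: differentiableV; first exact: dd.
  by apply: mulf_neq0; rewrite expf_neq0.
move=> q qU; have [qD _] := qU; have [q1 q2 _] := orbit_domain_open_domain qD.
by rewrite /Psi rE // PsiR_Phi.
Qed.

End Biholomorphism.

Theorem theorem2 (R : realType) (k l : nat) (hk : (1 <= k)%N) (hkl : (k < l)%N)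
    (F : frob_data R l.+2) (HF : orbit_frobenius k F) :
  locally_isomorphic (orbit_domain l k) F
                     (lg_domain k l) (lg_frobenius R k l).
Proof.
exists (Phi k); split.
- exact: (local_biholomorphism_Phi hk hkl (frob_open (orbit_frob HF))).
- exact: Phi_image.
exact: preserves_Phi.
Qed.
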